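(* Let $1\le p<\infty$ and $g\in\mathrm{BMOA}$. Then $$T_g(H^\infty)+\mathbb{C}\subseteq V_g^p.$$ Moreover, if there exist functions $u\in\mathrm{BMOA}$ and $B\in H^\infty$ such that $g'=Bu'$, then $V_g^p\subseteq V_u^p$.
   Context: $\mathbb{D}$ is the open unit disc of $\mathbb{C}$; $\mathrm{Hol}(\mathbb{D})$ is the set of holomorphic functions on $\mathbb{D}$. $H^p$ ($0<p<\infty$) is the Hardy space of $f\in\mathrm{Hol}(\mathbb{D})$ with $\|f\|_{H^p}^p=\sup_{0\le r<1}\int_0^{2\pi}|f(re^{it})|^p\frac{dt}{2\pi}<\infty$; $H^\infty$ is the space of bounded holomorphic functions on $\mathbb{D}$. $\mathrm{BMOA}$ consists of all $f\in H^2$ with $\|f\|_*:=\sup_{a\in\mathbb{D}}\|f\circ\varphi_a-f(a)\|_{H^2}<\infty$, where $\varphi_a(z)=\frac{z-a}{1-\overline{a}z}$. For $g,f\in\mathrm{Hol}(\mathbb{D})$, $T_g(f)(z)=\int_0^z f(\zeta)g'(\zeta)\,d\zeta$; $T_g(H^\infty)=\{T_g(k):k\in H^\infty\}$. The holomorphic optimal domain is $[T_g,H^p]=\{f\in\mathrm{Hol}(\mathbb{D}): T_g(f)\in H^p\}$. Define $V_g^p=\{h\in\mathrm{BMOA}:[T_h,H^p]\supseteq[T_g,H^p]\}$.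
   Formalization: The BMOA seminorm uses φ_a(z)=(a−z)/(1−āz) instead of (z−a)/(1−āz), so that φ_a(0)=a; with the printed sign the first inclusion fails, e.g. for g=log(1/(1−z²)) and k(z)=z. *)

(* Defs.v *)
From Stdlib Require Import Reals.
From Coquelicot Require Import Coquelicot.
Open Scope R_scope.

(* Functions on the open unit disc are represented by total functions C -> C.
   Every notion below only depends on the values taken on the disc. *)

Definition unit_disc (z : C) : Prop := Cmod z < 1.

Definition Hol (f : C -> C) : Prop :=
  forall z : C, unit_disc z -> @ex_derive C_AbsRing C_NormedModule f z.

Definition cis (t : R) : C := (cos t, sin t).

(* x^p for x >= 0 and p > 0; Stdlib's [Rpower 0 p] is 1. *)
Definition rpow (x p : R) : R :=
  if Req_EM_T x 0 then 0 else Rpower x p.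

Definition circle_mean (p : R) (f : C -> C) (r : R) : R :=
  / (2 * PI) *
    RInt (fun t : R => rpow (Cmod (f (RtoC r * cis t)%C)) p) 0 (2 * PI).

Definition Hp_norm_pow (p : R) (f : C -> C) : Rbar :=
  Lub_Rbar (fun x : R => exists r : R, 0 <= r < 1 /\ x = circle_mean p f r).

(* The [m_infty] branch is never reached: [Hp_norm_pow] is the least upper
   bound of a nonempty set of reals. *)
Definition Hp_norm (p : R) (f : C -> C) : Rbar :=
  match Hp_norm_pow p f with
  | Finite x => Finite (rpow x (/ p))
  | p_infty => p_infty
  | m_infty => m_infty
  end.

Definition Hardy (p : R) (f : C -> C) : Prop :=
  Hol f /\ Rbar_lt (Hp_norm_pow p f) p_infty.

Definition Hinf (f : C -> C) : Prop :=
  Hol f /\ exists M : R, forall z : C, unit_disc z -> Cmod (f z) <= M.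

(* The disc automorphism exchanging 0 and a. The numerator is a - z and not
   z - a: the seminorm of BMOA subtracts f(a), which has to be the value at 0
   of f o phi_a. *)
Definition phi (a z : C) : C := ((a - z) / (1 - Cconj a * z))%C.

Definition BMOA_seminorm (f : C -> C) : Rbar :=
  Rbar_lub (fun y : Rbar => exists a : C,
    unit_disc a /\ y = Hp_norm 2 (fun z : C => (f (phi a z) - f a)%C)).

Definition BMOA (f : C -> C) : Prop :=
  Hardy 2 f /\ Rbar_lt (BMOA_seminorm f) p_infty.

(* The integral of f g' from 0 to z, along the segment t |-> t z. *)
Definition T_op (g f : C -> C) (z : C) : C :=
  RInt (V := C_R_CompleteNormedModule)
    (fun t : R => (f (RtoC t * z) * C_derive g (RtoC t * z) * z)%C) 0 1.

(* [T_g, H^p] *)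
Definition optimal_domain (g : C -> C) (p : R) (f : C -> C) : Prop :=
  Hol f /\ Hardy p (T_op g f).

(* V_g^p *)
Definition V_class (g : C -> C) (p : R) (h : C -> C) : Prop :=
  BMOA h /\
  forall f : C -> C, optimal_domain g p f -> optimal_domain h p f.

(* T_g(H^inf) + C *)
Definition T_Hinf_plus_C (g h : C -> C) : Prop :=
  exists (k : C -> C) (c : C),
    Hinf k /\ forall z : C, unit_disc z -> h z = (T_op g k z + c)%C.

(* Main.v *)
(* Both inclusions reduce to one estimate: if [G' = k F'] with [|k| <= M] and
   [|G 0| <= M], then the p-means of [G] are at most [A (p-means of F + 1)] with
   [A] depending on [p] and [M] only.  It is applied to [F = T_g f],
   [G = T_h f], and, with [p = 2], to [F = g o phi_a - g a],
   [G = h o phi_a - h a] for the seminorm of BMOA.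

   Put [q = p/2], [X = |F|^2 + 1] and [N = l X + |G|^2].  For suitable [l], [K] the
   function [K X N^(q-1) - N^q] (if [q >= 1]), resp. [K X^q - N^q] (if
   [q < 1], [l = 1]), is subharmonic, because [|G'| <= M |F'|]; by the sub-mean
   value property the means of [N^q] are bounded by those of [K X N^(q-1)],
   resp. [K X^q], and [K X N^(q-1) <= N^q / 2 + A X^q].

   The derivative of a function that is merely complex differentiable must be
   shown to be holomorphic.  Bisection gives Green's inequality for forms
   that are differentiable at each point; in logarithmic polar coordinates it
   yields [f'(z)] as the circular mean of [(f(z + e^w) - f(z)) e^(-w)], hence
   Cauchy estimates, a local Lipschitz bound for [f'], and then [f'']. *)

Require Import Defs.
From Stdlib Require Import Reals.
From Coquelicot Require Import Coquelicot.
From Stdlib Require Import Lra Lia Classical ClassicalEpsilon.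
Open Scope R_scope.
Set Bullet Behavior "Strict Subproofs".

(** * Green's inequality on rectangles *)

(** [|F|^p] need not be smooth at the zeros of [F]. The [1] in [X] removes this obstacle: with
    [l >= 1] both [X] and [N] are at least 1 and all their powers are differentiable. Its price is
    the [1] next to the means of [F]. The cases differ by the sign of [r = q - 1]. If [r < 0], the
    Laplacian of [X^q] loses the term [r |grad X|^2 / X], at most half of the Laplacian of [X]
    because [r >= -1/2], that is [p >= 1]. If [r >= 0], the Laplacian of [N^q] has size [N^r] times
    that of [N], and [X^r] does not control [N^r] where [|G|] is much larger than [|F|]; hence the
    mixed product [X N^r]. Laplacians need two derivatives of [F] and [G], while [Hol] gives one;
    the same gap separates [T_g f] from being a primitive of [f g']. Logarithmic coordinates turn
    circles about a point into sides of rectangles, and periodicity in the angle cancels the other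
    two sides. Composition with [phi_a] multiplies both derivatives by [phi_a'], so the bound on
    their ratio keeps its constant. *)

(** An induction principle replacing compactness: a rectangle without the property has a quarter
    without it, and the nested quarters shrink to a point, where the local hypothesis contradicts
    their choice. *)
Lemma quadrisection (Pr : R -> R -> R -> R -> Prop) :
  (forall a b c d, a <= b -> c <= d ->
     let m := (a + b) / 2 in let n := (c + d) / 2 in
     Pr a m c n -> Pr m b c n -> Pr a m n d -> Pr m b n d -> Pr a b c d) ->
  forall a b c d, a <= b -> c <= d ->
  (forall x y, a <= x <= b -> c <= y <= d -> exists del : posreal,
     forall a' b' c' d', a <= a' <= x -> x <= b' <= b -> c <= c' <= y -> y <= d' <= d ->
       b' - a' < del -> d' - c' < del -> Pr a' b' c' d') ->
  Pr a b c d.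
Proof.
intros Hquad a b c d Hab Hcd Hloc.
apply NNPP; intros Hbad.
set (T := (R * R * R * R)%type).
set (ok := fun q : T => let '(a', b', c', d') := q in
   a <= a' /\ a' <= b' /\ b' <= b /\ c <= c' /\ c' <= d' /\ d' <= d /\ ~ Pr a' b' c' d').
(* The premise [ok q] stands under the existential, so that [choice] yields a total function
   [next]. *)
assert (Hstep : forall q : T, exists q' : T, ok q -> ok q' /\
   let '(a1, b1, c1, d1) := q in let '(a2, b2, c2, d2) := q' in
   a1 <= a2 /\ b2 <= b1 /\ c1 <= c2 /\ d2 <= d1 /\
   b2 - a2 = (b1 - a1) / 2 /\ d2 - c2 = (d1 - c1) / 2).
{ intros [[[a1 b1] c1] d1].
  destruct (classic (ok (a1, b1, c1, d1))) as [Hok | Hno];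
    [ | exists (a1, b1, c1, d1); intros; contradiction].
  generalize Hok; intros (H1 & H2 & H3 & H4 & H5 & H6 & H7).
  specialize (Hquad a1 b1 c1 d1 H2 H5); cbv zeta in Hquad.
  destruct (classic (Pr a1 ((a1 + b1) / 2) c1 ((c1 + d1) / 2))) as [P1 | P1].
  2: exists (a1, (a1 + b1) / 2, c1, (c1 + d1) / 2); intros _; unfold ok; repeat split; auto; lra.
  destruct (classic (Pr ((a1 + b1) / 2) b1 c1 ((c1 + d1) / 2))) as [P2 | P2].
  2: exists ((a1 + b1) / 2, b1, c1, (c1 + d1) / 2); intros _; unfold ok; repeat split; auto; lra.
  destruct (classic (Pr a1 ((a1 + b1) / 2) ((c1 + d1) / 2) d1)) as [P3 | P3].
  2: exists (a1, (a1 + b1) / 2, (c1 + d1) / 2, d1); intros _; unfold ok; repeat split; auto; lra.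
  destruct (classic (Pr ((a1 + b1) / 2) b1 ((c1 + d1) / 2) d1)) as [P4 | P4].
  2: exists ((a1 + b1) / 2, b1, (c1 + d1) / 2, d1); intros _; unfold ok; repeat split; auto; lra.
  exfalso; auto. }
destruct (choice _ Hstep) as [next Hnext].
set (q := fix q n := match n with O => (a, b, c, d) | S n => next (q n) end).
assert (Hok : forall n, ok (q n)).
{ induction n as [ | n IH]; simpl.
  - repeat split; auto; lra.
  - apply Hnext, IH. }
set (A := fun n => fst (fst (fst (q n)))).
set (B := fun n => snd (fst (fst (q n)))).
set (C' := fun n => snd (fst (q n))).
set (D := fun n => snd (q n)).
assert (Hb : forall n, a <= A n /\ A n <= B n /\ B n <= b /\ c <= C' n /\ C' n <= D n /\ D n <= d
   /\ ~ Pr (A n) (B n) (C' n) (D n)).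
{ intros n. generalize (Hok n). unfold A, B, C', D.
  destruct (q n) as [[[a1 b1] c1] d1]. simpl. tauto. }
assert (Hs : forall n, A n <= A (S n) /\ B (S n) <= B n /\ C' n <= C' (S n) /\ D (S n) <= D n /\
   B (S n) - A (S n) = (B n - A n) / 2 /\ D (S n) - C' (S n) = (D n - C' n) / 2).
{ intros n. generalize (proj2 (Hnext (q n) (Hok n))). unfold A, B, C', D.
  change (q (S n)) with (next (q n)).
  destruct (q n) as [[[a1 b1] c1] d1]. destruct (next _) as [[[a2 b2] c2] d2]. simpl. tauto. }
assert (Hlen : forall n, B n - A n = (b - a) * (/ 2) ^ n /\ D n - C' n = (d - c) * (/ 2) ^ n).
{ induction n as [ | n [IH1 IH2]].
  - unfold A, B, C', D; simpl; lra.
  - destruct (Hs n) as (_ & _ & _ & _ & -> & ->). rewrite IH1, IH2. simpl; lra. }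
assert (mono : forall (u : nat -> R) , (forall n, u n <= u (S n)) -> forall n m, (n <= m)%nat -> u n <= u m).
{ intros u Hu n m Hnm. induction Hnm; [lra | ]. specialize (Hu m). lra. }
assert (lim : forall u v : nat -> R, (forall n, u n <= u (S n)) -> (forall n, v (S n) <= v n) ->
   (forall n, u n <= v n) -> exists x, forall n, u n <= x <= v n).
{ intros u v Hu Hv Huv.
  assert (Huv' : forall n m, u n <= v m).
  { intros n m.
    apply Rle_trans with (u (max n m)). apply mono; auto; lia.
    apply Rle_trans with (v (max n m)). auto.
    assert (H := mono (fun n => - v n)). simpl in H.
    specialize (H (fun k => Ropp_le_contravar _ _ (Hv k)) m (max n m) (Nat.le_max_r _ _)). lra. }
  destruct (completeness (fun y => exists n, y = u n)) as [x [Hx1 Hx2]].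
  - exists (v 0%nat). intros y [n ->]. auto.
  - exists (u 0%nat), 0%nat. auto.
  - exists x. intros n. split.
    + apply Hx1. exists n; auto.
    + apply Hx2. intros y [m ->]. auto. }
destruct (lim A B) as [x Hx]; try (intros n; generalize (Hs n), (Hb n); tauto).
destruct (lim C' D) as [y Hy]; try (intros n; generalize (Hs n), (Hb n); tauto).
destruct (Hloc x y) as [del Hdel].
{ generalize (Hx 0%nat); unfold A, B; simpl; tauto. }
{ generalize (Hy 0%nat); unfold C', D; simpl; tauto. }
assert (Hpow : exists n, (b - a) * (/ 2) ^ n < del /\ (d - c) * (/ 2) ^ n < del).
(* Dividing by [1 + (b - a) + (d - c)] makes one power of [/ 2] serve for both side lengths, even
   when they vanish. *)
{ destruct (pow_lt_1_zero (/ 2)) with (y := del / (1 + (b - a) + (d - c))) as [n Hn].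
  - rewrite Rabs_pos_eq; lra.
  - apply Rdiv_lt_0_compat; [apply cond_pos | lra].
  - exists n. specialize (Hn n (le_n _)).
    rewrite Rabs_pos_eq in Hn by (apply pow_le; lra).
    assert (0 <= (/ 2) ^ n) by (apply pow_le; lra).
    apply (Rmult_lt_compat_r (1 + (b - a) + (d - c))) in Hn; [ | lra].
    unfold Rdiv in Hn. rewrite Rmult_assoc, Rinv_l, Rmult_1_r in Hn by lra.
    split; nra. }
destruct Hpow as [n [Hn1 Hn2]].
destruct (Hb n) as (H1 & H2 & H3 & H4 & H5 & H6 & H7).
apply H7. specialize (Hx n). specialize (Hy n). destruct (Hlen n) as [L1 L2].
apply Hdel; lra.
Qed.

Lemma dpl_slice_x P x y px py :
  differentiable_pt_lim P x y px py -> is_derive (fun u => P u y) x px.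
Proof.
intros H. apply is_derive_Reals.
replace px with (px * 1 + py * 0) by ring.
apply (derivable_pt_lim_comp_2d P (fun u => u) (fun _ => y)); auto.
apply derivable_pt_lim_id. apply derivable_pt_lim_const.
Qed.

Lemma dpl_slice_y P x y px py :
  differentiable_pt_lim P x y px py -> is_derive (fun v => P x v) y py.
Proof.
intros H. apply is_derive_Reals.
replace py with (px * 0 + py * 1) by ring.
apply (derivable_pt_lim_comp_2d P (fun _ => x) (fun v => v)); auto.
apply derivable_pt_lim_const. apply derivable_pt_lim_id.
Qed.

Lemma continuous_slice_x P x y px py :
  differentiable_pt_lim P x y px py -> continuous (fun u => P u y) x.
Proof. intros H. apply (ex_derive_continuous (fun u => P u y)). eexists. eapply dpl_slice_x, H. Qed.

Lemma continuous_slice_y P x y px py :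
  differentiable_pt_lim P x y px py -> continuous (fun v => P x v) y.
Proof. intros H. apply (ex_derive_continuous (fun v => P x v)). eexists. eapply dpl_slice_y, H. Qed.

(** The integral of [P dx + Q dy] along the counterclockwise boundary. Opposite sides share one
    integral, so that estimates act on the difference of the two values. *)
Definition circulation (P Q : R -> R -> R) (a b c d : R) : R :=
  RInt (fun x => P x c - P x d) a b + RInt (fun y => Q b y - Q a y) c d.

Lemma ex_RInt_diff (f g : R -> R) (a b : R) :
  a <= b -> (forall x, a <= x <= b -> continuous f x) -> (forall x, a <= x <= b -> continuous g x) ->
  ex_RInt (fun x => f x - g x) a b.
Proof.
intros Hab Hf Hg. apply (ex_RInt_continuous (fun x => f x - g x)). intros x.
rewrite Rmin_left, Rmax_right by auto. intros Hx.
apply (continuous_minus f g); auto.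
Qed.

(** The integrals over the inner sides cancel. *)
Lemma circulation_quad (P Q : R -> R -> R) a b c d :
  a <= b -> c <= d ->
  (forall x y, a <= x <= b -> c <= y <= d -> continuous (fun u => P u y) x) ->
  (forall x y, a <= x <= b -> c <= y <= d -> continuous (fun v => Q x v) y) ->
  let m := (a + b) / 2 in let n := (c + d) / 2 in
  circulation P Q a b c d = circulation P Q a m c n + circulation P Q m b c n
    + circulation P Q a m n d + circulation P Q m b n d.
Proof.
intros Hab Hcd HP HQ m n.
assert (Hm : a <= m <= b) by (unfold m; lra).
assert (Hn : c <= n <= d) by (unfold n; lra).
unfold circulation.
assert (EP : forall y1 y2 a' b', a <= a' <= b' -> b' <= b -> c <= y1 <= d -> c <= y2 <= d ->
  ex_RInt (fun x => P x y1 - P x y2) a' b').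
{ intros. apply (ex_RInt_diff (fun x => P x y1) (fun x => P x y2)); try lra;
  intros; apply HP; lra. }
assert (EQ : forall x1 x2 c' d', c <= c' <= d' -> d' <= d -> a <= x1 <= b -> a <= x2 <= b ->
  ex_RInt (fun y => Q x1 y - Q x2 y) c' d').
{ intros. apply (ex_RInt_diff (fun y => Q x1 y) (fun y => Q x2 y)); try lra;
  intros; apply HQ; lra. }
rewrite <- (RInt_Chasles (fun x => P x c - P x d) a m b) by (apply EP; lra).
rewrite <- (RInt_Chasles (fun y => Q b y - Q a y) c n d) by (apply EQ; lra).
assert (SP : forall a' b', a <= a' <= b' -> b' <= b ->
  RInt (fun x => P x c - P x d) a' b' =
  RInt (fun x => P x c - P x n) a' b' + RInt (fun x => P x n - P x d) a' b').
{ intros. rewrite <- (RInt_plus (V := R_CompleteNormedModule)) by (apply EP; lra).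
  apply RInt_ext. intros. unfold plus; simpl. ring. }
assert (SQ : forall a' b', c <= a' <= b' -> b' <= d ->
  RInt (fun x => Q b x - Q a x) a' b' =
  RInt (fun x => Q b x - Q m x) a' b' + RInt (fun x => Q m x - Q a x) a' b').
{ intros. rewrite <- (RInt_plus (V := R_CompleteNormedModule)) by (apply EQ; lra).
  apply RInt_ext. intros. unfold plus; simpl. ring. }
rewrite !SP, !SQ by lra. unfold plus; simpl. ring.
Qed.

Lemma RInt_ge_const (f : R -> R) a b m :
  a <= b -> ex_RInt f a b -> (forall x, a <= x <= b -> m <= f x) -> m * (b - a) <= RInt f a b.
Proof.
intros Hab Hf Hm.
replace (m * (b - a)) with (RInt (fun _ => m) a b)
  by (rewrite RInt_const; unfold scal; simpl; unfold mult; simpl; ring).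
apply RInt_le; auto. apply ex_RInt_const. intros; apply Hm; lra.
Qed.

(* No continuity of the partial derivatives is needed: the property
   [circulation >= - eps (width + height)^2] is inherited from the four
   quarters of a rectangle, and holds on small rectangles containing a given
   point by differentiability there. *)
Lemma green_ge (P Q : R -> R -> R) a b c d :
  a <= b -> c <= d ->
  (forall x y, a <= x <= b -> c <= y <= d -> exists px py qx qy,
     differentiable_pt_lim P x y px py /\ differentiable_pt_lim Q x y qx qy /\ 0 <= qx - py) ->
  0 <= circulation P Q a b c d.
Proof.
intros Hab Hcd H.
assert (HP : forall x y, a <= x <= b -> c <= y <= d -> continuous (fun u => P u y) x).
{ intros x y Hx Hy. destruct (H x y Hx Hy) as (px & py & qx & qy & H1 & _).
  eapply continuous_slice_x, H1. }
assert (HQ : forall x y, a <= x <= b -> c <= y <= d -> continuous (fun v => Q x v) y).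
{ intros x y Hx Hy. destruct (H x y Hx Hy) as (px & py & qx & qy & _ & H1 & _).
  eapply continuous_slice_y, H1. }
(* The square matters: halving width and height divides the bound by exactly four, so the bounds of
   the quarters add up to that of the whole. *)
assert (Main : forall eps : posreal, - (4 * eps) * (b - a + (d - c)) ^ 2 <= circulation P Q a b c d).
{ intros eps.
  apply (quadrisection (fun a' b' c' d' => a <= a' -> b' <= b -> c <= c' -> d' <= d ->
     - (4 * eps) * (b' - a' + (d' - c')) ^ 2 <= circulation P Q a' b' c' d')) with (a := a) (b := b) (c := c) (d := d); try lra.
  - intros a' b' c' d' Hab' Hcd' m n H1 H2 H3 H4 Ha Hb Hc Hd.
    assert (Hm : a' <= m <= b') by (unfold m; lra).
    assert (Hn : c' <= n <= d') by (unfold n; lra).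
    rewrite circulation_quad; auto.
    2: intros; apply HP; lra. 2: intros; apply HQ; lra.
    fold m n.
    specialize (H1 ltac:(lra) ltac:(lra) ltac:(lra) ltac:(lra)).
    specialize (H2 ltac:(lra) ltac:(lra) ltac:(lra) ltac:(lra)).
    specialize (H3 ltac:(lra) ltac:(lra) ltac:(lra) ltac:(lra)).
    specialize (H4 ltac:(lra) ltac:(lra) ltac:(lra) ltac:(lra)).
    unfold m, n in *.
    replace (- (4 * eps) * (b' - a' + (d' - c')) ^ 2)
      with (4 * (- (4 * eps) * (((a' + b') / 2 - a') + ((c' + d') / 2 - c')) ^ 2)) by field.
    replace (b' - (a' + b') / 2) with ((a' + b') / 2 - a') in * by field.
    replace (d' - (c' + d') / 2) with ((c' + d') / 2 - c') in * by field.
    lra.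
  - intros x y Hx Hy.
    destruct (H x y Hx Hy) as (px & py & qx & qy & H1 & H2 & H3).
    destruct (H1 eps) as [d1 Hd1]. destruct (H2 eps) as [d2 Hd2].
    assert (Hdel : 0 < Rmin d1 d2) by (apply Rmin_pos; apply cond_pos).
    exists (mkposreal _ Hdel). simpl.
    intros a' b' c' d' Ha' Hb' Hc' Hd' L1 L2 _ _ _ _.
    set (l := b' - a') in *. set (h := d' - c') in *.
    assert (Rmin d1 d2 <= d1 /\ Rmin d1 d2 <= d2) as [M1 M2]
      by (split; [apply Rmin_l | apply Rmin_r]).
    assert (eP : forall u v, a' <= u <= b' -> c' <= v <= d' ->
       Rabs (P u v - P x y - (px * (u - x) + py * (v - y))) <= eps * (l + h)).
    { intros u v Hu Hv. eapply Rle_trans. apply Hd1; apply Rabs_def1; unfold l, h in *; lra.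
      apply Rmult_le_compat_l. apply Rlt_le, cond_pos.
      apply Rmax_lub; apply Rabs_le; unfold l, h in *; lra. }
    assert (eQ : forall u v, a' <= u <= b' -> c' <= v <= d' ->
       Rabs (Q u v - Q x y - (qx * (u - x) + qy * (v - y))) <= eps * (l + h)).
    { intros u v Hu Hv. eapply Rle_trans. apply Hd2; apply Rabs_def1; unfold l, h in *; lra.
      apply Rmult_le_compat_l. apply Rlt_le, cond_pos.
      apply Rmax_lub; apply Rabs_le; unfold l, h in *; lra. }
    (* In [P x c' - P x d'] the terms with [px] cancel and [- py * h] remains; each of the two
       values carries an error of at most [eps * (l + h)]. *)
    assert (I1 : (- py * h - 2 * eps * (l + h)) * l <= RInt (fun x => P x c' - P x d') a' b').
    { apply RInt_ge_const. lra.
      - apply (ex_RInt_diff (fun x => P x c') (fun x => P x d')); try lra; intros; apply HP; lra.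
      - intros u Hu. 
        assert (E1 := eP u c' Hu ltac:(lra)). assert (E2 := eP u d' Hu ltac:(lra)).
        apply Rabs_le_between in E1. apply Rabs_le_between in E2. unfold h in *. lra. }
    assert (I2 : (qx * l - 2 * eps * (l + h)) * h <= RInt (fun y => Q b' y - Q a' y) c' d').
    { apply RInt_ge_const. lra.
      - apply (ex_RInt_diff (fun y => Q b' y) (fun y => Q a' y)); try lra; intros; apply HQ; lra.
      - intros u Hu.
        assert (E1 := eQ b' u ltac:(lra) Hu). assert (E2 := eQ a' u ltac:(lra) Hu).
        apply Rabs_le_between in E1. apply Rabs_le_between in E2. unfold l in *. lra. }
    unfold circulation.
    assert (0 <= l) by (unfold l; lra). assert (0 <= h) by (unfold h; lra).
    assert (0 <= (qx - py) * (l * h)) by (apply Rmult_le_pos; auto; apply Rmult_le_pos; auto).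
    assert (0 < eps) by apply cond_pos.
    assert (0 <= eps * (l + h) ^ 2) by (apply Rmult_le_pos; [lra | apply pow2_ge_0]).
    nra. }
apply Rnot_lt_le. intros Hneg.
set (K := (b - a + (d - c)) ^ 2).
assert (HK : 0 <= K) by apply pow2_ge_0.
(* With this [eps] the bound becomes the circulation times [K / (2 * (K + 1))], a factor below 1,
   which a negative circulation cannot satisfy. *)
assert (He : 0 < - circulation P Q a b c d / (8 * (K + 1))).
{ apply Rdiv_lt_0_compat; lra. }
specialize (Main (mkposreal _ He)). cbn [pos] in Main. fold K in Main.
replace (- (4 * (- circulation P Q a b c d / (8 * (K + 1)))) * K)
  with (circulation P Q a b c d * (K / (2 * (K + 1)))) in Main by (field; lra).
assert (Hrho : K / (2 * (K + 1)) < 1).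
{ apply Rmult_lt_reg_r with (2 * (K + 1)). lra. unfold Rdiv. rewrite Rmult_assoc, Rinv_l; lra. }
assert (0 < - circulation P Q a b c d * (1 - K / (2 * (K + 1)))) by (apply Rmult_lt_0_compat; lra).
lra.
Qed.

(** * Complex derivatives *)

(** A neutral form of the complex derivative: [Hol] is stated over [C_NormedModule], the product and
    chain rules are used over [AbsRing_NormedModule C_AbsRing], and the two equivalences below
    connect both with estimates in [Cmod]. *)
Definition cdiff (f : C -> C) (z l : C) : Prop :=
  forall eps, 0 < eps -> exists del, 0 < del /\
    forall w, Cmod (w - z) < del -> Cmod (f w - f z - (w - z) * l) <= eps * Cmod (w - z).

Lemma locally_C_Cmod (z : C) (P : C -> Prop) :
  locally (T := C_UniformSpace) z P <-> exists del, 0 < del /\ forall w, Cmod (w - z) < del -> P w.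
Proof.
split.
- intros H. apply locally_C in H. destruct H as [d Hd].
  exists d. split. apply cond_pos. intros w Hw. apply Hd, Hw.
- intros [d [Hd H]]. apply locally_C. exists (mkposreal d Hd). intros w Hw. apply H, Hw.
Qed.

Lemma is_derive_cdiff (f : C -> C) z l :
  @is_derive C_AbsRing C_NormedModule f z l <-> cdiff f z l.
Proof.
split.
- intros [_ H] eps Heps.
  specialize (H z (fun P HP => HP) (mkposreal eps Heps)).
  apply locally_C, locally_C_Cmod in H. exact H.
- intros H. split. apply (is_linear_scal_l (K := C_AbsRing) (V := C_NormedModule)).
  intros x Hx. apply (is_filter_lim_locally_unique (V := AbsRing_NormedModule C_AbsRing)) in Hx. subst x. intros eps.
  apply locally_C, locally_C_Cmod. exact (H eps (cond_pos eps)).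
Qed.

Lemma is_derive_AR_cdiff (f : C -> C) z l :
  @is_derive C_AbsRing (AbsRing_NormedModule C_AbsRing) f z l <-> cdiff f z l.
Proof.
split.
- intros [_ H] eps Heps.
  specialize (H z (fun P HP => HP) (mkposreal eps Heps)).
  apply locally_C, locally_C_Cmod in H. exact H.
- intros H. split. apply (is_linear_scal_l (K := C_AbsRing) (V := AbsRing_NormedModule C_AbsRing)).
  intros x Hx. apply (is_filter_lim_locally_unique (V := AbsRing_NormedModule C_AbsRing)) in Hx. subst x. intros eps.
  apply locally_C, locally_C_Cmod. exact (H eps (cond_pos eps)).
Qed.

Lemma cdiff_const (c z : C) : cdiff (fun _ => c) z 0.
Proof. apply is_derive_AR_cdiff.
apply (is_derive_const (K := C_AbsRing) (V := AbsRing_NormedModule C_AbsRing) c z). Qed.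

Lemma cdiff_id (z : C) : cdiff (fun w => w) z 1.
Proof. apply is_derive_AR_cdiff. apply (is_derive_id (K := C_AbsRing) z). Qed.

Lemma cdiff_plus f g z l m :
  cdiff f z l -> cdiff g z m -> cdiff (fun w => f w + g w)%C z (l + m).
Proof.
rewrite <- !is_derive_AR_cdiff. intros Hf Hg.
apply (is_derive_plus (K := C_AbsRing) (V := AbsRing_NormedModule C_AbsRing) f g); auto.
Qed.

Lemma cdiff_mult f g z l m :
  cdiff f z l -> cdiff g z m -> cdiff (fun w => f w * g w)%C z (l * g z + f z * m).
Proof.
rewrite <- !is_derive_AR_cdiff. intros Hf Hg.
apply (is_derive_mult (K := C_AbsRing) f g); auto. apply Cmult_comm.
Qed.

Lemma cdiff_comp f g z l m :
  cdiff f (g z) l -> cdiff g z m -> cdiff (fun w => f (g w)) z (m * l).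
Proof.
rewrite <- !is_derive_AR_cdiff. intros Hf Hg.
apply (is_derive_comp (K := C_AbsRing) (V := AbsRing_NormedModule C_AbsRing) f g z l m); auto.
Qed.

Lemma cdiff_ext_loc f g z l del :
  0 < del -> (forall w, Cmod (w - z) < del -> f w = g w) -> cdiff f z l -> cdiff g z l.
Proof.
intros Hdel E H eps Heps. destruct (H eps Heps) as [d [Hd Hd']].
exists (Rmin d del). split. now apply Rmin_pos.
intros w Hw. rewrite <- !E.
- apply Hd'. eapply Rlt_le_trans. exact Hw. apply Rmin_l.
- replace (z - z)%C with (RtoC 0) by ring. now rewrite Cmod_0.
- eapply Rlt_le_trans. exact Hw. apply Rmin_r.
Qed.

Lemma cdiff_eq f z l m : cdiff f z l -> l = m -> cdiff f z m.
Proof. now intros H <-. Qed.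

Lemma cdiff_cont f z l : cdiff f z l -> forall eps, 0 < eps ->
  exists del, 0 < del /\ forall w, Cmod (w - z) < del -> Cmod (f w - f z) < eps.
Proof.
intros H eps Heps. destruct (H 1 Rlt_0_1) as [d [Hd Hd']].
assert (Hl : 0 <= Cmod l) by apply Cmod_ge_0.
exists (Rmin d (eps / (2 + Cmod l))). split.
- apply Rmin_pos; auto. apply Rdiv_lt_0_compat; lra.
- intros w Hw.
  assert (H1 : Cmod (w - z) < d) by (eapply Rlt_le_trans; [exact Hw | apply Rmin_l]).
  assert (H2 : Cmod (w - z) < eps / (2 + Cmod l)) by (eapply Rlt_le_trans; [exact Hw | apply Rmin_r]).
  apply Rlt_div_r in H2; [ | lra].
  specialize (Hd' w H1).
  replace (f w - f z)%C with ((f w - f z - (w - z) * l) + (w - z) * l)%C by ring.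
  eapply Rle_lt_trans. apply Cmod_triangle. rewrite Cmod_mult.
  assert (0 <= Cmod (w - z)) by apply Cmod_ge_0. nra.
Qed.

Lemma cdiff_continuous f z l : cdiff f z l -> continuous (T := C_UniformSpace) (U := C_UniformSpace) f z.
Proof.
intros H P HP. apply locally_C_Cmod in HP. destruct HP as [e [He HP]].
destruct (cdiff_cont f z l H e He) as [d [Hd Hd']].
change (locally (T := C_UniformSpace) z (fun w => P (f w))).
apply locally_C_Cmod. exists d. split; auto.
Qed.

Lemma Cmod_le_sum (x y : R) : Cmod (x, y) <= Rabs x + Rabs y.
Proof.
replace (x, y) with ((x, 0) + (0, y))%C by (unfold Cplus; simpl; f_equal; ring).
eapply Rle_trans. apply Cmod_triangle. apply Req_le. f_equal.
- apply (Cmod_R x).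
- replace (0, y) with (Ci * RtoC y)%C by (unfold Cmult; simpl; f_equal; ring).
  rewrite Cmod_mult, Cmod_Ci, Cmod_R. ring.
Qed.

Lemma fst_le_Cmod (z : C) : Rabs (fst z) <= Cmod z.
Proof. eapply Rle_trans. apply Rmax_l. apply Rmax_Cmod. Qed.
Lemma snd_le_Cmod (z : C) : Rabs (snd z) <= Cmod z.
Proof. eapply Rle_trans. apply Rmax_r. apply Rmax_Cmod. Qed.

(** The Cauchy-Riemann equations: multiplication by [l] acts on real increments by the matrix with
    rows [(fst l, - snd l)] and [(snd l, fst l)]. Halving [eps] pays for [Cmod <= 2 * Rmax]. *)
Lemma cdiff_dpl f x y l : cdiff f (x, y) l ->
  differentiable_pt_lim (fun u v => fst (f (u, v))) x y (fst l) (- snd l) /\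
  differentiable_pt_lim (fun u v => snd (f (u, v))) x y (snd l) (fst l).
Proof.
intros H.
assert (K : forall eps : posreal, exists del, 0 < del /\ forall u v, Rabs (u - x) < del -> Rabs (v - y) < del ->
  Cmod (f (u, v) - f (x, y) - ((u, v) - (x, y)) * l) <= eps * Rmax (Rabs (u - x)) (Rabs (v - y))).
{ intros eps. assert (He : 0 < eps / 2) by (generalize (cond_pos eps); lra).
  destruct (H _ He) as [d [Hd Hd']].
  exists (d / 2). split. lra. intros u v Hu Hv.
  assert (B : Cmod ((u, v) - (x, y)) <= Rabs (u - x) + Rabs (v - y)) by (apply (Cmod_le_sum (u - x) (v - y))).
  eapply Rle_trans. apply Hd'. lra.
  assert (M1 := Rmax_l (Rabs (u - x)) (Rabs (v - y))).
  assert (M2 := Rmax_r (Rabs (u - x)) (Rabs (v - y))).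
  assert (Cmod ((u, v) - (x, y)) <= 2 * Rmax (Rabs (u - x)) (Rabs (v - y))) by lra.
  nra. }
split; intros eps; destruct (K eps) as [d [Hd Hd']]; exists (mkposreal d Hd); intros u v Hu Hv;
  eapply Rle_trans; [ | apply (Hd' u v Hu Hv) | | apply (Hd' u v Hu Hv)].
- eapply Rle_trans; [ | apply fst_le_Cmod]. simpl. apply Req_le. f_equal. ring.
- eapply Rle_trans; [ | apply snd_le_Cmod]. simpl. apply Req_le. f_equal. ring.
Qed.

Lemma dpl_cdiff f x y l :
  differentiable_pt_lim (fun u v => fst (f (u, v))) x y (fst l) (- snd l) ->
  differentiable_pt_lim (fun u v => snd (f (u, v))) x y (snd l) (fst l) ->
  cdiff f (x, y) l.
Proof.
intros H1 H2 eps Heps.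
assert (He : 0 < eps / 2) by lra.
destruct (H1 (mkposreal _ He)) as [d1 Hd1]. destruct (H2 (mkposreal _ He)) as [d2 Hd2].
exists (Rmin d1 d2). split. apply Rmin_pos; apply cond_pos.
intros [u v] Hw.
assert (Ru : Rabs (u - x) <= Cmod ((u, v) - (x, y))) by apply (fst_le_Cmod ((u, v) - (x, y))).
assert (Rv : Rabs (v - y) <= Cmod ((u, v) - (x, y))) by apply (snd_le_Cmod ((u, v) - (x, y))).
assert (m1 := Rmin_l d1 d2). assert (m2 := Rmin_r d1 d2).
specialize (Hd1 u v ltac:(lra) ltac:(lra)). specialize (Hd2 u v ltac:(lra) ltac:(lra)).
cbn [pos] in Hd1, Hd2.
assert (HM : Rmax (Rabs (u - x)) (Rabs (v - y)) <= Cmod ((u, v) - (x, y))) by (apply Rmax_lub; auto).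
rewrite (surjective_pairing (f (u, v) - f (x, y) - ((u, v) - (x, y)) * l)%C).
eapply Rle_trans. apply Cmod_le_sum.
replace (fst (f (u, v) - f (x, y) - ((u, v) - (x, y)) * l)%C) with
  (fst (f (u, v)) - fst (f (x, y)) - (fst l * (u - x) + - snd l * (v - y))) by (simpl; ring).
replace (snd (f (u, v) - f (x, y) - ((u, v) - (x, y)) * l)%C) with
  (snd (f (u, v)) - snd (f (x, y)) - (snd l * (u - x) + fst l * (v - y))) by (simpl; ring).
nra.
Qed.

(** * Complex exponential and calculus of real differentiability in two variables *)

Definition cexp (w : C) : C := (exp (fst w) * cos (snd w), exp (fst w) * sin (snd w)).

Lemma cexp_polar s t : cexp (s, t) = (RtoC (exp s) * cis t)%C.
Proof. unfold cexp, cis, Cmult, RtoC; simpl. f_equal; ring. Qed.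

Lemma Cmod_cis t : Cmod (cis t) = 1.
Proof.
unfold Cmod, cis; simpl. rewrite !Rmult_1_r, <- sqrt_1. f_equal.
generalize (sin2_cos2 t). unfold Rsqr. lra.
Qed.

Lemma Cmod_cexp w : Cmod (cexp w) = exp (fst w).
Proof.
destruct w as [s t]. rewrite cexp_polar, Cmod_mult, Cmod_cis, Cmod_R, Rmult_1_r.
apply Rabs_pos_eq, Rlt_le, exp_pos.
Qed.

Lemma dpl_fst_fun (h : R -> R) x y l : is_derive h x l -> differentiable_pt_lim (fun u _ => h u) x y l 0.
Proof. intros H. apply differentiable_pt_lim_proj1_0, is_derive_Reals, H. Qed.

Lemma dpl_swap P x y px py : differentiable_pt_lim P x y px py -> differentiable_pt_lim (fun u v => P v u) y x py px.
Proof.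
intros H eps. destruct (H eps) as [d Hd]. exists d. intros u v Hu Hv.
rewrite Rmax_comm, (Rplus_comm (py * _)). apply Hd; auto.
Qed.

Lemma dpl_snd_fun (h : R -> R) x y l : is_derive h y l -> differentiable_pt_lim (fun _ v => h v) x y 0 l.
Proof. intros H. apply (dpl_swap (fun u _ => h u)), dpl_fst_fun, H. Qed.

(** The error is exactly [(u - x) * (v - y)], so [eps] itself serves as radius. The product rule
    then follows from the chain rule. *)
Lemma dpl_mult_id x y : differentiable_pt_lim Rmult x y y x.
Proof.
intros eps. exists eps. intros u v Hu Hv.
replace (u * v - x * y - (y * (u - x) + x * (v - y))) with ((u - x) * (v - y)) by ring.
rewrite Rabs_mult. apply Rmult_le_compat; try apply Rabs_pos. apply Rlt_le, Hu. apply Rmax_r.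
Qed.

Lemma dpl_plus_id x y : differentiable_pt_lim Rplus x y 1 1.
Proof.
intros eps. exists eps. intros u v Hu Hv.
replace (u + v - (x + y) - (1 * (u - x) + 1 * (v - y))) with 0 by ring.
rewrite Rabs_R0. apply Rmult_le_pos. apply Rlt_le, cond_pos.
eapply Rle_trans. apply Rabs_pos. apply Rmax_l.
Qed.

Lemma dpl_eq P x y px py px' py' :
  differentiable_pt_lim P x y px py -> px = px' -> py = py' -> differentiable_pt_lim P x y px' py'.
Proof. now intros H <- <-. Qed.

Lemma dpl_mult P Q x y px py qx qy :
  differentiable_pt_lim P x y px py -> differentiable_pt_lim Q x y qx qy ->
  differentiable_pt_lim (fun u v => P u v * Q u v) x y
    (px * Q x y + P x y * qx) (py * Q x y + P x y * qy).
Proof.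
intros HP HQ. eapply dpl_eq.
apply (differentiable_pt_lim_comp Rmult P Q); eauto. apply dpl_mult_id.
all: ring.
Qed.

Lemma dpl_plus P Q x y px py qx qy :
  differentiable_pt_lim P x y px py -> differentiable_pt_lim Q x y qx qy ->
  differentiable_pt_lim (fun u v => P u v + Q u v) x y (px + qx) (py + qy).
Proof.
intros HP HQ. eapply dpl_eq.
apply (differentiable_pt_lim_comp Rplus P Q); eauto. apply dpl_plus_id.
all: ring.
Qed.

Lemma dpl_const c x y : differentiable_pt_lim (fun _ _ => c) x y 0 0.
Proof. apply (dpl_fst_fun (fun _ => c)). apply (is_derive_const (K := R_AbsRing) (V := R_NormedModule)). Qed.

Lemma dpl_comp1 (h : R -> R) P x y px py l :
  is_derive h (P x y) l -> differentiable_pt_lim P x y px py ->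
  differentiable_pt_lim (fun u v => h (P u v)) x y (l * px) (l * py).
Proof.
intros Hh HP. eapply dpl_eq.
apply (differentiable_pt_lim_comp (fun u _ => h u) P (fun _ _ => 0)); eauto.
apply dpl_fst_fun, Hh. apply dpl_const.
all: ring.
Qed.

Lemma dpl_opp P x y px py :
  differentiable_pt_lim P x y px py -> differentiable_pt_lim (fun u v => - P u v) x y (- px) (- py).
Proof.
intros HP. eapply dpl_eq. apply (dpl_comp1 Ropp P x y px py (-1)); auto.
auto_derive; auto. all: ring.
Qed.

Lemma cdiff_cexp w : cdiff cexp w (cexp w).
Proof.
destruct w as [s t]. apply dpl_cdiff; unfold cexp; simpl.
- eapply dpl_eq.
  + apply (dpl_mult (fun u _ => exp u) (fun _ v => cos v)).
    * apply dpl_fst_fun, is_derive_exp.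
    * apply dpl_snd_fun, is_derive_cos.
  + simpl; ring.
  + simpl; ring.
- eapply dpl_eq.
  + apply (dpl_mult (fun u _ => exp u) (fun _ v => sin v)).
    * apply dpl_fst_fun, is_derive_exp.
    * apply dpl_snd_fun, is_derive_sin.
  + simpl; ring.
  + simpl; ring.
Qed.

(** * Cauchy's theorem and the derivative of a holomorphic function *)

Lemma cdiff_along f a v t l : cdiff f (a + RtoC t * v) l ->
  is_derive (fun t => fst (f (a + RtoC t * v)%C)) t (fst (v * l)%C) /\
  is_derive (fun t => snd (f (a + RtoC t * v)%C)) t (snd (v * l)%C).
Proof.
intros H.
assert (E : forall t, (a + RtoC t * v)%C = (fst a + t * fst v, snd a + t * snd v)).
{ intros t'. unfold Cplus, Cmult, RtoC; simpl. f_equal; ring. }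
rewrite E in H. apply cdiff_dpl in H. destruct H as [H1 H2].
assert (D1 : derivable_pt_lim (fun t => fst a + t * fst v) t (fst v)) by (apply is_derive_Reals; auto_derive; auto; ring).
assert (D2 : derivable_pt_lim (fun t => snd a + t * snd v) t (snd v)) by (apply is_derive_Reals; auto_derive; auto; ring).
split.
- apply (is_derive_ext (fun t => fst (f (fst a + t * fst v, snd a + t * snd v)))).
  { intros s. now rewrite E. }
  apply is_derive_Reals.
  replace (fst (v * l)%C) with (fst l * fst v + - snd l * snd v) by (simpl; ring).
  exact (derivable_pt_lim_comp_2d _ _ _ _ _ _ _ _ H1 D1 D2).
- apply (is_derive_ext (fun t => snd (f (fst a + t * fst v, snd a + t * snd v)))).
  { intros s. now rewrite E. }
  apply is_derive_Reals.
  replace (snd (v * l)%C) with (snd l * fst v + fst l * snd v) by (simpl; ring).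
  exact (derivable_pt_lim_comp_2d _ _ _ _ _ _ _ _ H2 D1 D2).
Qed.

(** The mean value theorem is applied to the real and imaginary parts of [f w - c w] on the segment;
    the two intermediate points differ, whence the factor 2. Subtracting [c] gives Lipschitz bounds
    ([c = 0]) and Taylor remainders ([c = f' a]) alike. *)
Lemma complex_mean_value f f' a b c B :
  (forall t, 0 <= t <= 1 -> cdiff f (a + RtoC t * (b - a)) (f' (a + RtoC t * (b - a))%C) /\
     Cmod (f' (a + RtoC t * (b - a))%C - c) <= B) ->
  Cmod (f b - f a - c * (b - a)) <= 2 * B * Cmod (b - a).
Proof.
intros H. set (v := (b - a)%C) in *.
set (g := fun w => (f w + (- c) * w)%C).
assert (Hg : forall t, 0 <= t <= 1 -> cdiff g (a + RtoC t * v) (f' (a + RtoC t * v)%C - c)).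
{ intros t Ht. eapply cdiff_eq. apply cdiff_plus. apply H, Ht.
  apply cdiff_mult. apply cdiff_const. apply cdiff_id. simpl. ring. }
assert (E1 : (a + RtoC 1 * v)%C = b) by (unfold v; ring).
assert (E0 : (a + RtoC 0 * v)%C = a) by (unfold v; ring).
assert (Bd : forall t, 0 <= t <= 1 -> Cmod (v * (f' (a + RtoC t * v)%C - c)) <= Cmod v * B).
{ intros t Ht. rewrite Cmod_mult. apply Rmult_le_compat_l. apply Cmod_ge_0. apply H, Ht. }
assert (G1 := fun t Ht => proj1 (cdiff_along g a v t _ (Hg t Ht))).
assert (G2 := fun t Ht => proj2 (cdiff_along g a v t _ (Hg t Ht))).
destruct (MVT_gen (fun t => fst (g (a + RtoC t * v)%C)) 0 1 (fun t => fst (v * (f' (a + RtoC t * v)%C - c))%C))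
  as [t1 [Ht1 M1]].
{ intros t; rewrite Rmin_left, Rmax_right by lra; intros Ht. apply G1; lra. }
{ intros t; rewrite Rmin_left, Rmax_right by lra; intros Ht.
  apply continuity_pt_filterlim, (ex_derive_continuous (fun t => fst (g (a + RtoC t * v)%C))).
  eexists. apply G1; lra. }
destruct (MVT_gen (fun t => snd (g (a + RtoC t * v)%C)) 0 1 (fun t => snd (v * (f' (a + RtoC t * v)%C - c))%C))
  as [t2 [Ht2 M2]].
{ intros t; rewrite Rmin_left, Rmax_right by lra; intros Ht. apply G2; lra. }
{ intros t; rewrite Rmin_left, Rmax_right by lra; intros Ht.
  apply continuity_pt_filterlim, (ex_derive_continuous (fun t => snd (g (a + RtoC t * v)%C))).
  eexists. apply G2; lra. }
rewrite Rmin_left, Rmax_right in Ht1, Ht2 by lra.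
rewrite E1, E0 in M1, M2.
replace (f b - f a - c * v)%C with (g b - g a)%C by (unfold g, v; ring).
rewrite (surjective_pairing (g b - g a)%C).
eapply Rle_trans. apply Cmod_le_sum.
replace (fst (g b - g a)%C) with (fst (g b) - fst (g a)) by (simpl; ring).
replace (snd (g b - g a)%C) with (snd (g b) - snd (g a)) by (simpl; ring).
rewrite M1, M2, Rminus_0_r, !Rmult_1_r.
generalize (Bd t1 Ht1), (Bd t2 Ht2).
generalize (fst_le_Cmod (v * (f' (a + RtoC t1 * v)%C - c))), (snd_le_Cmod (v * (f' (a + RtoC t2 * v)%C - c))).
intros. lra.
Qed.

(** [green_ge] applied to the form and to its opposite. *)
Lemma green_eq (P Q : R -> R -> R) a b c d :
  a <= b -> c <= d ->
  (forall x y, a <= x <= b -> c <= y <= d -> exists px py qx qy,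
     differentiable_pt_lim P x y px py /\ differentiable_pt_lim Q x y qx qy /\ qx = py) ->
  circulation P Q a b c d = 0.
Proof.
intros Hab Hcd H.
assert (eP : ex_RInt (fun x => P x c - P x d) a b).
{ apply (ex_RInt_diff (fun x => P x c) (fun x => P x d)); auto; intros x Hx.
  - destruct (H x c Hx ltac:(lra)) as (? & ? & ? & ? & Hp & _). exact (continuous_slice_x P _ _ _ _ Hp).
  - destruct (H x d Hx ltac:(lra)) as (? & ? & ? & ? & Hp & _). exact (continuous_slice_x P _ _ _ _ Hp). }
assert (eQ : ex_RInt (fun y => Q b y - Q a y) c d).
{ apply (ex_RInt_diff (fun y => Q b y) (fun y => Q a y)); auto; intros y Hy.
  - destruct (H b y ltac:(lra) Hy) as (? & ? & ? & ? & _ & Hq & _). exact (continuous_slice_y Q _ _ _ _ Hq).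
  - destruct (H a y ltac:(lra) Hy) as (? & ? & ? & ? & _ & Hq & _). exact (continuous_slice_y Q _ _ _ _ Hq). }
assert (E : circulation (fun x y => - P x y) (fun x y => - Q x y) a b c d = - circulation P Q a b c d).
{ unfold circulation. rewrite Ropp_plus_distr.
  rewrite <- (RInt_opp (V := R_CompleteNormedModule) (fun x => P x c - P x d)) by exact eP.
  rewrite <- (RInt_opp (V := R_CompleteNormedModule) (fun x => Q b x - Q a x)) by exact eQ.
  f_equal; apply RInt_ext; intros; unfold opp; simpl; ring. }
apply Rle_antisym.
- apply Ropp_le_cancel. rewrite Ropp_0, <- E. apply green_ge; auto. intros x y Hx Hy.
  destruct (H x y Hx Hy) as (px & py & qx & qy & H1 & H2 & H3).
  exists (- px), (- py), (- qx), (- qy). split; [ | split]. now apply dpl_opp. now apply dpl_opp. lra.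
- apply green_ge; auto. intros x y Hx Hy.
  destruct (H x y Hx Hy) as (px & py & qx & qy & H1 & H2 & H3).
  exists px, py, qx, qy. split; [ | split]; auto. lra.
Qed.

(* The real and imaginary parts of the integral of [k dw] along the boundary. *)
Lemma holo_circulation k k' a b c d :
  a <= b -> c <= d ->
  (forall x y, a <= x <= b -> c <= y <= d -> cdiff k (x, y) (k' (x, y))) ->
  circulation (fun x y => fst (k (x, y))) (fun x y => - snd (k (x, y))) a b c d = 0 /\
  circulation (fun x y => snd (k (x, y))) (fun x y => fst (k (x, y))) a b c d = 0.
Proof.
intros Hab Hcd H.
split; apply green_eq; auto; intros x y Hx Hy; destruct (cdiff_dpl _ _ _ _ (H x y Hx Hy)) as [H1 H2].
- do 4 eexists. split; [exact H1 | split; [exact (dpl_opp _ _ _ _ _ H2) | reflexivity]].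
- do 4 eexists. split; [exact H2 | split; [exact H1 | reflexivity]].
Qed.

(** * Circular averages and Cauchy's formula for the derivative *)

Definition cont_circle (phi : R -> C) : Prop :=
  forall t, continuous (fun t => fst (phi t)) t /\ continuous (fun t => snd (phi t)) t.

(** Built from two real integrals, so that the real integration lemmas apply; bounding the
    components separately costs a factor 2 in [circle_avg_le]. *)
Definition circle_avg (phi : R -> C) : C :=
  (RInt (fun t => fst (phi t)) 0 (2 * PI) / (2 * PI), RInt (fun t => snd (phi t)) 0 (2 * PI) / (2 * PI)).

Lemma two_PI_pos : 0 < 2 * PI.
Proof. generalize PI_RGT_0; lra. Qed.

Lemma ex_RInt_cont (f : R -> R) a b : (forall t, continuous f t) -> ex_RInt f a b.
Proof. intros H. apply (ex_RInt_continuous f). auto. Qed.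

Lemma Rabs_avg_le (f : R -> R) B : (forall t, continuous f t) -> (forall t, Rabs (f t) <= B) ->
  Rabs (RInt f 0 (2 * PI) / (2 * PI)) <= B.
Proof.
intros Hf HB. assert (Hpi := two_PI_pos).
unfold Rdiv. rewrite Rabs_mult, (Rabs_pos_eq (/ _)) by (apply Rlt_le, Rinv_0_lt_compat; lra).
apply Rle_div_l. lra.
eapply Rle_trans. apply abs_RInt_le_const. lra. apply ex_RInt_cont, Hf. intros; apply HB. lra.
Qed.

Lemma circle_avg_le phi B : cont_circle phi -> (forall t, Cmod (phi t) <= B) ->
  Cmod (circle_avg phi) <= 2 * B.
Proof.
intros Hc HB. unfold circle_avg. eapply Rle_trans. apply Cmod_le_sum.
replace (2 * B) with (B + B) by ring.
apply Rplus_le_compat; apply Rabs_avg_le.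
- exact (fun t => proj1 (Hc t)).
- intros t. eapply Rle_trans. apply fst_le_Cmod. apply HB.
- exact (fun t => proj2 (Hc t)).
- intros t. eapply Rle_trans. apply snd_le_Cmod. apply HB.
Qed.

Lemma cont_circle_lin phi psi chi c :
  cont_circle phi -> cont_circle psi -> cont_circle chi ->
  cont_circle (fun t => phi t - psi t - c * chi t)%C.
Proof.
intros H1 H2 H3 t. destruct (H1 t) as [A1 B1]. destruct (H2 t) as [A2 B2]. destruct (H3 t) as [A3 B3].
split; simpl.
- apply (continuous_plus (fun t => fst (phi t) + - fst (psi t)) (fun t => - (fst c * fst (chi t) - snd c * snd (chi t)))).
  + apply (continuous_plus (fun t => fst (phi t)) (fun t => - fst (psi t))); auto.
    apply (continuous_opp (fun t => fst (psi t))); auto.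
  + apply (continuous_opp (fun t => fst c * fst (chi t) - snd c * snd (chi t))).
    apply (continuous_minus (fun t => fst c * fst (chi t)) (fun t => snd c * snd (chi t))).
    * apply (continuous_mult (fun t => fst c) (fun t => fst (chi t))); auto. apply continuous_const.
    * apply (continuous_mult (fun t => snd c) (fun t => snd (chi t))); auto. apply continuous_const.
- apply (continuous_plus (fun t => snd (phi t) + - snd (psi t)) (fun t => - (fst c * snd (chi t) + snd c * fst (chi t)))).
  + apply (continuous_plus (fun t => snd (phi t)) (fun t => - snd (psi t))); auto.
    apply (continuous_opp (fun t => snd (psi t))); auto.
  + apply (continuous_opp (fun t => fst c * snd (chi t) + snd c * fst (chi t))).
    apply (continuous_plus (fun t => fst c * snd (chi t)) (fun t => snd c * fst (chi t))).
    * apply (continuous_mult (fun t => fst c) (fun t => snd (chi t))); auto. apply continuous_const.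
    * apply (continuous_mult (fun t => snd c) (fun t => fst (chi t))); auto. apply continuous_const.
Qed.

(** The shape of one component of [phi - psi - c * chi]: multiplication by [c] mixes both components
    of [chi], hence four functions. *)
Lemma RInt_lin4 (f g h k : R -> R) a b x y :
  (forall t, continuous f t) -> (forall t, continuous g t) -> (forall t, continuous h t) -> (forall t, continuous k t) ->
  RInt (fun t => f t - g t - (x * h t + y * k t)) a b =
  RInt f a b - RInt g a b - (x * RInt h a b + y * RInt k a b).
Proof.
intros Hf Hg Hh Hk. apply (is_RInt_unique (V := R_CompleteNormedModule)).
assert (I : forall u, (forall t, continuous u t) -> is_RInt u a b (RInt (V := R_CompleteNormedModule) u a b)).
{ intros u Hu. apply (RInt_correct (V := R_CompleteNormedModule) u), ex_RInt_cont, Hu. }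
apply (is_RInt_minus (fun t => f t - g t) (fun t => x * h t + y * k t)).
apply (is_RInt_minus f g); auto.
apply (is_RInt_plus (fun t => x * h t) (fun t => y * k t)).
apply (is_RInt_scal h); auto. apply (is_RInt_scal k); auto.
Qed.

Lemma circle_avg_lin phi psi chi c :
  cont_circle phi -> cont_circle psi -> cont_circle chi ->
  circle_avg (fun t => phi t - psi t - c * chi t)%C =
  (circle_avg phi - circle_avg psi - c * circle_avg chi)%C.
Proof.
intros H1 H2 H3. assert (Hpi := two_PI_pos).
assert (f1 := fun t => proj1 (H1 t)). assert (f2 := fun t => proj1 (H2 t)). assert (f3 := fun t => proj1 (H3 t)).
assert (s1 := fun t => proj2 (H1 t)). assert (s2 := fun t => proj2 (H2 t)). assert (s3 := fun t => proj2 (H3 t)).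
assert (Ef := RInt_lin4 _ _ _ _ 0 (2 * PI) (fst c) (- snd c) f1 f2 f3 s3).
assert (Es := RInt_lin4 _ _ _ _ 0 (2 * PI) (fst c) (snd c) s1 s2 s3 f3).
unfold circle_avg, Cminus, Cplus, Copp, Cmult; simpl. f_equal.
- etransitivity.
  + apply (f_equal (fun x => x / (2 * PI))). etransitivity; [ | exact Ef].
    apply RInt_ext. intros; simpl; ring.
  + simpl; field; lra.
- etransitivity.
  + apply (f_equal (fun x => x / (2 * PI))). etransitivity; [ | exact Es].
    apply RInt_ext. intros; simpl; ring.
  + simpl; field; lra.
Qed.

(** Cauchy's theorem on the rectangle [[a, b] x [0, 2 pi]]: periodicity cancels the sides [t = 0]
    and [t = 2 pi], and the other two carry the averages. *)
Lemma holo_avg_radius k k' a b :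
  a <= b ->
  (forall s t, s <= b -> cdiff k (s, t) (k' (s, t))) ->
  (forall s, k (s, 2 * PI) = k (s, 0)) ->
  circle_avg (fun t => k (a, t)) = circle_avg (fun t => k (b, t)).
Proof.
intros Hab H Hper. assert (Hpi := two_PI_pos).
destruct (holo_circulation k k' a b 0 (2 * PI) Hab ltac:(lra)) as [H1 H2].
{ intros. apply H. lra. }
unfold circulation in H1, H2.
assert (Z : RInt (fun _ : R => 0) a b = 0) by (rewrite RInt_const; unfold scal; simpl; unfold mult; simpl; ring).
assert (Zk : forall h : C -> R, RInt (fun x => h (k (x, 0)) - h (k (x, 2 * PI))) a b = 0).
{ intros h. etransitivity; [ | exact Z]. apply RInt_ext. intros. rewrite Hper. apply Rminus_diag_eq. reflexivity. }
rewrite (Zk fst) in H1. rewrite (Zk snd) in H2.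
rewrite Rplus_0_l in H1, H2.
assert (cf : forall s t, s <= b -> continuous (fun t => fst (k (s, t))) t).
{ intros s t Hs. eapply (continuous_slice_y (fun u v => fst (k (u, v)))), cdiff_dpl, H; auto. }
assert (cs : forall s t, s <= b -> continuous (fun t => snd (k (s, t))) t).
{ intros s t Hs. eapply (continuous_slice_y (fun u v => snd (k (u, v)))), cdiff_dpl, H; auto. }
assert (Sub : forall f g : R -> R, (forall t, continuous f t) -> (forall t, continuous g t) ->
  RInt (fun t => f t - g t) 0 (2 * PI) = 0 -> RInt f 0 (2 * PI) = RInt g 0 (2 * PI)).
{ intros f g Hf Hg E. apply Rminus_diag_uniq. etransitivity; [ | exact E]. symmetry.
  apply (RInt_minus (V := R_CompleteNormedModule) f g); apply ex_RInt_cont; auto. }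
unfold circle_avg. f_equal; f_equal.
- symmetry. apply Sub; auto; intros; apply cf; lra.
- apply Sub; try (intros; apply cs; lra). etransitivity; [ | exact H1]. apply RInt_ext. intros; simpl; ring.
Qed.

Lemma Cmod_zero_of_small (w : C) : (forall eps, 0 < eps -> Cmod w <= eps) -> w = 0.
Proof.
intros H. apply Cmod_eq_0. apply Rle_antisym; [ | apply Cmod_ge_0].
apply le_epsilon. intros e He. rewrite Rplus_0_l. auto.
Qed.

Lemma exp_small eps : 0 < eps -> exists s0, forall s, s <= s0 -> exp s < eps.
Proof.
intros He. exists (ln eps - 1). intros s Hs.
rewrite <- (exp_ln eps) by auto. apply exp_increasing. lra.
Qed.

Lemma exp_mono x y : x <= y -> exp x <= exp y.
Proof. intros [H | ->]; [apply Rlt_le, exp_increasing, H | lra]. Qed.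

(* The difference quotient of [f] at [z] with increment [e^w]. *)
Definition quot (f : C -> C) (z : C) (w : C) : C := ((f (z + cexp w) - f z) * cexp (- w))%C.

Lemma cexp_opp w : (cexp w * cexp (- w))%C = 1.
Proof.
destruct w as [s t]. unfold cexp, Cmult, Copp; simpl. rewrite cos_neg, sin_neg, exp_Ropp.
assert (exp s <> 0) by (generalize (exp_pos s); lra).
unfold RtoC. f_equal.
- transitivity (Rsqr (sin t) + Rsqr (cos t)). unfold Rsqr. field; auto. apply sin2_cos2.
- field; auto.
Qed.

Lemma Cmod_cexp_opp w : Cmod (cexp (- w)) = / exp (fst w).
Proof. rewrite Cmod_cexp. simpl. apply exp_Ropp. Qed.

Lemma cexp_2PI s : cexp (s, 2 * PI) = cexp (s, 0).
Proof. unfold cexp; simpl. rewrite cos_2PI, sin_2PI, cos_0, sin_0. reflexivity. Qed.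

Lemma cdiff_opp z : cdiff Copp z (-1).
Proof.
apply (cdiff_ext_loc (fun w => -1 * w)%C) with (del := 1). lra.
{ intros; ring. }
eapply cdiff_eq. apply cdiff_mult. apply cdiff_const. apply cdiff_id. simpl; ring.
Qed.

Lemma cdiff_shift_exp f z w l : cdiff f (z + cexp w) l -> cdiff (fun w => f (z + cexp w)%C) w (cexp w * l).
Proof.
intros H. apply (cdiff_comp f (fun w => z + cexp w)%C); auto.
eapply cdiff_eq. apply cdiff_plus. apply cdiff_const. apply cdiff_cexp. ring.
Qed.

(** In the variable [w] the quotient is a product with [cexp (- w)]: no division occurs, and the
    singularity at [z] is sent to minus infinity. *)
Lemma cdiff_quot f z w l : cdiff f (z + cexp w) l ->
  cdiff (quot f z) w (l - quot f z w).
Proof.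
intros H. eapply cdiff_eq.
apply (cdiff_mult (fun w => f (z + cexp w) + - f z)%C (fun w => cexp (- w))%C).
- apply cdiff_plus. apply cdiff_shift_exp, H. apply cdiff_const.
- apply (cdiff_comp cexp Copp). apply cdiff_cexp. apply cdiff_opp.
- unfold quot. transitivity (cexp w * cexp (- w) * l - (f (z + cexp w) - f z) * cexp (- w))%C. ring.
  rewrite cexp_opp. ring.
Qed.

Lemma cont_circle_cdiff k k' s : (forall t, cdiff k (s, t) (k' (s, t))) -> cont_circle (fun t => k (s, t)).
Proof.
intros H t. split.
- eapply (continuous_slice_y (fun u v => fst (k (u, v)))), cdiff_dpl, H; auto.
- eapply (continuous_slice_y (fun u v => snd (k (u, v)))), cdiff_dpl, H; auto.
Qed.

Lemma circle_avg_const c : circle_avg (fun _ => c) = c.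
Proof.
assert (Hpi := two_PI_pos). destruct c as [x y]. unfold circle_avg. rewrite !RInt_const. unfold scal; simpl; unfold mult; simpl.
f_equal; field; lra.
Qed.

Lemma cont_circle_const c : cont_circle (fun _ => c).
Proof. intros t. split; apply continuous_const. Qed.

(** The average does not depend on the radius [e^a], and as [a] tends to minus infinity the
    difference quotient tends to [f' z] uniformly in the angle. *)
Lemma cauchy_derivative f f' z b :
  (forall w, Cmod (w - z) <= exp b -> cdiff f w (f' w)) ->
  f' z = circle_avg (fun t => quot f z (b, t)).
Proof.
intros H.
assert (Hq : forall s t, s <= b -> cdiff (quot f z) (s, t) (f' (z + cexp (s, t))%C - quot f z (s, t))).
{ intros s t Hs. apply cdiff_quot, H. replace (z + cexp (s, t) - z)%C with (cexp (s, t)) by ring.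
  rewrite Cmod_cexp. simpl. apply exp_mono; auto. }
assert (E : forall a, a <= b -> circle_avg (fun t => quot f z (a, t)) = circle_avg (fun t => quot f z (b, t))).
{ intros a Ha. apply (holo_avg_radius (quot f z) (fun w => f' (z + cexp w)%C - quot f z w)%C); auto.
  intros s. unfold quot. rewrite cexp_2PI. f_equal.
  unfold cexp; simpl. rewrite Ropp_0, cos_0, sin_0, cos_neg, sin_neg, cos_2PI, sin_2PI. f_equal; ring. }
symmetry. apply Ceq_minus. apply Cmod_zero_of_small. intros eps Heps.
destruct (H z) with (eps := eps / 2) as [d [Hd Hd']].
{ replace (z - z)%C with (RtoC 0) by ring. rewrite Cmod_0. apply Rlt_le, exp_pos. }
{ lra. }
destruct (exp_small d Hd) as [s0 Hs0].
set (a := Rmin s0 b). assert (Ha1 : a <= s0) by apply Rmin_l. assert (Ha2 : a <= b) by apply Rmin_r.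
rewrite <- (E a Ha2).
(* A vanishing third term brings the difference into the form of [circle_avg_lin]. *)
replace (circle_avg (fun t => quot f z (a, t)) - f' z)%C with
  (circle_avg (fun t => quot f z (a, t)) - circle_avg (fun _ => f' z) - 0 * circle_avg (fun _ => 0))%C
  by (rewrite !circle_avg_const; ring).
assert (Cq : cont_circle (fun t => quot f z (a, t))).
{ apply (cont_circle_cdiff (quot f z) (fun w => f' (z + cexp w)%C - quot f z w)%C). intros; apply Hq; auto. }
rewrite <- circle_avg_lin; auto using cont_circle_const.
replace eps with (2 * (eps / 2)) by field.
apply circle_avg_le. apply cont_circle_lin; auto using cont_circle_const.
intros t. specialize (Hd' (z + cexp (a, t))%C).
replace (z + cexp (a, t) - z)%C with (cexp (a, t)) in Hd' by ring.
rewrite Cmod_cexp in Hd'. specialize (Hd' (Hs0 _ Ha1)). simpl fst in Hd'.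
replace (quot f z (a, t) - f' z - 0 * 0)%C with
  ((f (z + cexp (a, t)) - f z - cexp (a, t) * f' z) * cexp (- (a, t)))%C.
2:{ unfold quot. transitivity ((f (z + cexp (a, t)) - f z) * cexp (- (a, t)) - (cexp (a, t) * cexp (- (a, t))) * f' z)%C. ring. rewrite cexp_opp. ring. }
rewrite Cmod_mult, Cmod_cexp_opp. simpl fst.
apply Rmult_le_reg_r with (exp a). apply exp_pos.
rewrite Rmult_assoc, Rinv_l by (generalize (exp_pos a); lra). lra.
Qed.

(** [quadrisection] in the role of compactness: near each point [Cmod f] exceeds its value there by
    at most 1. *)
Lemma bounded_on_rectangle (f : C -> C) a b c d :
  a <= b -> c <= d ->
  (forall x y, a <= x <= b -> c <= y <= d -> exists l, cdiff f (x, y) l) ->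
  exists M, forall x y, a <= x <= b -> c <= y <= d -> Cmod (f (x, y)) <= M.
Proof.
intros Hab Hcd H.
apply (quadrisection (fun a b c d => exists M, forall x y, a <= x <= b -> c <= y <= d -> Cmod (f (x, y)) <= M)); auto.
- clear. intros a b c d Hab Hcd m n [M1 H1] [M2 H2] [M3 H3] [M4 H4].
  exists (Rmax (Rmax M1 M2) (Rmax M3 M4)). intros x y Hx Hy.
  destruct (Rle_dec x m), (Rle_dec y n).
  + eapply Rle_trans. apply H1; lra. eapply Rle_trans; [ | apply Rmax_l]. apply Rmax_l.
  + eapply Rle_trans. apply H3; lra. eapply Rle_trans; [ | apply Rmax_r]. apply Rmax_l.
  + eapply Rle_trans. apply H2; lra. eapply Rle_trans; [ | apply Rmax_l]. apply Rmax_r.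
  + eapply Rle_trans. apply H4; lra. eapply Rle_trans; [ | apply Rmax_r]. apply Rmax_r.
- intros x y Hx Hy. destruct (H x y Hx Hy) as [l Hl].
  destruct (cdiff_cont _ _ _ Hl 1 Rlt_0_1) as [del [Hd Hd']].
  assert (Hd2 : 0 < del / 2) by lra. exists (mkposreal _ Hd2). cbn [pos].
  intros a' b' c' d' Ha Hb Hc Hd3 L1 L2. exists (Cmod (f (x, y)) + 1).
  intros u v Hu Hv. replace (f (u, v)) with (f (x, y) + (f (u, v) - f (x, y)))%C by ring.
  eapply Rle_trans. apply Cmod_triangle. apply Rplus_le_compat_l, Rlt_le, Hd'.
  eapply Rle_lt_trans. apply (Cmod_le_sum (u - x) (v - y)).
  assert (Rabs (u - x) < del / 2) by (apply Rabs_def1; lra).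
  assert (Rabs (v - y) < del / 2) by (apply Rabs_def1; lra). lra.
Qed.

(** * Cauchy estimates and differentiability of the derivative *)

Lemma locally_bounded (f f' : C -> C) z :
  unit_disc z -> (forall w, unit_disc w -> cdiff f w (f' w)) ->
  exists rho M, 0 < rho /\ Cmod z + 3 * rho < 1 /\ forall w, Cmod (w - z) <= 3 * rho -> Cmod (f w) <= M.
Proof.
intros Hz H. unfold unit_disc in *. destruct z as [x y].
(* The square of half-side [3 * rho] has its points within [6 * rho] of the centre, less than the
   distance to the unit circle. *)
set (rho := (1 - Cmod (x, y)) / 9). assert (Hr : 0 < rho) by (unfold rho; lra).
destruct (bounded_on_rectangle f (x - 3 * rho) (x + 3 * rho) (y - 3 * rho) (y + 3 * rho)) as [M HM]; try lra.
{ intros u v Hu Hv. exists (f' (u, v)). apply H.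
  replace (u, v) with ((x, y) + (u - x, v - y)%R)%C by (unfold Cplus; simpl; f_equal; ring).
  eapply Rle_lt_trans. apply Cmod_triangle.
  assert (B := Cmod_le_sum (u - x) (v - y)).
  assert (Rabs (u - x) <= 3 * rho) by (apply Rabs_le; lra).
  assert (Rabs (v - y) <= 3 * rho) by (apply Rabs_le; lra). unfold rho in *. lra. }
exists rho, M. split; [ | split]; auto. unfold rho; lra.
intros [u v] Hw. apply HM.
- assert (A := fst_le_Cmod ((u, v) - (x, y))). simpl in A.
  apply (Rle_trans _ _ _ A) in Hw. apply Rabs_le_between in Hw. lra.
- assert (A := snd_le_Cmod ((u, v) - (x, y))). simpl in A.
  apply (Rle_trans _ _ _ A) in Hw. apply Rabs_le_between in Hw. lra.
Qed.

Lemma Cmod_shift z w h : Cmod (w + h - z) <= Cmod (w - z) + Cmod h.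
Proof. replace (w + h - z)%C with ((w - z) + h)%C by ring. apply Cmod_triangle. Qed.

Lemma Cmod_segment z a b r t : 0 <= t <= 1 -> Cmod (a - z) <= r -> Cmod (b - z) <= r ->
  Cmod (a + RtoC t * (b - a) - z) <= r.
Proof.
intros Ht Ha Hb.
replace (a + RtoC t * (b - a) - z)%C with (RtoC (1 - t) * (a - z) + RtoC t * (b - z))%C
  by (rewrite RtoC_minus; ring).
eapply Rle_trans. apply Cmod_triangle. rewrite !Cmod_mult, !Cmod_R, !Rabs_pos_eq by lra.
nra.
Qed.

Lemma unit_disc_shift z w r : Cmod z + r < 1 -> Cmod (w - z) <= r -> unit_disc w.
Proof.
intros H Hw. unfold unit_disc. replace w with (z + (w - z))%C by ring.
eapply Rle_lt_trans. apply Cmod_triangle. lra.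
Qed.

Lemma Cmod_sub_triangle a b : Cmod (a - b) <= Cmod a + Cmod b.
Proof. unfold Cminus. rewrite <- (Cmod_opp b). apply Cmod_triangle. Qed.

(** The radius [3 * rho] leaves room for two losses of [rho]: [f] is bounded within [3 * rho], [f']
    within [2 * rho], and [f'] is Lipschitz within [rho]. *)
Definition holo_near (f f' : C -> C) (z : C) (rho M : R) : Prop :=
  (forall w, unit_disc w -> cdiff f w (f' w)) /\ 0 < rho /\ Cmod z + 3 * rho < 1 /\
  (forall w, Cmod (w - z) <= 3 * rho -> Cmod (f w) <= M).

Lemma quot_cont f f' z rho M w s : holo_near f f' z rho M ->
  Cmod (w - z) + exp s <= 3 * rho -> cont_circle (fun t => quot f w (s, t)).
Proof.
intros HH; generalize HH; intros (Hf & Hrho & Hz & HM) Hw. apply (cont_circle_cdiff (quot f w) (fun v => f' (w + cexp v)%C - quot f w v)%C).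
intros t. apply cdiff_quot, Hf, (unit_disc_shift z _ (3 * rho)); auto.
eapply Rle_trans. apply Cmod_shift. now rewrite Cmod_cexp.
Qed.

Lemma cauchy_derivative_disc f f' z rho M w s : holo_near f f' z rho M ->
  Cmod (w - z) + exp s <= 3 * rho ->
  f' w = circle_avg (fun t => quot f w (s, t)).
Proof.
intros HH; generalize HH; intros (Hf & Hrho & Hz & HM) Hw. apply cauchy_derivative. intros v Hv. apply Hf, (unit_disc_shift z _ (3 * rho)); auto.
replace (v - z)%C with (w + (v - w) - z)%C by ring. eapply Rle_trans. apply Cmod_shift. lra.
Qed.

(** On the circle of radius [rho] about [w] the quotient is at most [2 * M / rho]; averaging doubles
    this. *)
Lemma derivative_bound f f' z rho M w : holo_near f f' z rho M ->
  Cmod (w - z) <= 2 * rho -> Cmod (f' w) <= 4 * M / rho.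
Proof.
intros HH; generalize HH; intros (Hf & Hrho & Hz & HM) Hw. assert (Es : exp (ln rho) = rho) by now apply exp_ln.
rewrite (cauchy_derivative_disc f f' z rho M w (ln rho) HH) by lra.
replace (4 * M / rho) with (2 * (2 * M / rho)) by (field; lra).
apply circle_avg_le. apply (quot_cont f f' z rho M); auto; lra.
intros t. unfold quot. rewrite Cmod_mult, Cmod_cexp_opp. simpl fst. rewrite Es.
apply Rmult_le_compat_r. apply Rlt_le, Rinv_0_lt_compat, Hrho.
eapply Rle_trans. apply Cmod_sub_triangle.
assert (Cmod (f (w + cexp (ln rho, t))%C) <= M).
{ apply HM. eapply Rle_trans. apply Cmod_shift. rewrite Cmod_cexp. simpl. lra. }
assert (Cmod (f w) <= M) by (apply HM; lra). lra.
Qed.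

(** Both derivatives are averages over circles of the same radius. For equal increments [e] the
    quotients differ by [(f (v + e) - f (w + e)) - (f v - f w)] over [e], and each bracket is
    controlled by the Lipschitz constant [8 * M / rho] of [f]; with the factor 2 of averaging this
    makes 32. *)
Lemma derivative_lipschitz f f' z rho M v w : holo_near f f' z rho M ->
  Cmod (v - z) <= rho -> Cmod (w - z) <= rho ->
  Cmod (f' v - f' w) <= 32 * M / rho ^ 2 * Cmod (v - w).
Proof.
intros HH; generalize HH; intros (Hf & Hrho & Hz & HM) Hv Hw. assert (Es : exp (ln rho) = rho) by now apply exp_ln.
assert (Lip : forall a b, Cmod (a - z) <= 2 * rho -> Cmod (b - z) <= 2 * rho ->
  Cmod (f b - f a) <= 2 * (4 * M / rho) * Cmod (b - a)).
{ intros a b Ha Hb. replace (f b - f a)%C with (f b - f a - 0 * (b - a))%C by ring.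
  apply complex_mean_value with f'. intros t Ht.
  assert (Hs := Cmod_segment z a b (2 * rho) t Ht Ha Hb). split.
  - apply Hf, (unit_disc_shift z _ (2 * rho)); auto. lra.
  - replace (f' (a + RtoC t * (b - a)) - 0)%C with (f' (a + RtoC t * (b - a))%C) by ring.
    apply (derivative_bound f f' z rho M); auto. }
rewrite (cauchy_derivative_disc f f' z rho M v (ln rho) HH), (cauchy_derivative_disc f f' z rho M w (ln rho) HH) by lra.
assert (Cv : cont_circle (fun t => quot f v (ln rho, t))) by (apply (quot_cont f f' z rho M); auto; lra).
assert (Cw : cont_circle (fun t => quot f w (ln rho, t))) by (apply (quot_cont f f' z rho M); auto; lra).
match goal with |- Cmod (?a - ?b) <= _ => replace (a - b)%C with (a - b - 0 * circle_avg (fun _ => 0))%C by ring end.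
rewrite <- circle_avg_lin; auto using cont_circle_const.
replace (32 * M / rho ^ 2 * Cmod (v - w)) with (2 * (16 * M / rho ^ 2 * Cmod (v - w))) by (field; lra).
apply circle_avg_le. apply cont_circle_lin; auto using cont_circle_const.
intros t. set (e := cexp (ln rho, t)).
assert (He : Cmod e = rho) by (unfold e; rewrite Cmod_cexp; simpl; lra).
replace (quot f v (ln rho, t) - quot f w (ln rho, t) - 0 * 0)%C with
  (((f (v + e) - f (w + e)) - (f v - f w)) * cexp (- (ln rho, t)))%C by (unfold quot, e; ring).
rewrite Cmod_mult, Cmod_cexp_opp. simpl fst. rewrite Es.
apply Rmult_le_reg_r with rho; auto. rewrite Rmult_assoc, Rinv_l, Rmult_1_r by lra.
eapply Rle_trans. apply Cmod_sub_triangle.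
assert (L1 := Lip (w + e)%C (v + e)%C).
assert (L2 := Lip w v ltac:(lra) ltac:(lra)).
replace (v + e - (w + e))%C with (v - w)%C in L1 by ring.
assert (Sv := Cmod_shift z v e). assert (Sw := Cmod_shift z w e).
specialize (L1 ltac:(lra) ltac:(lra)).
replace (16 * M / rho ^ 2 * Cmod (v - w) * rho) with
  (2 * (4 * M / rho) * Cmod (v - w) + 2 * (4 * M / rho) * Cmod (v - w)) by (field; lra).
lra.
Qed.

Lemma continuous_C_iff (h : C -> C) (z : C) :
  continuous (T := C_UniformSpace) (U := C_UniformSpace) h z <->
  forall eps, 0 < eps -> exists del, 0 < del /\ forall w, Cmod (w - z) < del -> Cmod (h w - h z) < eps.
Proof.
split.
- intros H eps Heps. apply (locally_C_Cmod z (fun w => Cmod (h w - h z) < eps)).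
  apply (H (fun v => Cmod (v - h z) < eps)). apply locally_C_Cmod. exists eps. auto.
- intros H P HP. apply locally_C_Cmod in HP. destruct HP as [e [He HP]].
  destruct (H e He) as [d [Hd Hd']].
  change (locally (T := C_UniformSpace) z (fun w => P (h w))).
  apply locally_C_Cmod. exists d. split; auto.
Qed.

Lemma derivative_continuous f f' (z : C) : (forall w, unit_disc w -> cdiff f w (f' w)) -> unit_disc z ->
  continuous (T := C_UniformSpace) (U := C_UniformSpace) f' z.
Proof.
intros Hf Hz. destruct (locally_bounded f f' z Hz Hf) as (rho & M & Hrho & Hz3 & HM).
apply continuous_C_iff. intros eps Heps.
set (L := 32 * M / rho ^ 2).
exists (Rmin rho (eps / (Rabs L + 1))). split.
- apply Rmin_pos; auto. apply Rdiv_lt_0_compat; auto. generalize (Rabs_pos L); lra.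
- intros w Hw. assert (Ez : Cmod (z - z) = 0) by (replace (z - z)%C with (RtoC 0) by ring; apply Cmod_0).
  assert (H1 : Cmod (w - z) < rho) by (eapply Rlt_le_trans; [exact Hw | apply Rmin_l]).
  assert (H2 : Cmod (w - z) < eps / (Rabs L + 1)) by (eapply Rlt_le_trans; [exact Hw | apply Rmin_r]).
  apply Rlt_div_r in H2; [ | generalize (Rabs_pos L); lra].
  eapply Rle_lt_trans. apply (derivative_lipschitz f f' z rho M); try lra. split; auto.
  fold L. generalize (Rle_abs L), (Cmod_ge_0 (w - z)). nra.
Qed.

Lemma continuous_pair (phi : R -> C) t :
  continuous (fun t => fst (phi t)) t -> continuous (fun t => snd (phi t)) t ->
  continuous (T := R_UniformSpace) (U := C_UniformSpace) phi t.
Proof.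
intros H1 H2.
apply (continuous_ext (fun t => (fst (phi t), snd (phi t)))). { intros; symmetry; apply surjective_pairing. }
apply (continuous_comp_2 (fun t => fst (phi t)) (fun t => snd (phi t)) (fun a b => (a, b))); auto.
apply (continuous_ext (fun p : R * R => p)). { intros [? ?]; reflexivity. }
apply continuous_id.
Qed.

Lemma continuous_components (phi : R -> C) t :
  continuous (T := R_UniformSpace) (U := C_UniformSpace) phi t ->
  continuous (fun t => fst (phi t)) t /\ continuous (fun t => snd (phi t)) t.
Proof.
intros H. split.
- apply (continuous_comp (V := C_UniformSpace) phi fst); auto.
  destruct (phi t). apply (continuous_fst (U := R_UniformSpace) (V := R_UniformSpace)).
- apply (continuous_comp (V := C_UniformSpace) phi snd); auto.
  destruct (phi t). apply (continuous_snd (U := R_UniformSpace) (V := R_UniformSpace)).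
Qed.

Lemma cont_circle_iff (phi : R -> C) :
  cont_circle phi <-> forall t, continuous (T := R_UniformSpace) (U := C_UniformSpace) phi t.
Proof.
split.
- intros H t. exact (continuous_pair phi t (proj1 (H t)) (proj2 (H t))).
- intros H t. apply continuous_components, H.
Qed.

Lemma cont_circle_mult phi psi : cont_circle phi -> cont_circle psi -> cont_circle (fun t => phi t * psi t)%C.
Proof.
intros H1 H2 t. destruct (H1 t) as [a1 b1]. destruct (H2 t) as [a2 b2]. split; simpl.
- apply (continuous_minus (fun t => fst (phi t) * fst (psi t)) (fun t => snd (phi t) * snd (psi t)));
  apply (continuous_mult (K := R_AbsRing)); auto.
- apply (continuous_plus (fun t => fst (phi t) * snd (psi t)) (fun t => snd (phi t) * fst (psi t)));
  apply (continuous_mult (K := R_AbsRing)); auto.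
Qed.

(** Only continuity of [h] is assumed, since this is applied to [h = f'] before [f'] is known to be
    differentiable. *)
Lemma quot_cont_of_continuous (h : C -> C) (z : C) s :
  (forall t, continuous (T := C_UniformSpace) (U := C_UniformSpace) h (z + cexp (s, t))%C) ->
  cont_circle (fun t => quot h z (s, t)).
Proof.
intros H. unfold quot.
assert (C1 : cont_circle (fun t => z + cexp (s, t))%C).
{ apply (cont_circle_cdiff (fun w => z + cexp w)%C (fun w => 0 + cexp w)%C).
  intros t. apply cdiff_plus. apply cdiff_const. apply cdiff_cexp. }
apply cont_circle_mult.
- assert (C2 : cont_circle (fun t => h (z + cexp (s, t))%C)).
  { apply cont_circle_iff. intros t.
    apply (continuous_comp (V := C_UniformSpace) (W := C_UniformSpace) (fun t => z + cexp (s, t))%C h); auto.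
    exact (continuous_pair _ t (proj1 (C1 t)) (proj2 (C1 t))). }
  intros t. destruct (C2 t) as [D1 D2]. split; simpl.
  + apply (continuous_plus (fun t => fst (h (z + cexp (s, t))%C)) (fun _ => - fst (h z))); auto. apply continuous_const.
  + apply (continuous_plus (fun t => snd (h (z + cexp (s, t))%C)) (fun _ => - snd (h z))); auto. apply continuous_const.
- apply (cont_circle_cdiff (fun w => cexp (- w)) (fun w => (-1) * cexp (- w))%C).
  intros t. apply (cdiff_comp cexp Copp). apply cdiff_cexp. apply cdiff_opp.
Qed.

(** Cauchy's formula is differentiated under the integral sign: the candidate for the second
    derivative is the average of the quotients of [f'], and the error is an average of differences
    of Taylor remainders of [f]. *)
Lemma derivative_cdiff f f' z : (forall w, unit_disc w -> cdiff f w (f' w)) -> unit_disc z ->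
  exists m, cdiff f' z m.
Proof.
intros Hf Hzd. destruct (locally_bounded f f' z Hzd Hf) as (rho & M & Hrho & Hz & HM).
assert (HH : holo_near f f' z rho M) by (split; auto).
set (L := 32 * M / rho ^ 2).
assert (Ez : Cmod (z - z) = 0) by (replace (z - z)%C with (RtoC 0) by ring; apply Cmod_0).
assert (HM0 : 0 <= M) by (eapply Rle_trans; [apply Cmod_ge_0 | apply (HM z); lra]).
assert (HL : 0 <= L) by (unfold L; apply Rdiv_le_0_compat; [lra | apply pow_lt, Hrho]).
(* Along the segment [f'] deviates from [f' w] by at most [L * Cmod h], so the mean value estimate
   is quadratic in [h]. *)
assert (Taylor : forall w h, Cmod (w - z) <= rho / 2 -> Cmod h <= rho / 2 ->
  Cmod (f (w + h)%C - f w - h * f' w) <= 2 * L * Cmod h ^ 2).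
{ intros w h Hw Hh.
  replace (f (w + h) - f w - h * f' w)%C with (f (w + h) - f w - f' w * (w + h - w))%C by ring.
  replace (2 * L * Cmod h ^ 2) with (2 * (L * Cmod h) * Cmod (w + h - w)).
  2:{ replace (w + h - w)%C with h by ring. ring. }
  apply complex_mean_value with f'. intros t Ht.
  assert (Ht' : Cmod (RtoC t * (w + h - w)) <= Cmod h).
  { replace (w + h - w)%C with h by ring. rewrite Cmod_mult, Cmod_R, Rabs_pos_eq by lra.
    assert (Hh0 := Cmod_ge_0 h). nra. }
  assert (Hs := Cmod_shift z w (RtoC t * (w + h - w))). split.
  - apply Hf, (unit_disc_shift z _ rho); lra.
  - eapply Rle_trans. apply (derivative_lipschitz f f' z rho M); auto; lra. fold L.
    apply Rmult_le_compat_l; auto.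
    replace (w + RtoC t * (w + h - w) - w)%C with (RtoC t * (w + h - w))%C by ring. exact Ht'. }
set (s := ln (rho / 2)). assert (Es : exp s = rho / 2) by (apply exp_ln; lra).
assert (Ce : forall t, Cmod (cexp (s, t)) = rho / 2) by (intros; rewrite Cmod_cexp; exact Es).
set (m := circle_avg (fun t => quot f' z (s, t))). exists m.
assert (Cf' : cont_circle (fun t => quot f' z (s, t))).
{ apply quot_cont_of_continuous. intros t. apply derivative_continuous with f; auto.
  apply (unit_disc_shift z _ rho). lra. replace (z + cexp (s, t) - z)%C with (cexp (s, t)) by ring. rewrite Ce. lra. }
assert (Quad : forall h, Cmod h <= rho / 2 -> Cmod (f' (z + h)%C - f' z - h * m) <= 16 * L / rho * Cmod h ^ 2).
{ intros h Hh. assert (Szh := Cmod_shift z z h).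
  assert (C0 : cont_circle (fun t => quot f z (s, t))) by (apply (quot_cont f f' z rho M); auto; lra).
  assert (C1 : cont_circle (fun t => quot f (z + h) (s, t))) by (apply (quot_cont f f' z rho M); auto; lra).
  rewrite (cauchy_derivative_disc f f' z rho M (z + h) s HH), (cauchy_derivative_disc f f' z rho M z s HH) by lra.
  unfold m. rewrite <- circle_avg_lin; auto.
  replace (16 * L / rho * Cmod h ^ 2) with (2 * (8 * L / rho * Cmod h ^ 2)) by (field; lra).
  apply circle_avg_le. apply cont_circle_lin; auto.
  intros t. set (e := cexp (s, t)).
  (* The remainder at [z + e] minus the remainder at [z], divided by [e]. Two remainders, the radius
     [rho / 2] and the factor 2 of averaging give [16 * L / rho]. *)
  replace (quot f (z + h) (s, t) - quot f z (s, t) - h * quot f' z (s, t))%C with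
    (((f (z + e + h) - f (z + e) - h * f' (z + e)) - (f (z + h) - f z - h * f' z)) * cexp (- (s, t)))%C.
  2:{ unfold quot, e. replace (z + h + cexp (s, t))%C with (z + cexp (s, t) + h)%C by ring. ring. }
  rewrite Cmod_mult, Cmod_cexp_opp. simpl fst. rewrite Es.
  apply Rmult_le_reg_r with (rho / 2). lra. rewrite Rmult_assoc, Rinv_l, Rmult_1_r by lra.
  eapply Rle_trans. apply Cmod_sub_triangle.
  assert (T1 := Taylor (z + e)%C h). replace (z + e - z)%C with e in T1 by ring.
  assert (He : Cmod e = rho / 2) by apply Ce.
  specialize (T1 ltac:(lra) Hh). assert (T2 := Taylor z h ltac:(lra) Hh).
  replace (8 * L / rho * Cmod h ^ 2 * (rho / 2)) with (2 * L * Cmod h ^ 2 + 2 * L * Cmod h ^ 2) by (field; lra).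
  lra. }
intros eps Heps. set (K := 16 * L / rho) in *.
assert (HK : 0 <= K) by (unfold K; apply Rdiv_le_0_compat; lra).
exists (Rmin (rho / 2) (eps / (K + 1))). split.
- apply Rmin_pos. lra. apply Rdiv_lt_0_compat; lra.
- intros w Hw.
  assert (H1 : Cmod (w - z) < rho / 2) by (eapply Rlt_le_trans; [exact Hw | apply Rmin_l]).
  assert (H2 : Cmod (w - z) < eps / (K + 1)) by (eapply Rlt_le_trans; [exact Hw | apply Rmin_r]).
  apply Rlt_div_r in H2; [ | lra].
  specialize (Quad (w - z)%C ltac:(lra)). replace (z + (w - z))%C with w in Quad by ring.
  eapply Rle_trans. apply Quad. generalize (Cmod_ge_0 (w - z)). intros. nra.
Qed.

(** * Primitives *)

Lemma unit_disc_sqr x y : unit_disc (x, y) <-> x ^ 2 + y ^ 2 < 1.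
Proof.
unfold unit_disc, Cmod; cbn [fst snd]. rewrite <- sqrt_1 at 1. split.
- intros H. apply sqrt_lt_0_alt in H. lra.
- intros H. apply sqrt_lt_1_alt. split; [ nra | lra].
Qed.

Lemma RInt_approx (f : R -> R) a b c eps :
  (forall x, Rmin a b <= x <= Rmax a b -> continuous f x) ->
  (forall x, Rmin a b <= x <= Rmax a b -> Rabs (f x - c) <= eps) ->
  Rabs (RInt f a b - c * (b - a)) <= eps * Rabs (b - a).
Proof.
intros Hc He. rewrite (Rmult_comm eps).
apply (norm_RInt_le_const_abs (V := R_NormedModule) (fun x => f x - c) a b _ eps). exact He.
replace (c * (b - a)) with (scal (b - a) c) by (unfold scal; simpl; unfold mult; simpl; ring).
apply (is_RInt_minus (V := R_NormedModule) f (fun _ => c)).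
apply (RInt_correct (V := R_CompleteNormedModule)), ex_RInt_continuous; auto.
apply (is_RInt_const (V := R_NormedModule)).
Qed.

Definition diff_on_disc (P : R -> R -> R) : Prop :=
  forall x y, unit_disc (x, y) -> exists px py, differentiable_pt_lim P x y px py.

Definition closed_on_disc (P Q : R -> R -> R) : Prop :=
  forall a b c d, a <= b -> c <= d ->
  (forall x y, a <= x <= b -> c <= y <= d -> unit_disc (x, y)) -> circulation P Q a b c d = 0.

(** On an interval the square is largest at an endpoint, so every point of the box is at most as far
    from 0 as some corner. *)
Lemma disc_hull x0 x1 y0 y1 :
  unit_disc (x0, y0) -> unit_disc (x0, y1) -> unit_disc (x1, y0) -> unit_disc (x1, y1) ->
  forall x y, Rmin x0 x1 <= x <= Rmax x0 x1 -> Rmin y0 y1 <= y <= Rmax y0 y1 -> unit_disc (x, y).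
Proof.
rewrite !unit_disc_sqr. intros H1 H2 H3 H4 x y Hx Hy. rewrite unit_disc_sqr.
assert (Hx2 : x ^ 2 <= x0 ^ 2 \/ x ^ 2 <= x1 ^ 2).
{ unfold Rmin, Rmax in Hx. destruct (Rle_dec x0 x1); destruct (Rle_dec 0 x); [right | left | left | right]; nra. }
assert (Hy2 : y ^ 2 <= y0 ^ 2 \/ y ^ 2 <= y1 ^ 2).
{ unfold Rmin, Rmax in Hy. destruct (Rle_dec y0 y1); destruct (Rle_dec 0 y); [right | left | left | right]; nra. }
destruct Hx2, Hy2; lra.
Qed.

Lemma diff_slice_cont_x P x y : diff_on_disc P -> unit_disc (x, y) -> continuous (fun u => P u y) x.
Proof. intros H Hd. destruct (H x y Hd) as (px & py & Hp). eapply continuous_slice_x, Hp. Qed.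

Lemma diff_slice_cont_y P x y : diff_on_disc P -> unit_disc (x, y) -> continuous (fun u => P x u) y.
Proof. intros H Hd. destruct (H x y Hd) as (px & py & Hp). eapply continuous_slice_y, Hp. Qed.

(** [Rmin] and [Rmax] admit corners in any order, as increments of either sign require; reversing a
    direction changes the sign of the integrals along it. *)
Lemma closed_rectangle P Q x0 x1 y0 y1 :
  diff_on_disc P -> diff_on_disc Q -> closed_on_disc P Q ->
  (forall x y, Rmin x0 x1 <= x <= Rmax x0 x1 -> Rmin y0 y1 <= y <= Rmax y0 y1 -> unit_disc (x, y)) ->
  RInt (fun s => P s y0) x0 x1 + RInt (fun s => Q x1 s) y0 y1 =
  RInt (fun s => Q x0 s) y0 y1 + RInt (fun s => P s y1) x0 x1.
Proof.
intros HP HQ Hcl.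
assert (Base : forall x0 x1 y0 y1, x0 <= x1 -> y0 <= y1 ->
  (forall x y, x0 <= x <= x1 -> y0 <= y <= y1 -> unit_disc (x, y)) ->
  RInt (fun s => P s y0) x0 x1 + RInt (fun s => Q x1 s) y0 y1 =
  RInt (fun s => Q x0 s) y0 y1 + RInt (fun s => P s y1) x0 x1).
{ clear - HP HQ Hcl. intros x0 x1 y0 y1 Hx Hy H.
  assert (E := Hcl x0 x1 y0 y1 Hx Hy H). unfold circulation in E.
  assert (EP : forall y, y0 <= y <= y1 -> ex_RInt (fun s => P s y) x0 x1).
  { intros y Hy'. apply (ex_RInt_continuous (fun s => P s y)). rewrite Rmin_left, Rmax_right by auto.
    intros z Hz. apply diff_slice_cont_x; auto. }
  assert (EQ : forall x, x0 <= x <= x1 -> ex_RInt (fun s => Q x s) y0 y1).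
  { intros x Hx'. apply (ex_RInt_continuous (fun s => Q x s)). rewrite Rmin_left, Rmax_right by auto.
    intros z Hz. apply diff_slice_cont_y; auto. }
  assert (E1 : RInt (fun x => P x y0 - P x y1) x0 x1 = RInt (fun s => P s y0) x0 x1 - RInt (fun s => P s y1) x0 x1).
  { apply (RInt_minus (V := R_CompleteNormedModule) (fun s => P s y0) (fun s => P s y1)); apply EP; lra. }
  assert (E2 : RInt (fun y => Q x1 y - Q x0 y) y0 y1 = RInt (fun s => Q x1 s) y0 y1 - RInt (fun s => Q x0 s) y0 y1).
  { apply (RInt_minus (V := R_CompleteNormedModule) (fun s => Q x1 s) (fun s => Q x0 s)); apply EQ; lra. }
  rewrite E1, E2 in E. lra. }
assert (swap : forall (f : R -> R) a b, (forall s, Rmin a b <= s <= Rmax a b -> continuous f s) -> RInt f a b = - RInt f b a).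
{ intros f a b Hc. symmetry. apply (opp_RInt_swap (V := R_CompleteNormedModule)).
  apply (ex_RInt_continuous f). now rewrite Rmin_comm, Rmax_comm. }
intros H.
assert (SP : forall y, Rmin y0 y1 <= y <= Rmax y0 y1 -> RInt (fun s => P s y) x0 x1 = - RInt (fun s => P s y) x1 x0).
{ intros y Hy. apply (swap (fun s => P s y)). intros s Hs. apply diff_slice_cont_x; auto. }
assert (SQ : forall x, Rmin x0 x1 <= x <= Rmax x0 x1 -> RInt (fun s => Q x s) y0 y1 = - RInt (fun s => Q x s) y1 y0).
{ intros x Hx. apply (swap (fun s => Q x s)). intros s Hs. apply diff_slice_cont_y; auto. }
assert (Bx0 : Rmin x0 x1 <= x0 <= Rmax x0 x1) by (split; [apply Rmin_l | apply Rmax_l]).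
assert (Bx1 : Rmin x0 x1 <= x1 <= Rmax x0 x1) by (split; [apply Rmin_r | apply Rmax_r]).
assert (By0 : Rmin y0 y1 <= y0 <= Rmax y0 y1) by (split; [apply Rmin_l | apply Rmax_l]).
assert (By1 : Rmin y0 y1 <= y1 <= Rmax y0 y1) by (split; [apply Rmin_r | apply Rmax_r]).
destruct (Rle_dec x0 x1) as [Hx | Hx]; destruct (Rle_dec y0 y1) as [Hy | Hy].
- rewrite !Rmin_left, !Rmax_right in H by lra. exact (Base _ _ _ _ Hx Hy H).
- rewrite Rmin_left, Rmax_right, Rmin_right, Rmax_left in H by lra.
  generalize (Base x0 x1 y1 y0 ltac:(lra) ltac:(lra) H).
  rewrite (SQ x0 Bx0), (SQ x1 Bx1). lra.
- rewrite Rmin_right, Rmax_left, Rmin_left, Rmax_right in H by lra.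
  generalize (Base x1 x0 y0 y1 ltac:(lra) ltac:(lra) H).
  rewrite (SP y0 By0), (SP y1 By1). lra.
- rewrite !Rmin_right, !Rmax_left in H by lra.
  generalize (Base x1 x0 y1 y0 ltac:(lra) ltac:(lra) H).
  rewrite (SQ x0 Bx0), (SQ x1 Bx1).
  rewrite (SP y0 By0), (SP y1 By1). lra.
Qed.

(** The integral of [P dx + Q dy] along the path from [(0, 0)] to [(x, 0)] to [(x, y)], which stays
    in the disc when its end does. *)
Definition potential (P Q : R -> R -> R) (x y : R) : R :=
  RInt (fun s => P s 0) 0 x + RInt (fun s => Q x s) 0 y.

Lemma dpl_local_bound P x y px py eps : differentiable_pt_lim P x y px py -> 0 < eps ->
  exists del, 0 < del /\ forall u v, Rabs (u - x) < del -> Rabs (v - y) < del -> Rabs (P u v - P x y) <= eps.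
Proof.
intros H Heps. destruct (H (mkposreal 1 Rlt_0_1)) as [d Hd]. cbn [pos] in Hd.
set (K := 1 + Rabs px + Rabs py).
assert (HK : 0 < K) by (unfold K; generalize (Rabs_pos px), (Rabs_pos py); lra).
exists (Rmin d (eps / K)). split.
{ apply Rmin_pos. apply cond_pos. now apply Rdiv_lt_0_compat. }
intros u v Hu Hv.
assert (m1 := Rmin_l d (eps / K)). assert (m2 := Rmin_r d (eps / K)).
specialize (Hd u v ltac:(lra) ltac:(lra)).
assert (Hr : eps / K * K = eps) by (field; lra). set (r := eps / K) in *.
assert (HM : Rmax (Rabs (u - x)) (Rabs (v - y)) <= r) by (apply Rmax_lub; lra).
replace (P u v - P x y) with ((P u v - P x y - (px * (u - x) + py * (v - y))) + (px * (u - x) + py * (v - y))) by ring.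
eapply Rle_trans. apply Rabs_triang.
assert (Rabs (px * (u - x) + py * (v - y)) <= Rabs px * r + Rabs py * r).
{ eapply Rle_trans. apply Rabs_triang. rewrite !Rabs_mult.
  apply Rplus_le_compat; apply Rmult_le_compat_l; try apply Rabs_pos; lra. }
rewrite <- Hr. unfold K. lra.
Qed.

Lemma unit_disc_zero_l x y : unit_disc (x, y) -> unit_disc (0, y).
Proof. rewrite !unit_disc_sqr. nra. Qed.

Lemma unit_disc_zero_r x y : unit_disc (x, y) -> unit_disc (x, 0).
Proof. rewrite !unit_disc_sqr. nra. Qed.

Lemma between_Rabs u x s r : Rabs (u - x) < r -> Rmin x u <= s <= Rmax x u -> Rabs (s - x) < r.
Proof.
intros H Hs. apply Rabs_def2 in H. apply Rabs_def1; unfold Rmin, Rmax in Hs; destruct (Rle_dec x u); lra.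
Qed.

Lemma potential_dpl P Q x y :
  diff_on_disc P -> diff_on_disc Q -> closed_on_disc P Q -> unit_disc (x, y) ->
  differentiable_pt_lim (potential P Q) x y (P x y) (Q x y).
Proof.
intros HP HQ Hcl Hd eps.
assert (He : 0 < eps / 2) by (generalize (cond_pos eps); lra).
destruct (HP x y Hd) as (px & py & Hp). destruct (HQ x y Hd) as (qx & qy & Hq).
destruct (dpl_local_bound _ _ _ _ _ _ Hp He) as [d1 [Hd1 B1]].
destruct (dpl_local_bound _ _ _ _ _ _ Hq He) as [d2 [Hd2 B2]].
assert (Hopen : exists d3, 0 < d3 /\ forall u v, Rabs (u - x) < d3 -> Rabs (v - y) < d3 -> unit_disc (u, v)).
{ exists ((1 - Cmod (x, y)) / 2). unfold unit_disc in *. split. lra.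
  intros u v Hu Hv. replace (u, v) with ((x, y) + (u - x, v - y)%R)%C by (unfold Cplus; simpl; f_equal; ring).
  eapply Rle_lt_trans. apply Cmod_triangle. generalize (Cmod_le_sum (u - x) (v - y)). lra. }
destruct Hopen as [d3 [Hd3 B3]].
assert (Hdel : 0 < Rmin (Rmin d1 d2) d3) by (repeat apply Rmin_pos; auto).
exists (mkposreal _ Hdel). cbn [pos]. intros u v Hu Hv.
assert (M1 := Rmin_l (Rmin d1 d2) d3). assert (M2 := Rmin_r (Rmin d1 d2) d3).
assert (M3 := Rmin_l d1 d2). assert (M4 := Rmin_r d1 d2).
assert (Z0 : forall t d, 0 < d -> Rabs (t - t) < d) by (intros; rewrite Rminus_diag, Rabs_R0; auto).
assert (Duy : unit_disc (u, y)) by (apply B3; auto; lra).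
assert (Duv : unit_disc (u, v)) by (apply B3; lra).
assert (Dx0 := unit_disc_zero_r _ _ Hd). assert (Du0 := unit_disc_zero_r _ _ Duy).
assert (D00 : unit_disc (0, 0)) by apply (unit_disc_zero_l _ _ Dx0).
assert (EPx : forall a b c, unit_disc (a, c) -> unit_disc (b, c) -> forall s, Rmin a b <= s <= Rmax a b -> continuous (fun s => P s c) s).
{ intros a b c Ha Hb s Hs. apply diff_slice_cont_x; auto.
  apply (disc_hull a b c c); auto. rewrite Rmin_left, Rmax_left; lra. }
assert (EQy : forall a b c, unit_disc (c, a) -> unit_disc (c, b) -> forall s, Rmin a b <= s <= Rmax a b -> continuous (fun s => Q c s) s).
{ intros a b c Ha Hb s Hs. apply diff_slice_cont_y; auto.
  apply (disc_hull c c a b); auto. rewrite Rmin_left, Rmax_left; lra. }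
(* Closedness on the rectangle between [(x, 0)] and [(u, y)] moves the horizontal part of the path
   from height 0 to height [y]. *)
assert (Key : potential P Q u v - potential P Q x y = RInt (fun s => P s y) x u + RInt (fun s => Q u s) y v).
{ unfold potential.
  assert (C1 : RInt (fun s => P s 0) 0 x + RInt (fun s => P s 0) x u = RInt (fun s => P s 0) 0 u).
  { apply (RInt_Chasles (V := R_CompleteNormedModule) (fun s => P s 0)); apply (ex_RInt_continuous (fun s => P s 0)); apply EPx; auto. }
  assert (C2 : RInt (fun s => Q u s) 0 y + RInt (fun s => Q u s) y v = RInt (fun s => Q u s) 0 v).
  { apply (RInt_Chasles (V := R_CompleteNormedModule) (fun s => Q u s)); apply (ex_RInt_continuous (fun s => Q u s)); apply EQy; auto. }
  assert (C3 := closed_rectangle P Q x u 0 y HP HQ Hcl (disc_hull x u 0 y Dx0 Hd Du0 Duy)).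
  rewrite <- C1, <- C2. lra. }
rewrite Key.
assert (I1 : Rabs (RInt (fun s => P s y) x u - P x y * (u - x)) <= eps / 2 * Rabs (u - x)).
{ apply RInt_approx. apply EPx; auto. intros s Hs. apply B1; auto. apply between_Rabs with u; auto. lra. }
assert (I2 : Rabs (RInt (fun s => Q u s) y v - Q x y * (v - y)) <= eps / 2 * Rabs (v - y)).
{ apply RInt_approx. apply EQy; auto. intros s Hs. apply B2. lra. apply between_Rabs with v; auto. lra. }
replace (RInt (fun s => P s y) x u + RInt (fun s => Q u s) y v - (P x y * (u - x) + Q x y * (v - y))) with
  ((RInt (fun s => P s y) x u - P x y * (u - x)) + (RInt (fun s => Q u s) y v - Q x y * (v - y))) by ring.
eapply Rle_trans. apply Rabs_triang.
assert (N1 := Rmax_l (Rabs (u - x)) (Rabs (v - y))). assert (N2 := Rmax_r (Rabs (u - x)) (Rabs (v - y))).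
generalize (cond_pos eps). nra.
Qed.

(** Potentials of the real and imaginary parts of [k dz]; their partial derivatives are the
    Cauchy-Riemann equations with derivative [k]. *)
Lemma holo_primitive k k' : (forall w, unit_disc w -> cdiff k w (k' w)) ->
  exists F, forall w, unit_disc w -> cdiff F w (k w).
Proof.
intros H.
assert (D1 : diff_on_disc (fun x y => fst (k (x, y)))) by (intros x y Hd; do 2 eexists; apply cdiff_dpl, H, Hd).
assert (D2 : diff_on_disc (fun x y => snd (k (x, y)))) by (intros x y Hd; do 2 eexists; apply cdiff_dpl, H, Hd).
assert (D3 : diff_on_disc (fun x y => - snd (k (x, y)))).
{ intros x y Hd. destruct (D2 x y Hd) as (px & py & Hp). do 2 eexists. apply dpl_opp, Hp. }
exists (fun z => (potential (fun x y => fst (k (x, y))) (fun x y => - snd (k (x, y))) (fst z) (snd z),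
  potential (fun x y => snd (k (x, y))) (fun x y => fst (k (x, y))) (fst z) (snd z))).
intros [x y] Hd. apply dpl_cdiff; cbn [fst snd].
- apply (potential_dpl (fun x y => fst (k (x, y))) (fun x y => - snd (k (x, y)))); auto.
  intros a b c d Hab Hcd Hr. destruct (holo_circulation k k' a b c d Hab Hcd) as [E1 E2]; auto.
- apply (potential_dpl (fun x y => snd (k (x, y))) (fun x y => fst (k (x, y)))); auto.
  intros a b c d Hab Hcd Hr. destruct (holo_circulation k k' a b c d Hab Hcd) as [E1 E2]; auto.
Qed.

Lemma Cmod_scale_disc t z : 0 <= t <= 1 -> unit_disc z -> unit_disc (RtoC t * z).
Proof.
unfold unit_disc. intros Ht Hz. rewrite Cmod_mult, Cmod_R, Rabs_pos_eq by lra.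
generalize (Cmod_ge_0 z). nra.
Qed.

(** The fundamental theorem of calculus along a radius. It identifies the integral in [T_op] with
    the primitive built along axis-parallel paths. *)
Lemma ray_integral k k' F z : (forall w, unit_disc w -> cdiff k w (k' w)) ->
  (forall w, unit_disc w -> cdiff F w (k w)) -> unit_disc z ->
  RInt (V := C_R_CompleteNormedModule) (fun t : R => (k (RtoC t * z) * z)%C) 0 1 = (F z - F 0)%C.
Proof.
intros Hk HF Hz. apply is_RInt_unique.
assert (Ck : forall t, 0 <= t <= 1 -> continuous (T := R_UniformSpace) (U := C_UniformSpace) (fun t => z * k (RtoC t * z))%C t).
{ intros t Ht.
  destruct (cdiff_along (fun w => z * k w)%C 0 z t (0 * k (0 + RtoC t * z) + z * k' (0 + RtoC t * z)))%C as [d1 d2].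
  { apply cdiff_mult. apply cdiff_const. apply Hk. rewrite Cplus_0_l. apply Cmod_scale_disc; auto. }
  apply (continuous_ext (fun t => z * k (0 + RtoC t * z))%C). { intros. now rewrite Cplus_0_l. }
  apply continuous_pair; [apply (ex_derive_continuous (fun t => fst (z * k (0 + RtoC t * z))%C)) | apply (ex_derive_continuous (fun t => snd (z * k (0 + RtoC t * z))%C))]; eexists; eassumption. }
assert (DF : forall t, 0 <= t <= 1 ->
  is_derive (fun t => fst (F (0 + RtoC t * z))%C) t (fst (z * k (RtoC t * z))%C) /\
  is_derive (fun t => snd (F (0 + RtoC t * z))%C) t (snd (z * k (RtoC t * z))%C)).
{ intros t Ht. assert (Ht' := Cmod_scale_disc t z Ht Hz).
  apply cdiff_along. rewrite Cplus_0_l. apply HF, Ht'. }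
assert (E1 : (0 + RtoC 1 * z)%C = z) by ring.
assert (E0 : (0 + RtoC 0 * z)%C = 0) by ring.
apply (is_RInt_ext (V := C_R_NormedModule) (fun t => z * k (RtoC t * z))%C). { intros; apply Cmult_comm. }
apply (is_RInt_fct_extend_pair (U := R_NormedModule) (V := R_NormedModule) (fun t => z * k (RtoC t * z))%C 0 1).
- assert (Hd := is_RInt_derive (V := R_CompleteNormedModule) (fun t => fst (F (0 + RtoC t * z))%C) (fun t => fst (z * k (RtoC t * z))%C) 0 1).
  rewrite Rmin_left, Rmax_right, E1, E0 in Hd by lra. apply Hd.
  + intros; now apply DF.
  + intros x Hx. exact (proj1 (continuous_components _ _ (Ck x Hx))).
- assert (Hd := is_RInt_derive (V := R_CompleteNormedModule) (fun t => snd (F (0 + RtoC t * z))%C) (fun t => snd (z * k (RtoC t * z))%C) 0 1).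
  rewrite Rmin_left, Rmax_right, E1, E0 in Hd by lra. apply Hd.
  + intros; now apply DF.
  + intros x Hx. exact (proj2 (continuous_components _ _ (Ck x Hx))).
Qed.

Lemma cdiff_ray_integral k k' z : (forall w, unit_disc w -> cdiff k w (k' w)) -> unit_disc z ->
  cdiff (fun z => RInt (V := C_R_CompleteNormedModule) (fun t : R => (k (RtoC t * z) * z)%C) 0 1) z (k z).
Proof.
intros Hk Hz. destruct (holo_primitive k k' Hk) as [F HF].
apply (cdiff_ext_loc (fun z => F z + - F 0)%C) with (1 - Cmod z). { unfold unit_disc in Hz; lra. }
- intros w Hw. symmetry. apply (ray_integral k k'); auto.
  unfold unit_disc. replace w with (z + (w - z))%C by ring. eapply Rle_lt_trans. apply Cmod_triangle. lra.
- eapply cdiff_eq. apply cdiff_plus. apply HF, Hz. apply cdiff_const. apply Cplus_0_r.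
Qed.

(** * The sub-mean value property *)

(* [s] and [t] are logarithmic polar coordinates [z = e^(s + i t)]: the
   half-plane [s < 0] covers the punctured disc. *)
Definition has_laplacian (U Us Ut L : R -> R -> R) : Prop :=
  forall s t, s < 0 -> differentiable_pt_lim U s t (Us s t) (Ut s t) /\
    exists Uss Ust Uts Utt, differentiable_pt_lim Us s t Uss Ust /\
      differentiable_pt_lim Ut s t Uts Utt /\ Uss + Utt = L s t.

Lemma has_laplacian_const c : has_laplacian (fun _ _ => c) (fun _ _ => 0) (fun _ _ => 0) (fun _ _ => 0).
Proof.
intros s t _. split. apply dpl_const. exists 0, 0, 0, 0. repeat split; try apply dpl_const. ring.
Qed.

Lemma has_laplacian_plus U Us Ut L V Vs Vt M :
  has_laplacian U Us Ut L -> has_laplacian V Vs Vt M ->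
  has_laplacian (fun s t => U s t + V s t) (fun s t => Us s t + Vs s t) (fun s t => Ut s t + Vt s t)
    (fun s t => L s t + M s t).
Proof.
intros HU HV s t Hs.
destruct (HU s t Hs) as [U1 (Uss & Ust & Uts & Utt & U2 & U3 & EU)].
destruct (HV s t Hs) as [V1 (Vss & Vst & Vts & Vtt & V2 & V3 & EV)].
split. now apply dpl_plus.
do 4 eexists. split; [ | split]. apply dpl_plus; eassumption. apply dpl_plus; eassumption. lra.
Qed.

Lemma has_laplacian_mult U Us Ut L V Vs Vt M :
  has_laplacian U Us Ut L -> has_laplacian V Vs Vt M ->
  has_laplacian (fun s t => U s t * V s t) (fun s t => Us s t * V s t + U s t * Vs s t)
    (fun s t => Ut s t * V s t + U s t * Vt s t)
    (fun s t => L s t * V s t + U s t * M s t + 2 * (Us s t * Vs s t + Ut s t * Vt s t)).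
Proof.
intros HU HV s t Hs.
destruct (HU s t Hs) as [U1 (Uss & Ust & Uts & Utt & U2 & U3 & EU)].
destruct (HV s t Hs) as [V1 (Vss & Vst & Vts & Vtt & V2 & V3 & EV)].
split. now apply dpl_mult.
do 4 eexists. split; [ | split].
- apply (dpl_plus (fun s t => Us s t * V s t) (fun s t => U s t * Vs s t)); apply dpl_mult; eassumption.
- apply (dpl_plus (fun s t => Ut s t * V s t) (fun s t => U s t * Vt s t)); apply dpl_mult; eassumption.
- rewrite <- EU, <- EV. ring.
Qed.

Lemma has_laplacian_comp (h h1 h2 : R -> R) U Us Ut L :
  has_laplacian U Us Ut L ->
  (forall s t, s < 0 -> is_derive h (U s t) (h1 (U s t)) /\ is_derive h1 (U s t) (h2 (U s t))) ->
  has_laplacian (fun s t => h (U s t)) (fun s t => h1 (U s t) * Us s t) (fun s t => h1 (U s t) * Ut s t)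
    (fun s t => h1 (U s t) * L s t + h2 (U s t) * (Us s t ^ 2 + Ut s t ^ 2)).
Proof.
intros HU Hh s t Hs.
destruct (HU s t Hs) as [U1 (Uss & Ust & Uts & Utt & U2 & U3 & EU)].
destruct (Hh s t Hs) as [d1 d2].
split. now apply dpl_comp1.
do 4 eexists. split; [ | split].
- apply (dpl_mult (fun s t => h1 (U s t)) Us); [apply dpl_comp1; eassumption | eassumption].
- apply (dpl_mult (fun s t => h1 (U s t)) Ut); [apply dpl_comp1; eassumption | eassumption].
- rewrite <- EU. ring.
Qed.

Lemma is_derive_Rpower x r : 0 < x -> is_derive (fun y => Rpower y r) x (r * Rpower x (r - 1)).
Proof. intros Hx. apply is_derive_Reals, derivable_pt_lim_power, Hx. Qed.

Lemma has_laplacian_power r U Us Ut L :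
  has_laplacian U Us Ut L -> (forall s t, 0 < U s t) ->
  has_laplacian (fun s t => Rpower (U s t) r) (fun s t => r * Rpower (U s t) (r - 1) * Us s t)
    (fun s t => r * Rpower (U s t) (r - 1) * Ut s t)
    (fun s t => r * Rpower (U s t) (r - 1) * L s t +
       r * ((r - 1) * Rpower (U s t) (r - 1 - 1)) * (Us s t ^ 2 + Ut s t ^ 2)).
Proof.
intros HU Hpos.
apply (has_laplacian_comp (fun x => Rpower x r) (fun x => r * Rpower x (r - 1)) (fun x => r * ((r - 1) * Rpower x (r - 1 - 1)))); auto.
intros s t _. split. now apply is_derive_Rpower.
apply (is_derive_scal (fun x => Rpower x (r - 1))). now apply is_derive_Rpower.
Qed.

Lemma RInt_lin3 (f g h : R -> R) a b c :
  (forall t, continuous f t) -> (forall t, continuous g t) -> (forall t, continuous h t) ->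
  RInt (fun t => f t - g t - c * h t) a b = RInt f a b - RInt g a b - c * RInt h a b.
Proof.
intros Hf Hg Hh. transitivity (RInt (fun t => f t - g t - (c * h t + 0 * h t)) a b).
- apply RInt_ext. intros; simpl; ring.
- rewrite RInt_lin4; auto. simpl; ring.
Qed.

(* Green's formula for the 1-form [(s - b) *dU - U dt] makes the circular means
   [M(s)] of [U] lie above their tangents; a function with this property that
   is bounded near -oo is nondecreasing. *)
Lemma submean U Us Ut L u0 b :
  has_laplacian U Us Ut L -> (forall s t, s < 0 -> 0 <= L s t) ->
  (forall s, s < 0 -> Ut s (2 * PI) = Ut s 0) ->
  (forall eps, 0 < eps -> exists s0, forall s t, s <= s0 -> Rabs (U s t - u0) <= eps) ->
  b < 0 -> 2 * PI * u0 <= RInt (U b) 0 (2 * PI).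
Proof.
intros HU HL Hper Hlim Hb. assert (Hpi := two_PI_pos).
assert (cU : forall s, s < 0 -> forall t, continuous (U s) t).
{ intros s Hs t. eapply (continuous_slice_y U), HU, Hs. }
assert (cUs : forall s, s < 0 -> forall t, continuous (Us s) t).
{ intros s Hs t. destruct (HU s t Hs) as [_ (? & ? & ? & ? & H & _)]. eapply (continuous_slice_y Us), H. }
(* [N] is the expected derivative of [M], but it serves only as the slope of a supporting line, so
   no integral is differentiated. *)
set (M := fun s => RInt (U s) 0 (2 * PI)). set (N := fun s => RInt (Us s) 0 (2 * PI)).
assert (lin : forall c x y, differentiable_pt_lim (fun s _ => s - c) x y 1 0).
{ intros. apply (dpl_fst_fun (fun s => s - c)). auto_derive; auto; ring. }
assert (Zero : forall (f g : R -> R) a b, (forall x, Rmin a b < x < Rmax a b -> f x = g x) -> RInt (fun x => f x - g x) a b = 0).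
{ intros f g a c H. transitivity (RInt (fun _ : R => 0) a c).
  - apply RInt_ext. intros x Hx. rewrite H; auto. simpl; ring.
  - rewrite RInt_const. unfold scal; simpl; unfold mult; simpl; ring. }
(* The weight [s - c] vanishes on the side [s = c], where only [U] remains; on [s = a] it produces
   the tangent at [a]. The Green integrand is [(c - s) * L]. *)
assert (T1 : forall a c, a < c -> c < 0 -> M a + (c - a) * N a <= M c).
{ intros a c Hac Hc.
  assert (G := green_ge (fun s t => (s - c) * Ut s t) (fun s t => U s t + - ((s - c) * Us s t)) a c 0 (2 * PI)).
  apply Rminus_le_0. replace (M c - (M a + (c - a) * N a)) with (M c - M a - (c - a) * N a) by ring.
  unfold M, N. rewrite <- (RInt_lin3 (U c) (U a) (Us a)) by (first [apply cU | apply cUs]; lra).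
  replace (RInt _ _ _) with (circulation (fun s t => (s - c) * Ut s t) (fun s t => U s t + - ((s - c) * Us s t)) a c 0 (2 * PI)).
  - apply G; try lra. intros s t Hs Ht.
    destruct (HU s t ltac:(lra)) as [U1 (Uss & Ust & Uts & Utt & U2 & U3 & EU)].
    do 4 eexists. split; [ | split].
    + apply dpl_mult. apply lin. eassumption.
    + apply dpl_plus. eassumption. apply (dpl_opp (fun s t => (s - c) * Us s t)). apply dpl_mult. apply lin. eassumption.
    + specialize (HL s t ltac:(lra)). rewrite <- EU in HL. nra.
  - unfold circulation. rewrite Zero, Rplus_0_l.
    + apply RInt_ext. intros; simpl; ring.
    + intros s. rewrite Rmin_left, Rmax_right by lra. intros Hs. rewrite Hper; lra. }
(* To the left of [a] the weight is nonnegative, so the form is taken with the opposite sign. *)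
assert (T2 : forall a c, c < a -> a < 0 -> M a + (c - a) * N a <= M c).
{ intros a c Hac Ha.
  assert (G := green_ge (fun s t => - ((s - c) * Ut s t)) (fun s t => (s - c) * Us s t + - U s t) c a 0 (2 * PI)).
  apply Rminus_le_0. replace (M c - (M a + (c - a) * N a)) with (M c - M a - (c - a) * N a) by ring.
  unfold M, N. rewrite <- (RInt_lin3 (U c) (U a) (Us a)) by (first [apply cU | apply cUs]; lra).
  replace (RInt _ _ _) with (circulation (fun s t => - ((s - c) * Ut s t)) (fun s t => (s - c) * Us s t + - U s t) c a 0 (2 * PI)).
  - apply G; try lra. intros s t Hs Ht.
    destruct (HU s t ltac:(lra)) as [U1 (Uss & Ust & Uts & Utt & U2 & U3 & EU)].
    do 4 eexists. split; [ | split].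
    + apply (dpl_opp (fun s t => (s - c) * Ut s t)). apply dpl_mult. apply lin. eassumption.
    + apply (dpl_plus (fun s t => (s - c) * Us s t) (fun s t => - U s t)). apply dpl_mult. apply lin. eassumption.
      apply dpl_opp. eassumption.
    + specialize (HL s t ltac:(lra)). rewrite <- EU in HL. nra.
  - unfold circulation. rewrite Zero, Rplus_0_l.
    + apply RInt_ext. intros; simpl; ring.
    + intros s. rewrite Rmin_left, Rmax_right by lra. intros Hs. rewrite Hper; lra. }
assert (Mlim : forall eps, 0 < eps -> exists s0, s0 < 0 /\ forall s, s <= s0 -> Rabs (M s - 2 * PI * u0) <= 2 * PI * eps).
{ intros eps Heps. destruct (Hlim eps Heps) as [s1 Hs1].
  exists (Rmin s1 (-1)). split. { eapply Rle_lt_trans. apply Rmin_r. lra. }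
  intros s Hs. assert (m1 := Rmin_l s1 (-1)). assert (m2 := Rmin_r s1 (-1)).
  assert (A := RInt_approx (U s) 0 (2 * PI) u0 eps).
  rewrite Rminus_0_r, (Rabs_pos_eq (2 * PI)) in A by lra. unfold M.
  rewrite (Rmult_comm (2 * PI) u0), (Rmult_comm (2 * PI) eps). apply A.
  - intros; apply cU; lra.
  - intros; apply Hs1; lra. }
(* With a negative slope at [a], the tangent would force [M] to grow without bound towards minus
   infinity; [K] and [c] make this exceed the limit value by more than [2 * PI]. *)
assert (Npos : forall a, a < 0 -> 0 <= N a).
{ intros a Ha. apply Rnot_lt_le. intros Hneg.
  destruct (Mlim 1 Rlt_0_1) as [s0 [Hs0 B]].
  set (K := Rabs (M a) + Rabs (2 * PI * u0) + 2 * PI + 1).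
  assert (HK : 0 < K) by (unfold K; generalize (Rabs_pos (M a)), (Rabs_pos (2 * PI * u0)); lra).
  set (c := Rmin s0 (a - K / (- N a))).
  assert (c1 := Rmin_l s0 (a - K / (- N a))). assert (c2 := Rmin_r s0 (a - K / (- N a))). fold c in c1, c2.
  assert (HKN : 0 < K / (- N a)) by (apply Rdiv_lt_0_compat; lra).
  specialize (T2 a c ltac:(lra) Ha). specialize (B c c1).
  apply Rabs_le_between in B.
  assert (E : K / (- N a) * (- N a) = K) by (field; lra).
  assert (K <= (c - a) * N a) by nra.
  generalize (Rle_abs (2 * PI * u0)), (Rle_abs (- M a)). rewrite Rabs_Ropp. unfold K in *. lra. }
apply le_epsilon. intros e He.
destruct (Mlim (e / (2 * PI))) as [s0 [Hs0 B]]. { apply Rdiv_lt_0_compat; lra. }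
set (a := Rmin s0 (b - 1)).
assert (a1 := Rmin_l s0 (b - 1)). assert (a2 := Rmin_r s0 (b - 1)). fold a in a1, a2.
specialize (B a a1). apply Rabs_le_between in B.
replace (2 * PI * (e / (2 * PI))) with e in B by (field; lra).
specialize (T1 a b ltac:(lra) Hb). specialize (Npos a ltac:(lra)).
fold (M b). assert (0 <= (b - a) * N a) by (apply Rmult_le_pos; lra). lra.
Qed.

(** * Subharmonic functions of a subordinate pair *)

(* With [F = f1 + i f2], [F' = a + i b], [G = g1 + i g2], [G' = c + i d],
   the gradient of [|F|^2] is [2 (Re (conj F F'), - Im (conj F F'))]. *)
Lemma gradient_bound f1 f2 a b g1 g2 c d l :
  0 <= l ->
  let xs := 2 * (f1 * a + f2 * b) in let xt := 2 * (f2 * a - f1 * b) in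
  let ns := l * xs + 2 * (g1 * c + g2 * d) in let nt := l * xt + 2 * (g2 * c - g1 * d) in
  ns ^ 2 + nt ^ 2 <= (l * (f1 * f1 + f2 * f2 + 1) + (g1 * g1 + g2 * g2)) *
     (l * (4 * (a * a + b * b)) + 4 * (c * c + d * d)).
Proof.
intros Hl xs xt ns nt. apply Rminus_le_0.
(* Lagrange's identity for the Cauchy-Schwarz inequality: the first summand is
   [4 l |F G' - F' G|^2], the second comes from the [1] in [X]. The result reads
   [|grad N|^2 <= N * Laplacian N]. *)
replace (_ - _) with (4 * (l * ((f1 * c - f2 * d - a * g1 + b * g2) ^ 2 + (f1 * d + f2 * c - a * g2 - b * g1) ^ 2))
   + 4 * (l * (l * (a * a + b * b) + (c * c + d * d)))) by (unfold ns, nt, xs, xt; ring).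
apply Rplus_le_le_0_compat; apply Rmult_le_pos; try lra; apply Rmult_le_pos; auto.
- apply Rplus_le_le_0_compat; apply pow2_ge_0.
- assert (0 <= l * (a * a + b * b)) by (apply Rmult_le_pos; nra). nra.
Qed.

(** Completing the square [2 |2 r F G' + F' G|^2] leaves [- 8 r^2 |F|^2 |G'|^2 - 2 |F'|^2 |G|^2].
    The condition on [l] lets [2 l |F|^2 |F'|^2] absorb the first term, so that
    [2 r grad X . grad N] costs at most half of [N] times the Laplacian of [X]. *)
Lemma cross_gradient_bound f1 f2 a b g1 g2 c d M r l :
  0 <= r -> c * c + d * d <= M ^ 2 * (a * a + b * b) -> 4 * r ^ 2 * M ^ 2 <= l ->
  let xs := 2 * (f1 * a + f2 * b) in let xt := 2 * (f2 * a - f1 * b) in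
  let ns := l * xs + 2 * (g1 * c + g2 * d) in let nt := l * xt + 2 * (g2 * c - g1 * d) in
  - (/ 2 * (l * (f1 * f1 + f2 * f2 + 1) + (g1 * g1 + g2 * g2)) * (4 * (a * a + b * b)))
    <= 2 * r * (xs * ns + xt * nt).
Proof.
intros Hr Hcd Hl xs xt ns nt.
set (phi := f1 * f1 + f2 * f2). set (e := a * a + b * b).
assert (Hphi : 0 <= phi) by (unfold phi; nra). assert (He : 0 <= e) by (unfold e; nra).
assert (Hl0 : 0 <= l) by (eapply Rle_trans; [ | exact Hl]; generalize (pow2_ge_0 r), (pow2_ge_0 M); nra).
assert (E1 : 2 * r * (xs * ns + xt * nt) = 8 * r * l * phi * e +
   (2 * ((2 * r * (f1 * c - f2 * d) + (a * g1 - b * g2)) ^ 2 + (2 * r * (f1 * d + f2 * c) + (a * g2 + b * g1)) ^ 2)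
    - 8 * r ^ 2 * phi * (c * c + d * d) - 2 * e * (g1 * g1 + g2 * g2))).
{ unfold ns, nt, xs, xt, phi, e. ring. }
assert (S : 0 <= (2 * r * (f1 * c - f2 * d) + (a * g1 - b * g2)) ^ 2 + (2 * r * (f1 * d + f2 * c) + (a * g2 + b * g1)) ^ 2).
{ apply Rplus_le_le_0_compat; apply pow2_ge_0. }
assert (T : 8 * r ^ 2 * phi * (c * c + d * d) <= 2 * l * phi * e).
{ apply Rle_trans with (8 * r ^ 2 * phi * (M ^ 2 * e)).
  - apply Rmult_le_compat_l; auto. generalize (pow2_ge_0 r); nra.
  - replace (8 * r ^ 2 * phi * (M ^ 2 * e)) with (2 * (phi * e) * (4 * r ^ 2 * M ^ 2)) by ring.
    replace (2 * l * phi * e) with (2 * (phi * e) * l) by ring.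
    apply Rmult_le_compat_l; auto. generalize (Rmult_le_pos _ _ Hphi He). lra. }
assert (V : 0 <= 8 * r * l * phi * e) by (repeat apply Rmult_le_pos; lra).
assert (W : 0 <= l * e) by (apply Rmult_le_pos; auto).
rewrite E1. fold phi e. nra.
Qed.

(** The Laplacian of [K X N^r - N^(r+1)], with [P = N^r] and with [lx], [ln] the Laplacians of [X],
    [N]. The Laplacian of [N^r] is nonnegative by [gradient_bound], and the cross term costs half of
    [lx]; what remains is at least [K P lx / 2]. The subtracted part is at most [(r+1)^2 P ln], and
    [ln <= (l + M^2) lx], which dictates the size of [K]. *)
Lemma subharmonic_ge f1 f2 a b g1 g2 c d M r l K P :
  0 <= r -> c * c + d * d <= M ^ 2 * (a * a + b * b) -> 4 * r ^ 2 * M ^ 2 <= l -> 1 <= l ->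
  2 * (r + 1) ^ 2 * (l + M ^ 2) <= K -> 0 < P ->
  let xs := 2 * (f1 * a + f2 * b) in let xt := 2 * (f2 * a - f1 * b) in
  let ns := l * xs + 2 * (g1 * c + g2 * d) in let nt := l * xt + 2 * (g2 * c - g1 * d) in
  let x := f1 * f1 + f2 * f2 + 1 in let n := l * x + (g1 * g1 + g2 * g2) in
  let lx := 4 * (a * a + b * b) in let ln := l * lx + 4 * (c * c + d * d) in
  0 <= K * (lx * P + x * (r * (P / n) * ln + r * ((r - 1) * (P / n / n)) * (ns ^ 2 + nt ^ 2))
         + 2 * (xs * (r * (P / n) * ns) + xt * (r * (P / n) * nt)))
       - ((r + 1) * P * ln + (r + 1) * (r * (P / n)) * (ns ^ 2 + nt ^ 2)).
Proof.
intros Hr Hcd Hl Hl1 HK HP xs xt ns nt x n lx ln.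
assert (G1 := gradient_bound f1 f2 a b g1 g2 c d l ltac:(lra)). cbv zeta in G1.
fold xs xt in G1. fold ns nt in G1. fold x in G1. fold n in G1. fold lx in G1. fold ln in G1.
assert (G2 := cross_gradient_bound f1 f2 a b g1 g2 c d M r l Hr Hcd Hl). cbv zeta in G2.
fold xs xt in G2. fold ns nt in G2. fold x in G2. fold n in G2. fold lx in G2.
assert (Hx : 1 <= x) by (unfold x; nra).
assert (Hn : 0 < n) by (unfold n; nra).
assert (Hlx : 0 <= lx) by (unfold lx; nra).
assert (Hln : ln <= (l + M ^ 2) * lx) by (unfold ln, lx; nra).
assert (Hln0 : 0 <= ln) by (unfold ln; nra).
set (D := ns ^ 2 + nt ^ 2) in *. set (Cr := xs * ns + xt * nt) in *.
assert (HD : 0 <= D) by (unfold D; nra).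
assert (HM : 0 <= M ^ 2) by apply pow2_ge_0.
assert (HK0 : 0 <= K) by (eapply Rle_trans; [ | exact HK]; apply Rmult_le_pos; nra).
replace (K * _ - _) with (P * (K * (lx + x * r / n ^ 2 * (n * ln + (r - 1) * D) + 2 * r * Cr / n)
   - (r + 1) * (ln + r * (D / n)))) by (unfold Cr; field; lra).
apply Rmult_le_pos; [lra | ].
assert (H1 : 0 <= x * r / n ^ 2 * (n * ln + (r - 1) * D)).
{ apply Rmult_le_pos; [ | nra]. apply Rdiv_le_0_compat; [nra | apply pow_lt, Hn]. }
assert (H2 : - (/ 2 * lx) <= 2 * r * Cr / n).
{ apply Rle_div_r; auto. lra. }
assert (H3 : D / n <= ln). { apply Rle_div_l; auto. lra. }
assert (H4 : (r + 1) * (ln + r * (D / n)) <= (r + 1) ^ 2 * ((l + M ^ 2) * lx)).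
{ apply Rle_trans with ((r + 1) ^ 2 * ln). nra. apply Rmult_le_compat_l; auto. apply pow2_ge_0. }
assert (H5 : K * (/ 2 * lx) <= K * (lx + x * r / n ^ 2 * (n * ln + (r - 1) * D) + 2 * r * Cr / n)).
{ apply Rmult_le_compat_l; lra. }
assert (H6 : (2 * (r + 1) ^ 2 * (l + M ^ 2)) * (/ 2 * lx) <= K * (/ 2 * lx)).
{ apply Rmult_le_compat_r; lra. }
lra.
Qed.

(** The Laplacian of [K X^(r+1) - N^(r+1)] for [r <= 0], with [P = X^r] and [Q = N^r]; [Q <= P]
    reflects [X <= N]. The gradient term of [X] takes at most half of [lx] because [r >= -1/2],
    whereas that of [N] has the favourable sign. *)
Lemma subharmonic_lt f1 f2 a b g1 g2 c d M r K P Q :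
  - / 2 <= r <= 0 -> c * c + d * d <= M ^ 2 * (a * a + b * b) ->
  2 * (1 + M ^ 2) <= K -> 0 < Q <= P ->
  let xs := 2 * (f1 * a + f2 * b) in let xt := 2 * (f2 * a - f1 * b) in
  let ns := 1 * xs + 2 * (g1 * c + g2 * d) in let nt := 1 * xt + 2 * (g2 * c - g1 * d) in
  let x := f1 * f1 + f2 * f2 + 1 in let n := 1 * x + (g1 * g1 + g2 * g2) in
  let lx := 4 * (a * a + b * b) in let ln := 1 * lx + 4 * (c * c + d * d) in
  0 <= K * ((r + 1) * P * lx + (r + 1) * (r * (P / x)) * (xs ^ 2 + xt ^ 2))
       - ((r + 1) * Q * ln + (r + 1) * (r * (Q / n)) * (ns ^ 2 + nt ^ 2)).
Proof.
intros Hr Hcd HK HPQ xs xt ns nt x n lx ln.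
assert (Hx : 1 <= x) by (unfold x; nra).
assert (Hn : 0 < n) by (unfold n; nra).
assert (Hlx : 0 <= lx) by (unfold lx; nra).
assert (HD : xs ^ 2 + xt ^ 2 <= x * lx).
{ replace (xs ^ 2 + xt ^ 2) with ((x - 1) * lx) by (unfold xs, xt, x, lx; ring). nra. }
assert (Hln : ln <= (1 + M ^ 2) * lx) by (unfold ln, lx; nra).
assert (Hln0 : 0 <= ln) by (unfold ln; nra).
assert (HM : 0 <= M ^ 2) by apply pow2_ge_0.
set (D := xs ^ 2 + xt ^ 2) in *. set (E := ns ^ 2 + nt ^ 2).
assert (HE : 0 <= E) by (unfold E; nra).
assert (HDx : D / x <= lx) by (apply Rle_div_l; lra).
assert (HEn : 0 <= E / n) by (apply Rdiv_le_0_compat; lra).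
replace (K * _ - _) with ((r + 1) * (P * (K * (lx + r * (D / x))) - Q * (ln + r * (E / n)))) by (field; lra).
apply Rmult_le_pos; [lra | ].
assert (H1 : / 2 * lx <= lx + r * (D / x)) by nra.
assert (H2 : (2 * (1 + M ^ 2)) * (/ 2 * lx) <= K * (lx + r * (D / x))) by (apply Rmult_le_compat; lra).
assert (H3 : Q * (ln + r * (E / n)) <= Q * ((1 + M ^ 2) * lx)) by (apply Rmult_le_compat_l; nra).
assert (H4 : Q * ((1 + M ^ 2) * lx) <= P * (K * (lx + r * (D / x)))) by (apply Rmult_le_compat; nra).
lra.
Qed.

Lemma has_laplacian_eq U Us Ut L Us' Ut' L' :
  has_laplacian U Us Ut L -> (forall s t, Us s t = Us' s t) -> (forall s t, Ut s t = Ut' s t) ->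
  (forall s t, L s t = L' s t) -> has_laplacian U Us' Ut' L'.
Proof.
intros H E1 E2 E3 s t Hs. destruct (H s t Hs) as [U1 (Uss & Ust & Uts & Utt & U2 & U3 & EU)].
rewrite <- E1, <- E2. split; auto. exists Uss, Ust, Uts, Utt.
split; [ | split].
- apply (differentiable_pt_lim_ext Us); auto. exists (mkposreal 1 Rlt_0_1). intros; auto.
- apply (differentiable_pt_lim_ext Ut); auto. exists (mkposreal 1 Rlt_0_1). intros; auto.
- rewrite <- E3; auto.
Qed.

Lemma has_laplacian_scal k U Us Ut L : has_laplacian U Us Ut L ->
  has_laplacian (fun s t => k * U s t) (fun s t => k * Us s t) (fun s t => k * Ut s t) (fun s t => k * L s t).
Proof.
intros H. apply (has_laplacian_eq _ _ _ _ _ _ _ (has_laplacian_mult _ _ _ _ _ _ _ _ (has_laplacian_const k) H));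
intros; ring.
Qed.

(** A polynomial in the coordinates, hence differentiable also at 0, where [Cmod] is not. *)
Definition modsq (z : C) : R := fst z * fst z + snd z * snd z.

(** By the Cauchy-Riemann equations both components of [h] are harmonic, so only the gradient terms
    of their squares survive. The differentiability of [a = h'] supplies the second derivatives. *)
Lemma has_laplacian_modsq (h a : C -> C) :
  (forall w, fst w < 0 -> cdiff h w (a w)) -> (forall w, fst w < 0 -> exists l, cdiff a w l) ->
  has_laplacian (fun s t => modsq (h (s, t)))
   (fun s t => 2 * (fst (h (s, t)) * fst (a (s, t)) + snd (h (s, t)) * snd (a (s, t))))
   (fun s t => 2 * (snd (h (s, t)) * fst (a (s, t)) - fst (h (s, t)) * snd (a (s, t))))
   (fun s t => 4 * modsq (a (s, t))).
Proof.
intros Hh Ha.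
assert (L1 : has_laplacian (fun s t => fst (h (s, t))) (fun s t => fst (a (s, t))) (fun s t => - snd (a (s, t))) (fun _ _ => 0)).
{ intros s t Hs. destruct (Ha (s, t) Hs) as [l Hl]. split.
  - apply cdiff_dpl, Hh, Hs.
  - do 4 eexists. split; [ | split]. apply cdiff_dpl, Hl. apply dpl_opp, (cdiff_dpl _ _ _ _ Hl). simpl; ring. }
assert (L2 : has_laplacian (fun s t => snd (h (s, t))) (fun s t => snd (a (s, t))) (fun s t => fst (a (s, t))) (fun _ _ => 0)).
{ intros s t Hs. destruct (Ha (s, t) Hs) as [l Hl]. split.
  - apply cdiff_dpl, Hh, Hs.
  - do 4 eexists. split; [ | split]. apply (cdiff_dpl _ _ _ _ Hl). apply (cdiff_dpl _ _ _ _ Hl). simpl; ring. }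
assert (L3 := has_laplacian_plus _ _ _ _ _ _ _ _ (has_laplacian_mult _ _ _ _ _ _ _ _ L1 L1) (has_laplacian_mult _ _ _ _ _ _ _ _ L2 L2)).
apply (has_laplacian_eq _ _ _ _ _ _ _ L3); intros; unfold modsq; ring.
Qed.

Lemma modsq_ge_0 z : 0 <= modsq z.
Proof. unfold modsq. nra. Qed.

Lemma modsq_Cmod z : modsq z = Cmod z ^ 2.
Proof. rewrite Cmod2_alt. unfold modsq, Re, Im. ring. Qed.

(** * The functions [X] and [N] on the disc and their subharmonic combinations *)

Definition Xf (F : C -> C) (z : C) : R := modsq (F z) + 1.
Definition Nf (l : R) (F G : C -> C) (z : C) : R := l * Xf F z + modsq (G z).

Lemma Xf_ge_1 F z : 1 <= Xf F z.
Proof. unfold Xf. generalize (modsq_ge_0 (F z)). lra. Qed.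

Lemma Nf_ge l F G z : 1 <= l -> Xf F z <= Nf l F G z.
Proof. intros. unfold Nf. generalize (modsq_ge_0 (G z)), (Xf_ge_1 F z). nra. Qed.

Lemma Rpower_pos x y : 0 < Rpower x y.
Proof. apply exp_pos. Qed.

Lemma Rpower_minus_1 x r : 0 < x -> Rpower x (r - 1) = Rpower x r / x.
Proof.
intros. unfold Rminus. rewrite Rpower_plus, Rpower_Ropp, Rpower_1 by auto. reflexivity.
Qed.

Lemma Rpower_plus_1 x r : 0 < x -> Rpower x (r + 1) = Rpower x r * x.
Proof. intros. rewrite Rpower_plus, Rpower_1 by auto. reflexivity. Qed.

Lemma Rpower_mono_l x y r : 0 <= r -> 0 < x <= y -> Rpower x r <= Rpower y r.
Proof. intros. now apply Rle_Rpower_l. Qed.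

Lemma Rpower_anti_l x y r : r <= 0 -> 0 < x <= y -> Rpower y r <= Rpower x r.
Proof.
intros Hr Hxy. replace r with (- - r) by ring. rewrite !(Rpower_Ropp _ (- r)).
apply Rinv_le_contravar. apply Rpower_pos. apply Rpower_mono_l; lra.
Qed.

Lemma unit_disc_cexp w : fst w < 0 -> unit_disc (cexp w).
Proof. intros H. unfold unit_disc. rewrite Cmod_cexp, <- exp_0. now apply exp_increasing. Qed.

Lemma has_laplacian_modsq_exp (F F' : C -> C) :
  (forall w, unit_disc w -> cdiff F w (F' w)) ->
  let A := fun s t => (cexp (s, t) * F' (cexp (s, t)))%C in
  has_laplacian (fun s t => modsq (F (cexp (s, t))))
   (fun s t => 2 * (fst (F (cexp (s, t))) * fst (A s t) + snd (F (cexp (s, t))) * snd (A s t)))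
   (fun s t => 2 * (snd (F (cexp (s, t))) * fst (A s t) - fst (F (cexp (s, t))) * snd (A s t)))
   (fun s t => 4 * modsq (A s t)).
Proof.
intros HF A.
apply (has_laplacian_modsq (fun w => F (cexp w)) (fun w => cexp w * F' (cexp w))%C).
- intros w Hw. apply cdiff_comp. apply HF, unit_disc_cexp, Hw. apply cdiff_cexp.
- intros w Hw. destruct (derivative_cdiff F F' (cexp w) HF (unit_disc_cexp w Hw)) as [m Hm].
  eexists. apply cdiff_mult. apply cdiff_cexp. apply (cdiff_comp F' cexp). exact Hm. apply cdiff_cexp.
Qed.

Lemma continuous_modsq F F' z : cdiff F z (F' z) ->
  continuous (T := C_UniformSpace) (U := R_UniformSpace) (fun w => modsq (F w)) z.
Proof.
intros H. apply cdiff_continuous in H.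
assert (c1 : continuous (T := C_UniformSpace) (U := R_UniformSpace) (fun w => fst (F w)) z).
{ apply (continuous_comp (V := C_UniformSpace) F fst); auto.
  destruct (F z). apply (continuous_fst (U := R_UniformSpace) (V := R_UniformSpace)). }
assert (c2 : continuous (T := C_UniformSpace) (U := R_UniformSpace) (fun w => snd (F w)) z).
{ apply (continuous_comp (V := C_UniformSpace) F snd); auto.
  destruct (F z). apply (continuous_snd (U := R_UniformSpace) (V := R_UniformSpace)). }
apply (continuous_plus (V := R_NormedModule) (fun w => fst (F w) * fst (F w)) (fun w => snd (F w) * snd (F w)));
apply (continuous_mult (K := R_AbsRing)); auto.
Qed.

Lemma continuous_Rpower {T : UniformSpace} (f : T -> R) r x : 0 < f x -> continuous f x ->
  continuous (fun y => Rpower (f y) r) x.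
Proof.
intros Hpos Hf. apply (continuous_comp f (fun y => Rpower y r)); auto.
apply (ex_derive_continuous (fun y => Rpower y r)). eexists. now apply is_derive_Rpower.
Qed.

(** Continuity at the centre becomes the limit at minus infinity, uniform in the angle. *)
Lemma submean_disc (u : C -> R) Us Ut L b :
  has_laplacian (fun s t => u (cexp (s, t))) Us Ut L -> (forall s t, s < 0 -> 0 <= L s t) ->
  (forall s, s < 0 -> Ut s (2 * PI) = Ut s 0) ->
  continuous (T := C_UniformSpace) (U := R_UniformSpace) u (RtoC 0) ->
  b < 0 -> 2 * PI * u 0 <= RInt (fun t => u (cexp (b, t))) 0 (2 * PI).
Proof.
intros HU HL Hper Hc Hb.
apply (submean (fun s t => u (cexp (s, t))) Us Ut L (u 0) b); auto.
intros eps Heps.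
assert (Hloc := Hc (fun y => Rabs (y - u 0) <= eps)).
assert (Hl : locally (T := C_UniformSpace) (RtoC 0) (fun w => Rabs (u w - u 0) <= eps)).
{ apply Hloc. exists (mkposreal eps Heps). intros y Hy. apply Rlt_le, Hy. }
apply locally_C_Cmod in Hl. destruct Hl as [d [Hd Hl]].
destruct (exp_small d Hd) as [s0 Hs0]. exists s0. intros s t Hs. apply Hl.
replace (cexp (s, t) - 0)%C with (cexp (s, t)) by ring. rewrite Cmod_cexp. now apply Hs0.
Qed.

(** The division-free form of [G' = k F'] with bounded [k]. It persists when both derivatives are
    multiplied by the same function, be it [f] or [phi_a']. *)
Definition subordinate (F G F' G' : C -> C) (M : R) : Prop :=
  (forall w, unit_disc w -> cdiff F w (F' w)) /\
  (forall w, unit_disc w -> cdiff G w (G' w)) /\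
  (forall w, unit_disc w -> Cmod (G' w) <= M * Cmod (F' w)).

Lemma subordinate_modsq F G F' G' M : subordinate F G F' G' M -> forall s t, s < 0 ->
  modsq (cexp (s, t) * G' (cexp (s, t))) <= M ^ 2 * modsq (cexp (s, t) * F' (cexp (s, t))).
Proof.
intros (_ & _ & H) s t Hs. rewrite !modsq_Cmod, !Cmod_mult.
specialize (H (cexp (s, t)) (unit_disc_cexp (s, t) Hs)).
assert (H0 := Cmod_ge_0 (G' (cexp (s, t)))).
assert (Hsq : Cmod (G' (cexp (s, t))) ^ 2 <= (M * Cmod (F' (cexp (s, t)))) ^ 2) by (apply pow_incr; lra).
generalize (pow2_ge_0 (Cmod (cexp (s, t)))). nra.
Qed.

Lemma has_laplacian_Xf F F' : (forall w, unit_disc w -> cdiff F w (F' w)) ->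
  let A := fun s t => (cexp (s, t) * F' (cexp (s, t)))%C in
  has_laplacian (fun s t => Xf F (cexp (s, t)))
   (fun s t => 2 * (fst (F (cexp (s, t))) * fst (A s t) + snd (F (cexp (s, t))) * snd (A s t)))
   (fun s t => 2 * (snd (F (cexp (s, t))) * fst (A s t) - fst (F (cexp (s, t))) * snd (A s t)))
   (fun s t => 4 * modsq (A s t)).
Proof.
intros HF A.
apply (has_laplacian_eq _ _ _ _ _ _ _ (has_laplacian_plus _ _ _ _ _ _ _ _ (has_laplacian_modsq_exp F F' HF) (has_laplacian_const 1)));
  intros; unfold A; ring.
Qed.

Lemma has_laplacian_Nf l F G F' G' M : subordinate F G F' G' M ->
  let A := fun s t => (cexp (s, t) * F' (cexp (s, t)))%C in
  let B := fun s t => (cexp (s, t) * G' (cexp (s, t)))%C in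
  has_laplacian (fun s t => Nf l F G (cexp (s, t)))
   (fun s t => l * (2 * (fst (F (cexp (s, t))) * fst (A s t) + snd (F (cexp (s, t))) * snd (A s t)))
      + 2 * (fst (G (cexp (s, t))) * fst (B s t) + snd (G (cexp (s, t))) * snd (B s t)))
   (fun s t => l * (2 * (snd (F (cexp (s, t))) * fst (A s t) - fst (F (cexp (s, t))) * snd (A s t)))
      + 2 * (snd (G (cexp (s, t))) * fst (B s t) - fst (G (cexp (s, t))) * snd (B s t)))
   (fun s t => l * (4 * modsq (A s t)) + 4 * modsq (B s t)).
Proof.
intros (HF & HG & _) A B.
exact (has_laplacian_plus _ _ _ _ _ _ _ _ (has_laplacian_scal l _ _ _ _ (has_laplacian_Xf F F' HF)) (has_laplacian_modsq_exp G G' HG)).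
Qed.

Lemma unit_disc_0 : unit_disc 0.
Proof. unfold unit_disc. rewrite Cmod_0. lra. Qed.

Lemma continuous_Xf F F' z : cdiff F z (F' z) ->
  continuous (T := C_UniformSpace) (U := R_UniformSpace) (Xf F) z.
Proof.
intros H. apply (continuous_plus (V := R_NormedModule) (fun w => modsq (F w)) (fun _ => 1)).
now apply continuous_modsq with F'. apply continuous_const.
Qed.

Lemma continuous_Nf l F G F' G' z : cdiff F z (F' z) -> cdiff G z (G' z) ->
  continuous (T := C_UniformSpace) (U := R_UniformSpace) (Nf l F G) z.
Proof.
intros HF HG. apply (continuous_plus (V := R_NormedModule) (fun w => l * Xf F w) (fun w => modsq (G w))).
- apply (continuous_mult (K := R_AbsRing) (fun _ => l) (Xf F)). apply continuous_const.
  now apply continuous_Xf with F'.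
- now apply continuous_modsq with G'.
Qed.

Lemma submean_ge F G F' G' M r l K b :
  subordinate F G F' G' M -> 0 <= r -> 4 * r ^ 2 * M ^ 2 <= l -> 1 <= l ->
  2 * (r + 1) ^ 2 * (l + M ^ 2) <= K -> b < 0 ->
  let u := fun z => K * (Xf F z * Rpower (Nf l F G z) r) + -1 * Rpower (Nf l F G z) (r + 1) in
  2 * PI * u 0 <= RInt (fun t => u (cexp (b, t))) 0 (2 * PI).
Proof.
intros HS Hr Hl Hl1 HK Hb u. generalize HS; intros (HF & HG & _).
assert (Npos : forall z, 0 < Nf l F G z) by (intros z; generalize (Nf_ge l F G z Hl1), (Xf_ge_1 F z); lra).
assert (LX := has_laplacian_Xf F F' HF). assert (LN := has_laplacian_Nf l F G F' G' M HS).
cbv zeta in LX, LN.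
assert (LU := has_laplacian_plus _ _ _ _ _ _ _ _
  (has_laplacian_scal K _ _ _ _ (has_laplacian_mult _ _ _ _ _ _ _ _ LX (has_laplacian_power r _ _ _ _ LN (fun s t => Npos (cexp (s, t))))))
  (has_laplacian_scal (-1) _ _ _ _ (has_laplacian_power (r + 1) _ _ _ _ LN (fun s t => Npos (cexp (s, t)))))).
refine (submean_disc u _ _ _ b LU _ _ _ Hb).
- intros s t Hs. cbv beta.
  assert (Hcd := subordinate_modsq F G F' G' M HS s t Hs).
  replace (r + 1 - 1) with r by ring.
  rewrite !Rpower_minus_1 by apply Npos.
  assert (I := subharmonic_ge (fst (F (cexp (s, t)))) (snd (F (cexp (s, t))))
    (fst (cexp (s, t) * F' (cexp (s, t)))%C) (snd (cexp (s, t) * F' (cexp (s, t)))%C)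
    (fst (G (cexp (s, t)))) (snd (G (cexp (s, t))))
    (fst (cexp (s, t) * G' (cexp (s, t)))%C) (snd (cexp (s, t) * G' (cexp (s, t)))%C)
    M r l K (Rpower (Nf l F G (cexp (s, t))) r) Hr Hcd Hl Hl1 HK (Rpower_pos _ _)).
  eapply Rle_trans. exact I. apply Req_le. unfold Nf, Xf, modsq. ring.
- intros s Hs. cbv beta. rewrite !cexp_2PI. reflexivity.
- unfold u. assert (cN := continuous_Nf l F G F' G' 0 (HF _ unit_disc_0) (HG _ unit_disc_0)).
  apply (continuous_plus (V := R_NormedModule) (fun z => K * (Xf F z * Rpower (Nf l F G z) r)) (fun z => -1 * Rpower (Nf l F G z) (r + 1))).
  + apply (continuous_mult (K := R_AbsRing) (fun _ => K)). apply continuous_const.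
    apply (continuous_mult (K := R_AbsRing) (Xf F)). now apply continuous_Xf with F', HF, unit_disc_0.
    now apply continuous_Rpower.
  + apply (continuous_mult (K := R_AbsRing) (fun _ => -1)). apply continuous_const.
    now apply continuous_Rpower.
Qed.

Lemma submean_lt F G F' G' M r K b :
  subordinate F G F' G' M -> - / 2 <= r <= 0 ->
  2 * (1 + M ^ 2) <= K -> b < 0 ->
  let u := fun z => K * Rpower (Xf F z) (r + 1) + -1 * Rpower (Nf 1 F G z) (r + 1) in
  2 * PI * u 0 <= RInt (fun t => u (cexp (b, t))) 0 (2 * PI).
Proof.
intros HS Hr HK Hb u. generalize HS; intros (HF & HG & _).
assert (Xpos : forall z, 0 < Xf F z) by (intros z; generalize (Xf_ge_1 F z); lra).
assert (Npos : forall z, 0 < Nf 1 F G z) by (intros z; generalize (Nf_ge 1 F G z (Rle_refl 1)), (Xf_ge_1 F z); lra).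
assert (LX := has_laplacian_Xf F F' HF). assert (LN := has_laplacian_Nf 1 F G F' G' M HS).
cbv zeta in LX, LN.
assert (LU := has_laplacian_plus _ _ _ _ _ _ _ _
  (has_laplacian_scal K _ _ _ _ (has_laplacian_power (r + 1) _ _ _ _ LX (fun s t => Xpos (cexp (s, t)))))
  (has_laplacian_scal (-1) _ _ _ _ (has_laplacian_power (r + 1) _ _ _ _ LN (fun s t => Npos (cexp (s, t)))))).
refine (submean_disc u _ _ _ b LU _ _ _ Hb).
- intros s t Hs. cbv beta.
  assert (Hcd := subordinate_modsq F G F' G' M HS s t Hs).
  replace (r + 1 - 1) with r by ring.
  rewrite (Rpower_minus_1 (Nf 1 F G (cexp (s, t)))), (Rpower_minus_1 (Xf F (cexp (s, t)))) by (apply Npos || apply Xpos).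
  assert (I := subharmonic_lt (fst (F (cexp (s, t)))) (snd (F (cexp (s, t))))
    (fst (cexp (s, t) * F' (cexp (s, t)))%C) (snd (cexp (s, t) * F' (cexp (s, t)))%C)
    (fst (G (cexp (s, t)))) (snd (G (cexp (s, t))))
    (fst (cexp (s, t) * G' (cexp (s, t)))%C) (snd (cexp (s, t) * G' (cexp (s, t)))%C)
    M r K (Rpower (Xf F (cexp (s, t))) r) (Rpower (Nf 1 F G (cexp (s, t))) r) Hr Hcd HK).
  eapply Rle_trans. apply I.
  + split. apply Rpower_pos. apply Rpower_anti_l. lra. split. apply Xpos. apply Nf_ge; lra.
  + apply Req_le. unfold Nf, Xf, modsq. ring.
- intros s Hs. cbv beta. rewrite !cexp_2PI. reflexivity.
- unfold u. assert (cN := continuous_Nf 1 F G F' G' 0 (HF _ unit_disc_0) (HG _ unit_disc_0)).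
  assert (cX := continuous_Xf F F' 0 (HF _ unit_disc_0)).
  apply (continuous_plus (V := R_NormedModule) (fun z => K * Rpower (Xf F z) (r + 1)) (fun z => -1 * Rpower (Nf 1 F G z) (r + 1))).
  + apply (continuous_mult (K := R_AbsRing) (fun _ => K)). apply continuous_const.
    now apply continuous_Rpower.
  + apply (continuous_mult (K := R_AbsRing) (fun _ => -1)). apply continuous_const.
    now apply continuous_Rpower.
Qed.

(* [A] depends only on [q] and [M]: the same constant serves a whole family of
   pairs, as needed for the seminorm of BMOA. *)
Lemma power_mean_bound q M : / 2 <= q -> 0 <= M -> exists A, 0 <= A /\
  forall F G F' G', subordinate F G F' G' M -> Cmod (G 0) <= M ->
  exists (l : R) (u : C -> R), 1 <= l /\ 
    (forall z, unit_disc z -> continuous (T := C_UniformSpace) (U := R_UniformSpace) u z) /\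
    (forall z, u z <= A * Rpower (Xf F z) q - / 2 * Rpower (Nf l F G z) q) /\
    forall b, b < 0 -> 0 <= RInt (fun t => u (cexp (b, t))) 0 (2 * PI).
Proof.
intros Hq HM. assert (Hpi := two_PI_pos).
assert (HM2 : 0 <= M ^ 2) by apply pow2_ge_0.
destruct (Rle_dec 1 q) as [Hq1 | Hq1].
- set (r := q - 1). assert (Hr : 0 <= r) by (unfold r; lra).
  (* Chosen to meet both [4 r^2 M^2 <= l] and [1 <= l]. *)
  set (l := 4 * r ^ 2 * M ^ 2 + 1).
  assert (Hl : 1 <= l). { unfold l. generalize (pow2_ge_0 r). nra. }
  set (K := 2 * (r + 1) ^ 2 * (l + M ^ 2)).
  assert (HK : l + M ^ 2 <= K).
  { unfold K. assert (1 <= (r + 1) ^ 2) by nra. nra. }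
  exists (K * Rpower (2 * K) r). split. { apply Rmult_le_pos. lra. apply Rlt_le, Rpower_pos. }
  intros F G F' G' HS HG0. generalize HS; intros (HF & HG & _).
  exists l, (fun z => K * (Xf F z * Rpower (Nf l F G z) r) + -1 * Rpower (Nf l F G z) (r + 1)).
  assert (Npos : forall z, 0 < Nf l F G z) by (intros z; generalize (Nf_ge l F G z Hl), (Xf_ge_1 F z); lra).
  split; [exact Hl | split; [ | split]].
  + intros z Hz. assert (cN := continuous_Nf l F G F' G' z (HF _ Hz) (HG _ Hz)).
    apply (continuous_plus (V := R_NormedModule) (fun z => K * (Xf F z * Rpower (Nf l F G z) r)) (fun z => -1 * Rpower (Nf l F G z) (r + 1))).
    * apply (continuous_mult (K := R_AbsRing) (fun _ => K)). apply continuous_const.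
      apply (continuous_mult (K := R_AbsRing) (Xf F)). now apply continuous_Xf with F', HF.
      now apply continuous_Rpower.
    * apply (continuous_mult (K := R_AbsRing) (fun _ => -1)). apply continuous_const.
      now apply continuous_Rpower.
  + intros z. replace q with (r + 1) by (unfold r; ring).
    assert (Hx := Xf_ge_1 F z). assert (Hn := Npos z).
    rewrite !Rpower_plus_1 by lra. set (n := Nf l F G z) in *. set (x := Xf F z) in *.
    assert (P1 := Rpower_pos n r). assert (P2 := Rpower_pos x r). assert (P3 := Rpower_pos (2 * K) r).
    (* If [2 K X <= N], then [K X N^r] is at most half of [N^(r+1)]; otherwise [N^r <= (2 K X)^r],
       the source of the constant [K (2 K)^r]. *)
    destruct (Rle_dec (2 * K * x) n) as [Hc | Hc].
    * assert (0 <= K * Rpower (2 * K) r * (Rpower x r * x)) by (repeat apply Rmult_le_pos; lra).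
      assert (Rpower n r * (2 * K * x) <= Rpower n r * n) by (apply Rmult_le_compat_l; lra). nra.
    * assert (E : Rpower n r <= Rpower (2 * K) r * Rpower x r).
      { rewrite (Rpower_mult_distr (2 * K) x) by lra. apply Rpower_mono_l; lra. }
      assert (K * x * Rpower n r <= K * x * (Rpower (2 * K) r * Rpower x r)).
      { apply Rmult_le_compat_l; auto. apply Rmult_le_pos; lra. }
      assert (0 < Rpower n r * n) by (apply Rmult_lt_0_compat; lra). nra.
  (* It remains to see [u 0 >= 0]: from [|G 0| <= M] and [X >= 1] follows
     [N 0 <= (l + M^2) X 0 <= K X 0]. *)
  + intros b Hb. eapply Rle_trans; [ | apply (submean_ge F G F' G' M r l K b); auto; unfold K, l; lra].
    apply Rmult_le_pos; [lra | ]. rewrite Rpower_plus_1 by apply Npos.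
    replace (K * _ + _) with (Rpower (Nf l F G 0) r * (K * Xf F 0 - Nf l F G 0)) by ring.
    apply Rmult_le_pos. apply Rlt_le, Rpower_pos.
    unfold Nf. rewrite modsq_Cmod. assert (Hx := Xf_ge_1 F 0).
    assert (Cmod (G 0) ^ 2 <= M ^ 2) by (apply pow_incr; split; auto; apply Cmod_ge_0). nra.
- set (r := q - 1). assert (Hr : - / 2 <= r <= 0) by (unfold r; lra).
  set (K := 2 * (1 + M ^ 2)).
  exists K. split. { unfold K; lra. }
  intros F G F' G' HS HG0. generalize HS; intros (HF & HG & _).
  exists 1, (fun z => K * Rpower (Xf F z) (r + 1) + -1 * Rpower (Nf 1 F G z) (r + 1)).
  assert (Xpos : forall z, 0 < Xf F z) by (intros z; generalize (Xf_ge_1 F z); lra).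
  assert (Npos : forall z, 0 < Nf 1 F G z) by (intros z; generalize (Nf_ge 1 F G z (Rle_refl 1)), (Xf_ge_1 F z); lra).
  split; [lra | split; [ | split]].
  + intros z Hz. assert (cN := continuous_Nf 1 F G F' G' z (HF _ Hz) (HG _ Hz)).
    assert (cX := continuous_Xf F F' z (HF _ Hz)).
    apply (continuous_plus (V := R_NormedModule) (fun z => K * Rpower (Xf F z) (r + 1)) (fun z => -1 * Rpower (Nf 1 F G z) (r + 1))).
    * apply (continuous_mult (K := R_AbsRing) (fun _ => K)). apply continuous_const.
      now apply continuous_Rpower.
    * apply (continuous_mult (K := R_AbsRing) (fun _ => -1)). apply continuous_const.
      now apply continuous_Rpower.
  + intros z. replace (r + 1) with q by (unfold r; ring).
    generalize (Rpower_pos (Nf 1 F G z) q). lra.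
  + intros b Hb. eapply Rle_trans; [ | apply (submean_lt F G F' G' M r K b); auto; unfold K; lra].
    apply Rmult_le_pos; [lra | ].
    (* [N 0 <= (1 + M^2) X 0], and the power of [1 + M^2] is at most the number itself because
       [r + 1 <= 1]. *)
    assert (E : Rpower (Nf 1 F G 0) (r + 1) <= Rpower (1 + M ^ 2) 1 * Rpower (Xf F 0) (r + 1)).
    { apply Rle_trans with (Rpower (1 + M ^ 2) (r + 1) * Rpower (Xf F 0) (r + 1)).
      - rewrite Rpower_mult_distr; [ | lra | apply Xpos]. apply Rpower_mono_l. lra. split. apply Npos.
        unfold Nf. rewrite modsq_Cmod. assert (Hx := Xf_ge_1 F 0).
        assert (Cmod (G 0) ^ 2 <= M ^ 2) by (apply pow_incr; split; auto; apply Cmod_ge_0). nra.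
      - apply Rmult_le_compat_r. apply Rlt_le, Rpower_pos. apply Rle_Rpower; lra. }
    rewrite Rpower_1 in E by lra. generalize (Rpower_pos (Xf F 0) (r + 1)). unfold K. nra.
Qed.

(** * Circular means *)

Lemma rpow_ge_0 x p : 0 <= rpow x p.
Proof. unfold rpow. destruct (Req_EM_T x 0). lra. apply Rlt_le, Rpower_pos. Qed.

Lemma rpow_pos_eq x p : 0 < x -> rpow x p = Rpower x p.
Proof. intros H. unfold rpow. destruct (Req_EM_T x 0); lra. Qed.

Lemma rpow_mono x y p : 0 <= p -> 0 <= x <= y -> rpow x p <= rpow y p.
Proof.
intros Hp [Hx Hxy]. destruct (Req_dec x 0) as [-> | Hne].
- unfold rpow at 1. destruct (Req_EM_T 0 0); [apply rpow_ge_0 | lra].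
- rewrite !rpow_pos_eq by lra. apply Rpower_mono_l; lra.
Qed.

Lemma continuous_Cmod (w : C) : continuous (T := C_UniformSpace) (U := R_UniformSpace) Cmod w.
Proof. apply (filterlim_norm (K := C_AbsRing) (V := C_NormedModule)). Qed.

(** At 0 the formula with [Rpower] gives the wrong value, and [x^p <= x] for [x <= 1] is used
    instead; elsewhere [rpow] agrees locally with [Rpower]. *)
Lemma continuous_rpow_Cmod p (w : C) : 1 <= p ->
  continuous (T := C_UniformSpace) (U := R_UniformSpace) (fun v => rpow (Cmod v) p) w.
Proof.
intros Hp. destruct (Req_dec (Cmod w) 0) as [Hw | Hw].
- apply Cmod_eq_0 in Hw. subst w. intros Q [e HQ].
  change (locally (T := C_UniformSpace) (RtoC 0) (fun v => Q (rpow (Cmod v) p))).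
  apply locally_C_Cmod. exists (Rmin 1 e). split. { apply Rmin_pos. lra. apply cond_pos. }
  intros v Hv. replace (v - 0)%C with v in Hv by ring.
  assert (m1 := Rmin_l 1 e). assert (m2 := Rmin_r 1 e). assert (H0 := Cmod_ge_0 v).
  apply HQ. change (Rabs (rpow (Cmod v) p - rpow (Cmod 0) p) < e).
  rewrite Cmod_0. unfold rpow at 2. destruct (Req_EM_T 0 0); [ | lra].
  rewrite Rminus_0_r, Rabs_pos_eq by apply rpow_ge_0.
  apply Rle_lt_trans with (Cmod v); [ | lra].
  destruct (Req_dec (Cmod v) 0) as [Hv0 | Hv0].
  + unfold rpow. destruct (Req_EM_T (Cmod v) 0); lra.
  + rewrite rpow_pos_eq by lra. replace p with (1 + (p - 1)) by ring. rewrite Rpower_plus, Rpower_1 by lra.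
    rewrite <- (Rmult_1_r (Cmod v)) at 3. apply Rmult_le_compat_l; auto.
    apply Rle_trans with (Rpower 1 (p - 1)). apply Rpower_mono_l; lra.
    unfold Rpower. rewrite ln_1, Rmult_0_r, exp_0. lra.
- assert (Hpos : 0 < Cmod w) by (generalize (Cmod_ge_0 w); lra).
  apply (continuous_ext_loc (T := C_UniformSpace) (U := R_UniformSpace) (fun v => rpow (Cmod v) p) (fun v => Rpower (Cmod v) p)).
  + apply locally_C_Cmod. exists (Cmod w). split; auto. intros v Hv. symmetry. apply rpow_pos_eq.
    assert (H := Cmod_sub_triangle w (w - v)). replace (w - (w - v))%C with v in H by ring.
    assert (H2 := Cmod_triangle v (w - v)). replace (v + (w - v))%C with w in H2 by ring.
    rewrite <- (Cmod_opp (w - v)) in H2. replace (- (w - v))%C with (v - w)%C in H2 by ring. lra.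
  + apply (continuous_Rpower (T := C_UniformSpace) Cmod); auto. apply continuous_Cmod.
Qed.

Lemma unit_disc_circle r t : 0 <= r < 1 -> unit_disc (RtoC r * cis t).
Proof. intros H. unfold unit_disc. rewrite Cmod_mult, Cmod_cis, Cmod_R, Rabs_pos_eq; lra. Qed.

Lemma continuous_circle_param r t :
  continuous (T := R_UniformSpace) (U := C_UniformSpace) (fun t => RtoC r * cis t)%C t.
Proof.
apply continuous_pair.
- apply (ex_derive_continuous (fun t => fst (RtoC r * cis t)%C)). unfold cis; simpl. auto_derive; auto.
- apply (ex_derive_continuous (fun t => snd (RtoC r * cis t)%C)). unfold cis; simpl. auto_derive; auto.
Qed.

Lemma continuous_on_circle {U : UniformSpace} (u : C -> U) r :
  (forall z, unit_disc z -> continuous (T := C_UniformSpace) u z) -> 0 <= r < 1 ->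
  forall t, continuous (fun t => u (RtoC r * cis t)%C) t.
Proof.
intros Hu Hr t. apply (continuous_comp (V := C_UniformSpace) (fun t => RtoC r * cis t)%C u).
apply continuous_circle_param. apply Hu, unit_disc_circle, Hr.
Qed.

Definition continuous_on_disc (f : C -> C) : Prop :=
  forall z, unit_disc z -> continuous (T := C_UniformSpace) (U := C_UniformSpace) f z.

Lemma circle_integrand_continuous p f r : 1 <= p -> continuous_on_disc f -> 0 <= r < 1 ->
  forall t, continuous (fun t => rpow (Cmod (f (RtoC r * cis t)%C)) p) t.
Proof.
intros Hp Hf Hr. apply (continuous_on_circle (fun z => rpow (Cmod (f z)) p)); auto.
intros z Hz. apply (continuous_comp (V := C_UniformSpace) f (fun w => rpow (Cmod w) p)).
now apply Hf. now apply continuous_rpow_Cmod.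
Qed.

Lemma circle_mean_ge_0 p f r : 1 <= p -> continuous_on_disc f -> 0 <= r < 1 -> 0 <= circle_mean p f r.
Proof.
intros Hp Hf Hr. assert (Hpi := two_PI_pos). unfold circle_mean.
apply Rmult_le_pos. apply Rlt_le, Rinv_0_lt_compat; lra.
apply RInt_ge_0. lra. apply ex_RInt_cont, circle_integrand_continuous; auto. intros; apply rpow_ge_0.
Qed.

(** The radius 0 is out of reach of logarithmic coordinates and is treated by evaluation. *)
Lemma circle_mean_0 p f : circle_mean p f 0 = rpow (Cmod (f 0)) p.
Proof.
assert (Hpi := two_PI_pos). unfold circle_mean.
transitivity (/ (2 * PI) * RInt (fun _ : R => rpow (Cmod (f 0)) p) 0 (2 * PI)).
- f_equal. apply RInt_ext. intros t _. now rewrite Cmult_0_l.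
- rewrite RInt_const. unfold scal; simpl; unfold mult; simpl. field; lra.
Qed.

Lemma rpow_le_Nf l F G z q : 1 <= l -> 0 < q -> rpow (Cmod (G z)) (2 * q) <= Rpower (Nf l F G z) q.
Proof.
intros Hl Hq. destruct (Req_dec (Cmod (G z)) 0) as [E | E].
- rewrite E. unfold rpow. destruct (Req_EM_T 0 0); [apply Rlt_le, Rpower_pos | lra].
- assert (Hpos : 0 < Cmod (G z)) by (generalize (Cmod_ge_0 (G z)); lra).
  rewrite rpow_pos_eq, <- Rpower_mult by auto.
  apply Rpower_mono_l; [lra | ]. split. apply Rpower_pos.
  replace 2 with (INR 2) by (simpl; ring). rewrite Rpower_pow by auto.
  rewrite <- modsq_Cmod. unfold Nf. generalize (Xf_ge_1 F z). nra.
Qed.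

(** [X] is at most twice the larger of 1 and [|F|^2]. *)
Lemma Xf_power_le F z q : 0 < q -> Rpower (Xf F z) q <= Rpower 2 q * (rpow (Cmod (F z)) (2 * q) + 1).
Proof.
intros Hq. assert (P := Rpower_pos 2 q). assert (Hx := Xf_ge_1 F z). assert (H0 := rpow_ge_0 (Cmod (F z)) (2 * q)).
destruct (Rle_dec (modsq (F z)) 1) as [H | H].
- apply Rle_trans with (Rpower 2 q). apply Rpower_mono_l; [lra | ]. unfold Xf in *; lra. nra.
- assert (Hpos : 0 < Cmod (F z)).
  { destruct (Cmod_ge_0 (F z)) as [| E]; auto. exfalso. apply H. rewrite modsq_Cmod, <- E. lra. }
  apply Rle_trans with (Rpower 2 q * rpow (Cmod (F z)) (2 * q)); [ | nra].
  rewrite rpow_pos_eq, <- Rpower_mult by auto.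
  replace (Rpower (Cmod (F z)) 2) with (modsq (F z)).
  2:{ replace 2 with (INR 2) by (simpl; ring). rewrite Rpower_pow by auto. apply modsq_Cmod. }
  rewrite Rpower_mult_distr by lra. apply Rpower_mono_l; unfold Xf in *; lra.
Qed.

Lemma cexp_ln r t : 0 < r -> cexp (ln r, t) = (RtoC r * cis t)%C.
Proof. intros. rewrite cexp_polar, exp_ln; auto. Qed.

Lemma circle_mean_bound p M : 1 <= p -> 0 <= M -> exists A, 0 <= A /\
  forall F G F' G', subordinate F G F' G' M -> Cmod (G 0) <= M ->
  forall r, 0 <= r < 1 -> circle_mean p G r <= A * (circle_mean p F r + 1).
Proof.
intros Hp HM. assert (Hpi := two_PI_pos). set (q := p / 2).
assert (Hpq : p = 2 * q) by (unfold q; field).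
destruct (power_mean_bound q M) as [A0 [HA0 H]]; auto. { unfold q; lra. }
assert (P2 := Rpower_pos 2 q). assert (PM := rpow_ge_0 M p).
(* The first summand serves for [r > 0], where the 2 undoes the factor [/ 2] before [N^q]; the
   second serves for [r = 0]. *)
exists (2 * A0 * Rpower 2 q + rpow M p). split.
{ apply Rplus_le_le_0_compat; auto. apply Rmult_le_pos; lra. }
intros F G F' G' HS HG0 r Hr. generalize HS; intros (HF & HG & _).
assert (cF : continuous_on_disc F) by (intros z Hz; eapply cdiff_continuous, HF, Hz).
assert (cG : continuous_on_disc G) by (intros z Hz; eapply cdiff_continuous, HG, Hz).
assert (F0 := circle_mean_ge_0 p F r Hp cF Hr).
destruct (proj1 Hr) as [Hr0 | <-].
- destruct (H F G F' G' HS HG0) as (l & u & Hl & Hu & Hub & Hint).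
  (* The bound [0] is rewritten as [ln 1], so that [ln r < 0] comes from [r < 1] by monotonicity. *)
  specialize (Hint (ln r)). rewrite <- ln_1 in Hint. specialize (Hint (ln_increasing _ _ Hr0 (proj2 Hr))).
  rewrite ln_1 in Hint.
  set (f := fun t => rpow (Cmod (F (RtoC r * cis t)%C)) p). set (g := fun t => rpow (Cmod (G (RtoC r * cis t)%C)) p).
  assert (cf : forall t, continuous f t) by (apply circle_integrand_continuous; auto).
  assert (cg : forall t, continuous g t) by (apply circle_integrand_continuous; auto).
  set (B := A0 * Rpower 2 q).
  assert (HB : 0 <= B) by (apply Rmult_le_pos; lra).
  assert (cc : forall c : R, forall t : R, continuous (fun _ : R => c) t) by (intros; apply continuous_const).
  (* The integrand is [B * (f t + 1) - / 2 * g t], arranged to fit [RInt_lin4]. *)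
  assert (E : RInt (fun t => 0 - (- B) - ((- B) * f t + / 2 * g t)) 0 (2 * PI) = B * (RInt f 0 (2 * PI) + 2 * PI) - / 2 * RInt g 0 (2 * PI)).
  { rewrite (RInt_lin4 (fun _ => 0) (fun _ => - B) f g); auto. rewrite !RInt_const. unfold scal; simpl; unfold mult; simpl. ring. }
  assert (Main : 0 <= B * (RInt f 0 (2 * PI) + 2 * PI) - / 2 * RInt g 0 (2 * PI)).
  { rewrite <- E. eapply Rle_trans. apply Hint.
    assert (cu : forall t, continuous (fun t => u (cexp (ln r, t))) t).
    { intros t. apply (continuous_ext (fun t => u (RtoC r * cis t)%C)). { intros; now rewrite cexp_ln. }
      apply (continuous_on_circle (U := R_UniformSpace) u); auto. }
    apply RInt_le. lra. now apply ex_RInt_cont.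
    - apply (ex_RInt_cont (fun t => 0 - (- B) - ((- B) * f t + / 2 * g t))). intros t.
      apply (continuous_minus (V := R_NormedModule) (fun _ => 0 - - B) (fun t => (- B) * f t + / 2 * g t)); auto.
      apply (continuous_plus (V := R_NormedModule) (fun t => (- B) * f t) (fun t => / 2 * g t)).
      apply (continuous_mult (K := R_AbsRing) (fun _ => - B) f); auto.
      apply (continuous_mult (K := R_AbsRing) (fun _ => / 2) g); auto.
    - intros t _. rewrite cexp_ln by auto. unfold f, g. rewrite Hpq.
      set (z := (RtoC r * cis t)%C). specialize (Hub z).
      assert (Hq : 0 < q) by (unfold q; lra).
      assert (G1 := rpow_le_Nf l F G z q Hl Hq). assert (F1 := Xf_power_le F z q Hq).
      assert (A0 * Rpower (Xf F z) q <= A0 * (Rpower 2 q * (rpow (Cmod (F z)) (2 * q) + 1))) by (apply Rmult_le_compat_l; auto).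
      unfold B. lra. }
  unfold circle_mean in *. fold f g. fold f in F0.
  apply Rle_trans with (2 * B * (/ (2 * PI) * RInt f 0 (2 * PI) + 1)).
  + replace (2 * B * (/ (2 * PI) * RInt f 0 (2 * PI) + 1)) with (/ (2 * PI) * (2 * (B * (RInt f 0 (2 * PI) + 2 * PI)))) by (field; lra).
    apply Rmult_le_compat_l. apply Rlt_le, Rinv_0_lt_compat; lra. lra.
  + apply Rmult_le_compat_r. lra. unfold B. lra.
- rewrite circle_mean_0.
  apply Rle_trans with (rpow M p). apply rpow_mono. lra. split; [apply Cmod_ge_0 | auto].
  assert (0 <= 2 * A0 * Rpower 2 q) by (apply Rmult_le_pos; lra). nra.
Qed.

(** * Hardy spaces and BMOA *)

Lemma cdiff_C_derive f z l : cdiff f z l -> C_derive f z = l.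
Proof. intros H. apply is_C_derive_unique, is_derive_cdiff, H. Qed.

Lemma Hol_cdiff f : Hol f <-> forall z, unit_disc z -> cdiff f z (C_derive f z).
Proof.
split.
- intros H z Hz. destruct (H z Hz) as [l Hl]. apply is_derive_cdiff in Hl.
  now rewrite (cdiff_C_derive _ _ _ Hl).
- intros H z Hz. exists (C_derive f z). apply is_derive_cdiff, H, Hz.
Qed.

Lemma Hol_intro f f' : (forall z, unit_disc z -> cdiff f z (f' z)) -> Hol f.
Proof. intros H z Hz. exists (f' z). apply is_derive_cdiff, H, Hz. Qed.


Lemma Hol_derive f : Hol f -> Hol (C_derive f).
Proof.
intros H z Hz. destruct (derivative_cdiff f (C_derive f) z (proj1 (Hol_cdiff f) H) Hz) as [m Hm].
exists m. apply is_derive_cdiff, Hm.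
Qed.

Lemma Hol_mult f g : Hol f -> Hol g -> Hol (fun z => f z * g z)%C.
Proof.
intros Hf Hg. apply (Hol_intro _ (fun z => C_derive f z * g z + f z * C_derive g z)%C).
intros z Hz. apply cdiff_mult; now apply Hol_cdiff.
Qed.

(** The integral along radii is a primitive because [f g'] is holomorphic, which rests on the
    holomorphy of [g']. *)
Lemma T_op_cdiff g f : Hol g -> Hol f ->
  forall z, unit_disc z -> cdiff (T_op g f) z (f z * C_derive g z).
Proof.
intros Hg Hf z Hz.
apply (cdiff_ray_integral (fun w => f w * C_derive g w)%C (C_derive (fun w => f w * C_derive g w)%C)); auto.
apply Hol_cdiff, Hol_mult; auto. now apply Hol_derive.
Qed.

Lemma T_op_0 g f : T_op g f 0 = 0.
Proof.
unfold T_op. transitivity (RInt (V := C_R_CompleteNormedModule) (fun _ : R => RtoC 0) 0 1).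
- apply (RInt_ext (V := C_R_CompleteNormedModule)). intros t _. apply Cmult_0_r.
- rewrite (RInt_const (V := C_R_CompleteNormedModule)). apply (scal_zero_r (V := C_R_NormedModule)).
Qed.

Lemma Hp_norm_pow_finite_iff p f : Rbar_lt (Hp_norm_pow p f) p_infty <->
  exists B, forall r, 0 <= r < 1 -> circle_mean p f r <= B.
Proof.
unfold Hp_norm_pow.
destruct (Lub_Rbar_correct (fun x : R => exists r, 0 <= r < 1 /\ x = circle_mean p f r)) as [Hub Hlub].
split.
- intros H. destruct (Lub_Rbar _) as [x | | ]; [ | contradiction | ].
  + exists x. intros r Hr. apply (Hub (circle_mean p f r)). now exists r.
  + exfalso. apply (Hub (circle_mean p f 0)). exists 0. split; auto. lra.
- intros [B HB]. apply Rbar_le_lt_trans with (Finite B); [ | exact I].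
  apply Hlub. intros x [r [Hr ->]]. now apply HB.
Qed.

Lemma Hardy_iff p f : Hardy p f <-> Hol f /\ exists B, forall r, 0 <= r < 1 -> circle_mean p f r <= B.
Proof. unfold Hardy. now rewrite Hp_norm_pow_finite_iff. Qed.

Lemma Hp_norm_pow_is_lub p f B : 1 <= p -> continuous_on_disc f ->
  (forall r, 0 <= r < 1 -> circle_mean p f r <= B) ->
  exists x, Hp_norm_pow p f = Finite x /\ 0 <= x <= B /\ forall r, 0 <= r < 1 -> circle_mean p f r <= x.
Proof.
intros Hp Hf HB. unfold Hp_norm_pow.
destruct (Lub_Rbar_correct (fun x : R => exists r, 0 <= r < 1 /\ x = circle_mean p f r)) as [Hub Hlub].
assert (H1 : Rbar_le (Lub_Rbar (fun x : R => exists r, 0 <= r < 1 /\ x = circle_mean p f r)) B).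
{ apply Hlub. intros x [r [Hr ->]]. now apply HB. }
assert (H0 := Hub (circle_mean p f 0) (ex_intro _ 0 (conj (conj (Rle_refl 0) Rlt_0_1) eq_refl))).
destruct (Lub_Rbar _) as [x | | ]; [ | contradiction | contradiction].
exists x. split; [reflexivity | split; [split | ]].
- eapply Rle_trans; [ | exact H0]. apply circle_mean_ge_0; auto. lra.
- exact H1.
- intros r Hr. apply (Hub (circle_mean p f r)). now exists r.
Qed.

(** Writing the bound as a [p]-th root keeps the comparison inside one strictly increasing function;
    [B = 0] is separate because [rpow] branches there. *)
Lemma Hp_norm_le_iff p f B : 1 <= p -> continuous_on_disc f -> 0 <= B ->
  Rbar_le (Hp_norm p f) (rpow B (/ p)) <-> forall r, 0 <= r < 1 -> circle_mean p f r <= B.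
Proof.
intros Hp Hf HB.
assert (Hip : 0 < / p) by (apply Rinv_0_lt_compat; lra).
split.
- intros H. unfold Hp_norm in H.
  destruct (Hp_norm_pow p f) as [x | | ] eqn:E; [ | contradiction | ].
  2:{ exfalso. unfold Hp_norm_pow in E. assert (Hub := proj1 (Lub_Rbar_correct (fun x : R => exists r, 0 <= r < 1 /\ x = circle_mean p f r))).
      rewrite E in Hub. apply (Hub (circle_mean p f 0)). exists 0. split; auto. lra. }
  assert (Hx : exists B', forall r, 0 <= r < 1 -> circle_mean p f r <= B').
  { apply Hp_norm_pow_finite_iff. now rewrite E. }
  destruct Hx as [B' HB']. destruct (Hp_norm_pow_is_lub p f B' Hp Hf HB') as (x' & E' & Hx' & Hub).
  rewrite E in E'. injection E' as <-.
  intros r Hr. eapply Rle_trans. now apply Hub.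
  apply Rnot_lt_le. intros Hlt. apply (Rle_not_lt _ _ H).
  rewrite (rpow_pos_eq x) by lra. destruct HB as [HB | <-].
  + rewrite rpow_pos_eq by lra. apply Rlt_Rpower_l; lra.
  + unfold rpow. destruct (Req_EM_T 0 0); [apply Rpower_pos | lra].
- intros H. destruct (Hp_norm_pow_is_lub p f B Hp Hf H) as (x & E & Hx & _).
  unfold Hp_norm. rewrite E. apply rpow_mono; lra.
Qed.

Lemma rpow_surj x p : 0 < p -> 0 <= x -> exists y, 0 <= y /\ x = rpow y (/ p).
Proof.
intros Hp [Hx | <-].
- exists (Rpower x p). split. apply Rlt_le, Rpower_pos.
  rewrite rpow_pos_eq by apply Rpower_pos. rewrite Rpower_mult, Rinv_r, Rpower_1; lra.
- exists 0. split. lra. unfold rpow. destruct (Req_EM_T 0 0); lra.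
Qed.

(** * Disc automorphisms and the seminorm of BMOA *)

(** The source of both facts about [phi]: the denominator does not vanish on the disc, and the
    values stay in the disc. *)
Lemma modsq_phi_identity a z : modsq (1 - Cconj a * z) - modsq (a - z) = (1 - modsq a) * (1 - modsq z).
Proof. destruct a as [a1 a2], z as [x y]. unfold modsq, Cconj; simpl. ring. Qed.

Lemma modsq_lt_1 z : unit_disc z -> 0 < 1 - modsq z.
Proof. unfold unit_disc. intros H. rewrite modsq_Cmod. generalize (Cmod_ge_0 z). nra. Qed.

Lemma phi_denominator_neq_0 a z : unit_disc a -> unit_disc z -> (1 - Cconj a * z)%C <> 0.
Proof.
intros Ha Hz E. assert (H := modsq_phi_identity a z). rewrite E in H.
assert (0 < (1 - modsq a) * (1 - modsq z)) by (apply Rmult_lt_0_compat; now apply modsq_lt_1).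
assert (modsq 0 = 0) by (unfold modsq; simpl; ring). generalize (modsq_ge_0 (a - z)). lra.
Qed.

Lemma unit_disc_phi a z : unit_disc a -> unit_disc z -> unit_disc (phi a z).
Proof.
intros Ha Hz. assert (Hne := phi_denominator_neq_0 a z Ha Hz). unfold unit_disc, phi.
rewrite Cmod_div by auto. assert (Hd := proj1 (Cmod_gt_0 _) Hne).
apply Rlt_div_l; auto. rewrite Rmult_1_l.
assert (H := modsq_phi_identity a z). rewrite !modsq_Cmod in H.
assert (0 < (1 - Cmod a ^ 2) * (1 - Cmod z ^ 2)).
{ rewrite <- !modsq_Cmod. apply Rmult_lt_0_compat; now apply modsq_lt_1. }
generalize (Cmod_ge_0 (a - z)). intros. apply Rnot_le_lt. intros Hle. nra.
Qed.

Lemma phi_0 a : phi a 0 = a.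
Proof. unfold phi. field. Qed.

Lemma cdiff_inv (z : C) : z <> RtoC 0 -> cdiff Cinv z (- / (z * z)).
Proof.
intros Hz eps Heps. assert (Hm := proj1 (Cmod_gt_0 z) Hz). set (m := Cmod z) in *.
(* The first bound keeps [|w| > m / 2]; the error is [|w - z|^2 / (|w| m^2)], and the second bound
   makes it at most [eps * |w - z|]. *)
exists (Rmin (m / 2) (eps * m ^ 3 / 2)). split.
{ apply Rmin_pos. lra. apply Rdiv_lt_0_compat; [ | lra]. apply Rmult_lt_0_compat; auto. now apply pow_lt. }
intros w Hw. assert (m1 := Rmin_l (m / 2) (eps * m ^ 3 / 2)). assert (m2 := Rmin_r (m / 2) (eps * m ^ 3 / 2)).
assert (Hwm : m / 2 < Cmod w).
{ assert (H := Cmod_triangle w (z - w)). replace (w + (z - w))%C with z in H by ring. fold m in H.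
  rewrite <- (Cmod_opp (z - w)) in H. replace (- (z - w))%C with (w - z)%C in H by ring. lra. }
assert (Hw0 : w <> RtoC 0) by (apply Cmod_gt_0; lra).
replace (/ w - / z - (w - z) * - / (z * z))%C with ((w - z) * ((w - z) / (w * (z * z))))%C by (field; auto).
rewrite Cmod_mult, Rmult_comm. apply Rmult_le_compat_r. apply Cmod_ge_0.
assert (Hzz : (z * z)%C <> RtoC 0) by (apply Cmult_neq_0; auto).
rewrite Cmod_div, !Cmod_mult by (apply Cmult_neq_0; auto). fold m.
apply Rle_div_l. { apply Rmult_lt_0_compat. lra. apply Rmult_lt_0_compat; auto. }
assert (H3 : m * (m * m) = m ^ 3) by ring. assert (0 < m * m) by (apply Rmult_lt_0_compat; auto).
apply Rle_trans with (eps * (m / 2 * (m * m))).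
- replace (eps * (m / 2 * (m * m))) with (eps * m ^ 3 / 2) by field. lra.
- apply Rmult_le_compat_l. lra. apply Rmult_le_compat_r; lra.
Qed.

Lemma Hol_phi a : unit_disc a -> Hol (phi a).
Proof.
intros Ha z Hz. assert (Hne := phi_denominator_neq_0 a z Ha Hz).
eexists. apply is_derive_cdiff. unfold phi, Cdiv.
apply (cdiff_mult (fun z => a - z)%C (fun z => / (1 - Cconj a * z))%C).
- apply (cdiff_plus (fun _ => a) Copp). apply cdiff_const. apply cdiff_opp.
- apply (cdiff_comp Cinv (fun z => 1 - Cconj a * z)%C). apply cdiff_inv, Hne.
  apply (cdiff_plus (fun _ => RtoC 1) (fun z => - (Cconj a * z))%C). apply cdiff_const.
  apply (cdiff_comp Copp (fun z => Cconj a * z)%C). apply cdiff_opp.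
  apply cdiff_mult. apply cdiff_const. apply cdiff_id.
Qed.

Lemma cdiff_phi_comp f a z : Hol f -> unit_disc a -> unit_disc z ->
  cdiff (fun z => f (phi a z) - f a)%C z (C_derive (phi a) z * C_derive f (phi a z)).
Proof.
intros Hf Ha Hz. eapply cdiff_eq.
apply (cdiff_plus (fun z => f (phi a z)) (fun _ => - f a)%C).
- apply (cdiff_comp f (phi a)). apply Hol_cdiff; auto. now apply unit_disc_phi. apply Hol_cdiff; auto. now apply Hol_phi.
- apply cdiff_const.
- apply Cplus_0_r.
Qed.

(** Extended reals, suprema and the square root disappear: what remains is one bound on quadratic
    means, uniform in [a] and [r], the form to which [circle_mean_bound] applies. *)
Lemma BMOA_iff f : BMOA f <-> Hardy 2 f /\ exists B, 0 <= B /\ forall a, unit_disc a ->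
  forall r, 0 <= r < 1 -> circle_mean 2 (fun z => f (phi a z) - f a)%C r <= B.
Proof.
unfold BMOA, BMOA_seminorm, Rbar_lub.
destruct (proj2_sig (Rbar_ex_lub (fun y : Rbar => exists a, unit_disc a /\ y = Hp_norm 2 (fun z => (f (phi a z) - f a)%C)))) as [Hub Hlub].
assert (Hc : Hardy 2 f -> forall a, unit_disc a -> continuous_on_disc (fun z => f (phi a z) - f a)%C).
{ intros [Hf _] a Ha z Hz. eapply cdiff_continuous, cdiff_phi_comp; auto. }
split; intros [Hf H]; split; auto; specialize (Hc Hf).
(* A nonnegative [S] is needed to write it as the square root of some [B]. *)
- assert (Hb : exists S, 0 <= S /\ Rbar_le (proj1_sig (Rbar_ex_lub (fun y : Rbar => exists a, unit_disc a /\ y = Hp_norm 2 (fun z => (f (phi a z) - f a)%C)))) (Finite S)).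
  { destruct (proj1_sig _) as [S | | ]; [ | contradiction | ].
    - exists (Rabs S). split. apply Rabs_pos. apply Rle_abs.
    - exists 0. split; [lra | exact I]. }
  destruct Hb as [S [HS Hb]]. destruct (rpow_surj S 2 ltac:(lra) HS) as [B [HB ->]].
  exists B. split; auto. intros a Ha. apply Hp_norm_le_iff; auto; try lra.
  eapply Rbar_le_trans; [ | exact Hb]. apply Hub. now exists a.
- destruct H as [B [HB H]]. apply Rbar_le_lt_trans with (Finite (rpow B (/ 2))); [ | exact I].
  apply Hlub. intros y [a [Ha ->]]. apply Hp_norm_le_iff; auto. lra.
Qed.

(** The derivatives are [f g'] and [f h' = k f g'], so [T_h f] is subordinate to [T_g f], and both
    vanish at 0. *)
Lemma Hardy_T_op p g h f k M : 1 <= p -> 0 <= M -> Hol g -> Hol h -> Hol f ->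
  (forall z, unit_disc z -> Cmod (k z) <= M) ->
  (forall z, unit_disc z -> C_derive h z = (k z * C_derive g z)%C) ->
  Hardy p (T_op g f) -> Hardy p (T_op h f).
Proof.
intros Hp HM Hg Hh Hf Hk E. rewrite !Hardy_iff. intros [_ [B HB]].
split. { apply (Hol_intro _ (fun z => f z * C_derive h z)%C), T_op_cdiff; auto. }
destruct (circle_mean_bound p M Hp HM) as [A [HA H]].
exists (A * (B + 1)). intros r Hr.
eapply Rle_trans. apply (H (T_op g f) (T_op h f) (fun z => f z * C_derive g z)%C (fun z => f z * C_derive h z)%C); auto.
- split; [ | split]; try (apply T_op_cdiff; auto).
  intros z Hz. rewrite E by auto. rewrite !Cmod_mult.
  replace (Cmod (f z) * (Cmod (k z) * Cmod (C_derive g z))) with (Cmod (k z) * (Cmod (f z) * Cmod (C_derive g z))) by ring.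
  apply Rmult_le_compat_r; auto. apply Rmult_le_pos; apply Cmod_ge_0.
- now rewrite T_op_0, Cmod_0.
- apply Rmult_le_compat_l; auto. specialize (HB r Hr). lra.
Qed.

(** The mean estimate is used twice: for [g] and [h] themselves, and for all their compositions with
    [phi_a], where the common factor [phi_a'] leaves [M] unchanged and one constant serves every
    [a]. *)
Lemma BMOA_of_bounded_ratio g h k M : 0 <= M -> BMOA g -> Hol h ->
  (forall z, unit_disc z -> Cmod (k z) <= M) ->
  (forall z, unit_disc z -> C_derive h z = (k z * C_derive g z)%C) -> BMOA h.
Proof.
intros HM. rewrite !BMOA_iff, !Hardy_iff. intros [[Hg [B HB]] [B' [HB0 HB']]] Hh Hk E.
assert (Hsub : forall z, unit_disc z -> Cmod (C_derive h z) <= M * Cmod (C_derive g z)).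
{ intros z Hz. rewrite E, Cmod_mult by auto. apply Rmult_le_compat_r; auto. apply Cmod_ge_0. }
split; [split; auto | ].
(* [h 0] is arbitrary, so the constant is enlarged to dominate it; the functions [h o phi_a - h a]
   below vanish at 0. *)
- assert (HM' : 0 <= M + Cmod (h 0)) by (generalize (Cmod_ge_0 (h 0)); lra).
  destruct (circle_mean_bound 2 (M + Cmod (h 0)) ltac:(lra) HM') as [A [HA H]].
  exists (A * (B + 1)). intros r Hr.
  eapply Rle_trans. apply (H g h (C_derive g) (C_derive h)); auto.
  + split; [ | split]; try (apply Hol_cdiff; auto).
    intros z Hz. eapply Rle_trans. apply Hsub, Hz. apply Rmult_le_compat_r. apply Cmod_ge_0.
    generalize (Cmod_ge_0 (h 0)); lra.
  + lra.
  + apply Rmult_le_compat_l; auto. specialize (HB r Hr). lra.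
- destruct (circle_mean_bound 2 M ltac:(lra) HM) as [A [HA H]].
  exists (A * (B' + 1)). split. { apply Rmult_le_pos; lra. }
  intros a Ha r Hr.
  eapply Rle_trans. apply (H (fun z => g (phi a z) - g a)%C (fun z => h (phi a z) - h a)%C
    (fun z => C_derive (phi a) z * C_derive g (phi a z))%C (fun z => C_derive (phi a) z * C_derive h (phi a z))%C); auto.
  + split; [ | split]; try (intros z Hz; apply cdiff_phi_comp; auto).
    intros z Hz. rewrite !Cmod_mult.
    replace (M * (Cmod (C_derive (phi a) z) * Cmod (C_derive g (phi a z)))) with
      (Cmod (C_derive (phi a) z) * (M * Cmod (C_derive g (phi a z)))) by ring.
    apply Rmult_le_compat_l. apply Cmod_ge_0. apply Hsub, unit_disc_phi; auto.
  + rewrite phi_0. replace (h a - h a)%C with (RtoC 0) by ring. now rewrite Cmod_0.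
  + apply Rmult_le_compat_l; auto. specialize (HB' a Ha r Hr). lra.
Qed.

Theorem proposition5p2 (p : R) (g : C -> C) (hp : 1 <= p) (hg : BMOA g) :
  (forall h : C -> C, T_Hinf_plus_C g h -> V_class g p h) /\
  (forall u B : C -> C,
     BMOA u -> Hinf B ->
     (forall z : C, unit_disc z -> C_derive g z = (B z * C_derive u z)%C) ->
     forall h : C -> C, V_class g p h -> V_class u p h).
Proof.
assert (Hg : Hol g) by apply hg.
split.
- intros h (k & c & [Hk [M HM]] & Eh).
  assert (HM0 : 0 <= M) by (eapply Rle_trans; [apply Cmod_ge_0 | apply (HM 0), unit_disc_0]).
  (* [h] agrees with [T_op g k + c] on the disc only, so the derivative is transported on a small
     disc about [z]. *)
  assert (Dh : forall z, unit_disc z -> cdiff h z (k z * C_derive g z)).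
  { intros z Hz. apply (cdiff_ext_loc (fun z => T_op g k z + c)%C) with (1 - Cmod z).
    - unfold unit_disc in Hz; lra.
    - intros w Hw. symmetry. apply Eh. unfold unit_disc. replace w with (z + (w - z))%C by ring.
      eapply Rle_lt_trans. apply Cmod_triangle. lra.
    - eapply cdiff_eq. apply cdiff_plus. apply T_op_cdiff; auto. apply cdiff_const. apply Cplus_0_r. }
  assert (Hh : Hol h) by exact (Hol_intro h _ Dh).
  assert (E : forall z, unit_disc z -> C_derive h z = (k z * C_derive g z)%C).
  { intros z Hz. now apply cdiff_C_derive, Dh. }
  split.
  + exact (BMOA_of_bounded_ratio g h k M HM0 hg Hh HM E).
  + intros f [Hf HT]. split; [exact Hf | ].
    exact (Hardy_T_op p g h f k M hp HM0 Hg Hh Hf HM E HT).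
(* Since [g' = B u'], the optimal domain of [u] lies in that of [g], which in turn lies in that of
   [h]. *)
- intros u B Hu [HB [M HM]] E h [Hh Hdom].
  assert (HM0 : 0 <= M) by (eapply Rle_trans; [apply Cmod_ge_0 | apply (HM 0), unit_disc_0]).
  split; [exact Hh | ]. intros f [Hf HT]. apply Hdom. split; [exact Hf | ].
  exact (Hardy_T_op p u g f B M hp HM0 (proj1 (proj1 Hu)) Hg Hf HM E HT).
Qed.
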